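(* Let $n\ge 2$ and $p\ge1$ be integers. The Dirichlet eigenvalues of $\mathbb{L}^n_{\pi/p}$ are of the form $K(K+n-1)$ with $K\ge p$ an integer, thus forming a proper subset of those of $\mathbb{S}^n$. The corresponding multiplicities are given by $$m_{n,p}[K(K+n-1)]=\sum_{s=0}^{m}\frac{(sp+r+1)^{\overline{n-2}}}{(n-2)!},$$ where $m=\left\lfloor \frac{K}{p}\right\rfloor-1$ and $r=K\bmod p$.
   Context: $\mathbb{S}^n$ is the unit sphere in $\mathbb{R}^{n+1}$ and $\mathbb{L}^n_{\pi/p}=\{(w,\rho\cos\alpha,\rho\sin\alpha)\in\mathbb{S}^n: w\in\mathbb{R}^{n-1},|w|\le1,\rho=\sqrt{1-|w|^2},\alpha\in[0,\pi/p]\}$. Dirichlet eigenvalues are those of $\Delta u+\lambda u=0$ in the interior, $u=0$ on the boundary, $\Delta$ the Laplace–Beltrami operator of $\mathbb{S}^n$. The rising factorial is $q^{\overline{t}}=q(q+1)\cdots(q+t-1)$, with $q^{\overline{0}}=1$. $r=K\bmod p$ denotes the remainder in $\{0,\dots,p-1\}$. *)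

(* Defs.v *)
From mathcomp Require Export all_boot all_order all_algebra.
From mathcomp Require Export all_classical all_reals all_analysis.
Export Order.TTheory GRing.Theory Num.Theory.
Export numFieldNormedType.Exports.

Set Implicit Arguments.
Unset Strict Implicit.
Unset Printing Implicit Defensive.

Local Open Scope classical_set_scope.
Local Open Scope ring_scope.

Section Sphere.
Context {R : realType}.

(* The library norm on ['rV[R]_d] is the sup norm, which gives the same topology. *)
Definition enorm d (x : 'rV[R]_d) : R := Num.sqrt (\sum_i x 0 i ^+ 2).

(* S^n, in R^(n+1) *)
Definition sphere n : set 'rV[R]_n.+1 := [set x | enorm x = 1].

(* The coordinates 0, ..., n-2 of x are those of w; the last two, of index
   n-1 and n, are [rho * cos alpha] and [rho * sin alpha]. *)
Definition lune (n p : nat) : set 'rV[R]_n.+1 :=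
  [set x | sphere x /\ exists (w : 'rV[R]_n.-1) (alpha : R),
    let rho := Num.sqrt (1 - enorm w ^+ 2) in
    [/\ enorm w <= 1,
        0 <= alpha <= pi / p%:R,
        forall i : 'I_n.-1, x 0 (inord i) = w 0 i,
        x 0 (inord n.-1) = rho * cos alpha
      & x 0 (inord n) = rho * sin alpha]].

Definition sphere_interior n (D : set 'rV[R]_n.+1) : set 'rV[R]_n.+1 :=
  [set x | sphere x /\ within (@sphere n) (nbhs x) D].

(* This is the boundary of D in S^n when D is closed, as the lunes and S^n
   are; for D = S^n it is empty. *)
Definition sphere_boundary n (D : set 'rV[R]_n.+1) : set 'rV[R]_n.+1 :=
  D `\` sphere_interior D.

Definition normalize d (y : 'rV[R]_d) : 'rV[R]_d := (enorm y)^-1 *: y.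

(* The extension of a function on S^n to R^(n+1) \ {0} that is constant along
   rays.  At points of S^n its derivative in the direction v is the derivative
   of the original function along the tangential part of v. *)
Definition ray_ext n (T : Type) (f : 'rV[R]_n.+1 -> T) : 'rV[R]_n.+1 -> T :=
  f \o @normalize n.+1.

Definition partial n (i : 'I_n.+1) (f : 'rV[R]_n.+1 -> R) : 'rV[R]_n.+1 -> R :=
  'D_(delta_mx 0 i) f.

(* By the preceding remark, the i-th entry is the scalar product of the i-th
   standard basis vector with the gradient for the induced metric. *)
Definition sphere_grad n (u : 'rV[R]_n.+1 -> R) (x : 'rV[R]_n.+1) : 'rV[R]_n.+1 :=
  \row_i partial i (ray_ext u) x.

(* For a tangent field X, this is the trace over the tangent space of the
   ambient derivative of X, hence of its covariant derivative. *)
Definition sphere_div n (X : 'rV[R]_n.+1 -> 'rV[R]_n.+1) (x : 'rV[R]_n.+1) : R :=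
  \sum_i partial i (fun y => ray_ext X y 0 i) x.

Definition laplace_beltrami n (u : 'rV[R]_n.+1 -> R) : 'rV[R]_n.+1 -> R :=
  sphere_div (sphere_grad u).

Definition C2_on n (U : set 'rV[R]_n.+1) (f : 'rV[R]_n.+1 -> R) : Prop :=
  forall y, U y -> forall i : 'I_n.+1,
    [/\ derivable f y (delta_mx 0 i),
        {for y, continuous (partial i f)}
      & forall j : 'I_n.+1,
          derivable (partial i f) y (delta_mx 0 j) /\
          {for y, continuous (partial j (partial i f))}].

(* Twice continuously differentiable on a relatively open subset O of S^n:
   the ray-constant extension is so on the open cone over O. *)
Definition sphere_C2_on n (O : set 'rV[R]_n.+1) (u : 'rV[R]_n.+1 -> R) : Prop :=
  C2_on (@normalize n.+1 @^-1` O) (ray_ext u).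

(* A function on D is represented by its extension by zero, so that distinct
   elements of the eigenspace are distinct functions on D.  For D = S^n there
   is no boundary condition and this is the eigenspace of the closed sphere. *)
Definition dirichlet_eigenspace n (D : set 'rV[R]_n.+1) (lambda : R) :
    set ('rV[R]_n.+1 -> R) :=
  [set u | [/\ forall x, ~ D x -> u x = 0,
               {within D, continuous u},
               sphere_C2_on (sphere_interior D) u,
               forall x, sphere_interior D x ->
                 laplace_beltrami u x + lambda * u x = 0
             & forall x, sphere_boundary D x -> u x = 0]].

Definition dirichlet_eigenvalues n (D : set 'rV[R]_n.+1) : set R :=
  [set lambda | exists2 u, dirichlet_eigenspace D lambda u & u <> 0].

Definition has_dim (V : lmodType R) (W : set V) (d : nat) : Prop :=
  exists b : 'I_d -> V,
    (forall c : 'I_d -> R, \sum_i c i *: b i = 0 -> forall i, c i = 0) /\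
    (forall v, W v <-> exists c : 'I_d -> R, v = \sum_i c i *: b i).

Definition has_multiplicity n (D : set 'rV[R]_n.+1) (lambda : R) (d : nat) : Prop :=
  has_dim (dirichlet_eigenspace D lambda : set ('rV[R]_n.+1 -> R)) d.

End Sphere.

Arguments sphere R n : clear implicits.
Arguments lune R n p : clear implicits.

Definition rising_factorial (q t : nat) : nat := (\prod_(0 <= i < t) (q + i))%N.

(* Main.v *)
Require Import Defs.
From HB Require Import structures.
From mathcomp Require Import ring lra zify.
From mathcomp Require mpoly.
Import -(notations) mpoly.

(** Let x, y be the last two coordinates, z = x + i y, and w the others. For a polynomial
    q in w, homogeneous of degree s, and a multiple m = j p of p with j > 0, there is
    exactly one harmonic polynomial of the form
    (q + q_1 |z|^2 + q_2 |z|^4 + ...) Im z^m with all the q_i in w; see hext and lap_hext.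
    It vanishes on the boundary of the lune and is homogeneous of degree K = s + m, so
    its restriction to the lune is an eigenfunction for K (K + n - 1)
    (harmonic_eigenfunction). For fixed K there is one such family for each
    s = K - j p >= 0, of dimension the number of monomials of degree s in n - 1 variables,
    and families with different m are independent, since the square of the infinitesimal
    rotation of the z-plane acts by - m^2 (basis_independent). Summation over s gives
    the formula for the multiplicity, and what has to be proved is that these
    are all the eigenfunctions.

    The span of these polynomials, for fixed K, is the predicate aharm. Its members change
    sign under the reflections that generate the dihedral group of order 2 p, so
    their values on the lune determine them on the whole sphere (aharm_fold). On the
    sphere, the finite sums of such polynomials form a module over the polynomials in w and
    Re z^p: multiplication by a coordinate is the identity var_hext, and multiplication
    by Re z^p a product formula for sines and cosines. By the Stone-Weierstrass
    theorem these sums approximate uniformly every continuous function on the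
    lune that vanishes on the boundary (aharm_dense).

    Let now u be an eigenfunction for lambda. If lambda <= 0, the maximum principle gives
    u = 0 (nonpos_eigen). If lambda > 0, let a > 0 be such that a (a + n - 1) = lambda; then
    the function
    |v|^a u (v / |v|) of a point v is harmonic on the cone over the lune. When a sum of
    antiinvariant harmonics P k of degrees k approximates u within eps, the maximum
    principle on the cone gives |t^a u - (sum of the t^k P k)| <= eps for 0 < t <= 1
    (cone_maximum). Comparing t = 1 and t = 1/2, one finds that the sum of the
    (2^(-k) - 2^(-a)) P k is small. A Cauchy estimate (component_bound), which follows from
    Bernstein's gradient estimate for harmonic functions, passes to the components: each
    P k with k <> a is small. High degrees are controlled by taking t small. Hence u is
    the uniform limit of the components of degree a, and it is zero if there
    is no such degree, that is, if a is not an integer at least p (eigen_limit). For a = K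
    these components lie in a space of finite dimension, which contains its uniform limits
    (span_closed). *)

Set Implicit Arguments.
Unset Strict Implicit.
Unset Printing Implicit Defensive.

Local Open Scope classical_set_scope.
Local Open Scope ring_scope.

(** * The Stone-Weierstrass theorem *)

Section StoneWeierstrass.
Context {R : realType} {T : topologicalType} (K : set T).

(** Continuity on K spelled out with neighbourhoods of T, the form in which the
    covering arguments below use it. *)
Definition cont_on (f : T -> R) := forall y, K y -> forall e, 0 < e ->
  \forall z \near y, K z -> `|f z - f y| < e.

Lemma cont_on_cvg (f : T -> R) :
  (forall y, K y -> f z @[z --> within K (nbhs y)] --> f y) -> cont_on f.
Proof.
move=> cf y Ky e e0.
have /cvgrPdist_lt /(_ e e0) := cf y Ky.
rewrite near_withinE; apply: filterS => z + Kz => /(_ Kz).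
by rewrite distrC.
Qed.

Lemma cont_onP (f : T -> R) : {within K, continuous f} -> cont_on f.
Proof. by move=> /subspace_continuousP; exact: cont_on_cvg. Qed.

Lemma cont_onB (f g : T -> R) :
  cont_on f -> cont_on g -> cont_on (fun x => f x - g x).
Proof.
move=> cf cg y Ky e e0.
have e2 : 0 < e / 2 by rewrite divr_gt0.
near=> z => Kz.
have /(_ Kz) h1 : K z -> `|f z - f y| < e / 2 by near: z; exact: cf.
have /(_ Kz) h2 : K z -> `|g z - g y| < e / 2 by near: z; exact: cg.
have -> : f z - g z - (f y - g y) = (f z - f y) - (g z - g y) by ring.
rewrite (le_lt_trans (ler_normB _ _))// [ltRHS]splitr; lra.
Unshelve. all: by end_near. Qed.

(** A Dini-type argument: the members of L above a given one form a filter base,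
    since L is directed, and compactness of K turns the local inequalities into a
    global one along this filter. *)
Lemma compact_directed_gt (L : set (T -> R)) (f : T -> R) (e : R) :
  compact K -> L !=set0 -> (forall h, L h -> cont_on h) -> cont_on f ->
  (forall h k, L h -> L k -> exists2 l, L l & forall x, h x <= l x /\ k x <= l x) ->
  (forall y, K y -> exists2 h, L h & f y - e < h y) ->
  exists2 h, L h & forall y, K y -> f y - e < h y.
Proof.
move=> /compact_near_coveringP /near_covering_withinP cK [h0 Lh0] cL cf dirL ptw.
pose F : set_system (T -> R) := filter_from L
  (fun h => [set k | L k /\ forall x, h x <= k x]).
have FF : Filter F.
  apply: filter_from_filter; first by exists h0.
  move=> h k Lh Lk; have [l Ll hkl] := dirL _ _ Lh Lk.
  exists l => // m [Lm lm]; split; split => // x; rewrite (le_trans _ (lm x))//.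
    exact: (hkl x).1.
  exact: (hkl x).2.
have [] := cK (T -> R) F (fun h y => f y - e < h y) FF.
  move=> y Ky; have [h Lh fh] := ptw y Ky.
  pose d := h y - (f y - e).
  have d0 : 0 < d by rewrite subr_gt0.
  have chf := cont_onB (cL _ Lh) cf.
  exists ([set z | K z -> `|(h z - f z) - (h y - f y)| < d],
          [set k | L k /\ forall x, h x <= k x]); first split => /=.
  - exact: chf.
  - by exists h.
  move=> [z k] /= [hz [Lk hk]] Kz; have := hz Kz; rewrite ltr_norml => /andP[+ _].
  move: (hk z); rewrite /d => h1 h2.
  lra.
move=> h Lh hK; exists h => //.
by apply: hK; split => // x.
Qed.

Lemma cont_on_bounded (f : T -> R) : compact K -> cont_on f ->
  exists2 M, 0 < M & forall x, K x -> `|f x| <= M.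
Proof.
move=> /compact_near_coveringP /near_covering_withinP cK cf.
have : \forall M \near +oo, K `<=` (fun y => `|f y| <= M).
  apply: (cK R +oo (fun M y => `|f y| <= M)) => y Ky.
  exists ([set z | K z -> `|f z - f y| < 1], [set M | `|f y| + 1 <= M]).
    split => /=; first exact: cf.
    by apply: nbhs_pinfty_ge; rewrite num_real.
  move=> [z M] /= [hz hM] Kz; rewrite (le_trans _ hM)//.
  have := hz Kz; have := ler_normD (f z - f y) (f y); rewrite subrK; lra.
move=> /(filterI (nbhs_pinfty_gt (num_real (0:R)))) /filter_ex [M [M0 hM]].
by exists M.
Qed.

Context (A : set (T -> R)).
Hypothesis cK : compact K.
Hypothesis cA : forall f, A f -> cont_on f.
Hypothesis Ac : forall c, A (fun=> c).
Hypothesis AD : forall f g, A f -> A g -> A (fun x => f x + g x).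
Hypothesis AM : forall f g, A f -> A g -> A (fun x => f x * g x).
Hypothesis Asep : forall x y, K x -> K y -> x <> y -> exists2 f, A f & f x <> f y.

(* The uniform closure of A on K. It has the advantage over A of being closed
   under absolute values. *)
Let B (f : T -> R) := forall e, 0 < e ->
  exists2 g, A g & forall x, K x -> `|f x - g x| < e.

Let BA f : A f -> B f.
Proof. by move=> Af e e0; exists f => // x _; rewrite subrr normr0. Qed.

Let cB f : B f -> cont_on f.
Proof.
move=> Bf y Ky e e0; have e3 : 0 < e / 3 by rewrite divr_gt0.
have [g Ag fg] := Bf _ e3.
near=> z => Kz.
have /(_ Kz) h1 : K z -> `|g z - g y| < e / 3 by near: z; exact: cA.
have h2 := fg z Kz; have h3 := fg y Ky.
move: h1 h2 h3; rewrite !ltr_norml => /andP[? ?] /andP[? ?] /andP[? ?].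
by apply/andP; split; lra.
Unshelve. all: by end_near. Qed.

Let BD f g : B f -> B g -> B (fun x => f x + g x).
Proof.
move=> Bf Bg e e0; have e2 : 0 < e / 2 by rewrite divr_gt0.
have [f' Af' ff'] := Bf _ e2; have [g' Ag' gg'] := Bg _ e2.
exists (fun x => f' x + g' x); first exact: AD.
move=> x Kx; have := ff' x Kx; have := gg' x Kx.
by rewrite !ltr_norml => /andP[? ?] /andP[? ?]; apply/andP; split; lra.
Qed.

Let BZ c f : B f -> B (fun x => c * f x).
Proof.
move=> Bf e e0.
have c0 : 0 < `|c| + 1 by rewrite ltr_pwDr.
have [g Ag fg] := Bf (e / (`|c| + 1)) (divr_gt0 e0 c0).
exists (fun x => c * g x); first by apply: AM.
move=> x Kx; rewrite -mulrBr normrM.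
have := fg x Kx; rewrite ltr_pdivlMr// => h.
apply: le_lt_trans h.
by rewrite mulrC ler_wpM2l// lerDl.
Qed.

(** The iteration p <- p + (s^2 - p^2) / 2 increases to |s| on [-1, 1]; the
    factor 1 - (|s| + p) / 2 of the error gives |s| (1 - |s| / 2)^k, and this
    is at most 2 / (k + 1) by Bernoulli's inequality. *)
Let bern (s : R) k : 0 <= s <= 1 -> s * (1 - s) ^+ k * k.+1%:R <= 1.
Proof.
move=> /andP[s0 s1].
have h1 : (1 - s) ^+ k * (1 + k%:R * s) <= 1.
  elim: k => [|k IH]; first by rewrite expr0 mul1r mul0r addr0.
  apply: le_trans IH; rewrite exprSr -mulrA ler_wpM2l ?exprn_ge0 ?subr_ge0//.
  have -> : (1 - s) * (1 + k.+1%:R * s) = 1 + k%:R * s - k.+1%:R * s ^+ 2.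
    by rewrite -natr1; ring.
  by rewrite gerDl oppr_le0 mulr_ge0// sqr_ge0.
apply: le_trans h1; rewrite [leLHS]mulrAC mulrC ler_wpM2l ?exprn_ge0 ?subr_ge0//.
by rewrite -natr1 mulrDr mulr1 addrC [s * _]mulrC lerD2r.
Qed.

Let Babs f : B f -> B (fun x => `|f x|).
Proof.
move=> Bf e e0; have e2 : 0 < e / 2 by rewrite divr_gt0.
have [g Ag fg] := Bf _ e2.
have [M M0 gM] := cont_on_bounded cK (cA Ag).
pose s x := M^-1 * g x.
have As : A s by apply: AM.
pose p := fix p k : T -> R := if k is k.+1 then
   (fun x => p k x + 2^-1 * (s x * s x + (- 1) * (p k x * p k x))) else (fun=> 0).
have Ap k : A (p k).
  elim: k => [|k IH]; first exact: Ac.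
  by apply: AD => //; apply: AM => //; apply: AD; [exact: AM|do 2 apply: AM => //].
have s1 x : K x -> `|s x| <= 1.
  move=> /gM; rewrite /s normrM gtr0_norm ?invr_gt0// => h.
  by rewrite mulrC ler_pdivrMr// mul1r.
have err k x : K x -> 0 <= p k x <= `|s x| /\
    `|s x| - p k x <= `|s x| * (1 - `|s x| / 2) ^+ k.
  move=> Kx; elim: k => [|k [/andP[p0 ps] IH]] /=.
    by rewrite lexx normr_ge0 subr0 expr0 mulr1.
  have ss : s x * s x = `|s x| * `|s x| by rewrite -!expr2 real_normK ?num_real.
  rewrite ss; move: (s1 _ Kx) p0 ps IH (normr_ge0 (s x)).
  set t := `|s x|; set q := p k x => t1 q0 qt IH t0; split.
    by apply/andP; split; nra.
  rewrite exprSr mulrA.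
  have : 0 <= 1 - t / 2 by lra.
  move=> h; apply: (@le_trans _ _ ((t - q) * (1 - t / 2))); last first.
    by rewrite mulrA ler_wpM2r.
  by nra.
have [k kM] : exists k, 2 * M / k.+1%:R < e / 2.
  exists (Num.truncn (4 * M / e)).
  rewrite ltr_pdivrMr// -ltr_pdivrMl//.
  have -> : (e / 2)^-1 * (2 * M) = 4 * M / e by field; rewrite gt_eqF.
  exact: truncnS_gt.
exists (fun x => M * p k x); first by apply: AM.
move=> x Kx; have [/andP[p0 ps] h] := err k x Kx.
have gs : `|g x| = M * `|s x|.
  by rewrite /s normrM gtr0_norm ?invr_gt0// mulrA divff ?gt_eqF// mul1r.
have h2 : `| `|g x| - M * p k x| <= 2 * M / k.+1%:R.
  rewrite gs -mulrBr normrM gtr0_norm// ger0_norm ?subr_ge0//.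
  rewrite [2 * M]mulrC -mulrA ler_pM2l// (le_trans h)//.
  rewrite ler_pdivlMr//.
  have := @bern (`|s x| / 2) k; have := s1 _ Kx; have := normr_ge0 (s x) => a b.
  have ab : 0 <= `|s x| / 2 <= 1 by apply/andP; split; lra.
  move=> /(_ ab) hb.
  rewrite -[X in _ <= X]mulr1; apply: le_trans (ler_wpM2l _ hb) => //.
  by rewrite le_eqVlt; apply/orP; left; apply/eqP; field.
have h3 := fg x Kx.
have h4 : `| `|f x| - `|g x| | <= `|f x - g x| := ler_dist_dist _ _.
have -> : `|f x| - M * p k x = (`|f x| - `|g x|) + (`|g x| - M * p k x) by ring.
rewrite (le_lt_trans (ler_normD _ _))//.
move: (le_lt_trans h2 kM) (le_lt_trans h4 h3); lra.
Qed.

Let BB f g : B f -> B g -> B (fun x => f x - g x).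
Proof.
move=> Bf Bg; have := BD Bf (BZ (-1) Bg).
by under eq_fun do rewrite mulN1r.
Qed.

Let Bmax f g : B f -> B g -> B (fun x => Num.max (f x) (g x)).
Proof.
move=> Bf Bg.
have := BZ (2^-1) (BD (BD Bf Bg) (Babs (BB Bf Bg))).
suff -> : (fun x => 2^-1 * (f x + g x + `|f x - g x|)) =
  (fun x => Num.max (f x) (g x)) by [].
apply/funext => x; rewrite maxr_absE; ring.
Qed.

Let interp (f : T -> R) x y : K x -> K y -> exists g, [/\ A g, g x = f x & g y = f y].
Proof.
move=> Kx Ky; have [->|/eqP xy] := eqVneq x y.
  by exists (fun=> f y).
have [h Ah hxy] := Asep Kx Ky xy.
have hd : h y - h x != 0 by rewrite subr_eq0 eq_sym; apply/eqP.
exists (fun z => f x + ((f y - f x) / (h y - h x)) * (h z + - h x)).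
split; first by apply: AD => //; apply: AM => //; apply: AD.
  by rewrite subrr mulr0 addr0.
by rewrite mulfVK// addrC subrK.
Qed.

(** A function of B that is at most f at one point and above f - e / 2 on K
    is obtained from two-point interpolation by taking maxima. A second
    family of maxima, of the opposites of such functions, gives one that is close
    to f everywhere. *)
Theorem stone_weierstrass f : cont_on f -> forall e, 0 < e ->
  exists2 g, A g & forall x, K x -> `|f x - g x| < e.
Proof.
move=> cf e e0; have e2 : 0 < e / 2 by rewrite divr_gt0.
have step1 x : K x -> exists2 h, B h & h x <= f x /\ forall y, K y -> f y - e / 2 < h y.
  move=> Kx.
  have := @compact_directed_gt [set h | B h /\ h x <= f x] f (e / 2) cK.
  case.
  - by exists (fun=> f x); split => //=; exact: BA.
  - by move=> h [Bh _]; exact: cB.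
  - exact: cf.
  - move=> h k [Bh hx] [Bk kx]; exists (fun x => Num.max (h x) (k x)).
      by split; [exact: Bmax|rewrite ge_max hx].
    by move=> z; rewrite !le_max !lexx orbT.
  - move=> y Ky; have [g [Ag gx gy]] := @interp f _ _ Kx Ky.
    by exists g; [split; [exact: BA|rewrite /= gx]|rewrite gy; lra].
  by move=> h [Bh hx] hK; exists h.
have [h Bh hK] : exists2 h, B h & forall y, K y -> `|f y - h y| < e / 2.
  have [|||||h [Bh h1] h2] :=
    @compact_directed_gt [set h | B h /\ forall y, K y -> h y < - f y + e / 2]
    (fun x => - f x) (e / 2) cK.
  - have [->|/set0P[x Kx]] := eqVneq K set0.
      by exists (fun=> 0); split => //; exact: BA.
    have [h Bh [_ h1]] := step1 x Kx.
    exists (fun x => - 1 * h x); split; first exact: BZ.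
    by move=> y /h1; lra.
  - by move=> h [Bh _]; exact: cB.
  - move=> y Ky d d0; apply: filterS (cf y Ky d d0) => z /[apply].
    by rewrite -opprD normrN.
  - move=> k l [Bk kx] [Bl lx]; exists (fun x => Num.max (k x) (l x)).
      split; first exact: Bmax.
      by move=> y Ky; rewrite gt_max kx// lx.
    by move=> z; rewrite !le_max !lexx orbT.
  - move=> y Ky; have [k Bk [k1 k2]] := step1 y Ky.
    exists (fun x => - 1 * k x); last by lra.
    by split; [exact: BZ|move=> z /k2; lra].
  exists (fun x => - 1 * h x); first exact: BZ.
  move=> y Ky; have := h1 y Ky; have := h2 y Ky => /= a b.
  by rewrite ltr_norml; apply/andP; split; lra.
have [g Ag hg] := Bh _ e2; exists g => // x Kx.
have := hK x Kx; have := hg x Kx; rewrite !ltr_norml => /andP[? ?] /andP[? ?].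
by apply/andP; split; lra.
Qed.

End StoneWeierstrass.

(** * Differential calculus of polynomials *)

Notation var i := (mpolyX _ (mnm1 i)).

Section PolynomialCalculus.
Context {R : realType} {d : nat}.
Local Notation poly := (mpoly d R).
Implicit Types (p q : poly) (i j : 'I_d).

Lemma mpoly_ring_ind (P : poly -> Prop) :
  (forall c, P (mpolyC d c)) -> (forall i, P (var i)) ->
  (forall p q, P p -> P q -> P (p + q)) -> (forall p q, P p -> P q -> P (p * q)) ->
  forall p, P p.
Proof.
move=> Pc PX PD PM; apply: mpolyind => [|c m p _ _ Pp]; first by rewrite -mpolyC0.
apply: PD => //; rewrite -mul_mpolyC; apply: (PM); first exact: Pc.
rewrite mpolyXE_id; elim/big_rec: _ => [|i q _ Pq]; first by rewrite -mpolyC1.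
apply: (PM) => //; elim: (m i) => [|k IH]; first by rewrite expr0 -mpolyC1.
by rewrite exprS; apply: PM.
Qed.

Definition ev (p : poly) (x : 'rV[R]_d) : R := meval (fun i => x 0 i) p.

Lemma evD p q x : ev (p + q) x = ev p x + ev q x. Proof. exact: mevalD. Qed.
Lemma evB p q x : ev (p - q) x = ev p x - ev q x. Proof. exact: mevalB. Qed.
Lemma evN p x : ev (- p) x = - ev p x. Proof. exact: mevalN. Qed.
Lemma evM p q x : ev (p * q) x = ev p x * ev q x. Proof. exact: mevalM. Qed.
Lemma evZ c p x : ev (c *: p) x = c * ev p x. Proof. exact: mevalZ. Qed.
Lemma evC c x : ev (mpolyC d c) x = c. Proof. exact: mevalC. Qed.
Lemma ev0 x : ev 0 x = 0. Proof. exact: meval0. Qed.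
Lemma ev1 x : ev 1 x = 1. Proof. exact: meval1. Qed.
Lemma ev_var i x : ev (var i) x = x 0 i. Proof. exact: mevalXU. Qed.
Lemma evXn p k x : ev (p ^+ k) x = ev p x ^+ k.
Proof. by elim: k => [|k IH]; rewrite ?expr0 ?ev1// !exprS evM IH. Qed.
Lemma ev_sum I (r : seq I) (P : pred I) (F : I -> poly) x :
  ev (\sum_(i <- r | P i) F i) x = \sum_(i <- r | P i) ev (F i) x.
Proof. exact: (raddf_sum (meval (fun i => x 0 i))). Qed.
Definition evE := (evD, evB, evN, evM, evZ, evC, ev0, ev1, ev_var, evXn).

Lemma mderiv_var i j : mderiv i (var j : poly) = (i == j)%:R.
Proof.
rewrite mderivX mnmE eq_sym; case: eqP => [->|_]; last by rewrite scale0r.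
by rewrite scale1r -[X in mnm_sub X _]add0m addmK mpolyX0.
Qed.

Lemma mderivXn i p k : mderiv i (p ^+ k.+1) = k.+1%:R *: (p ^+ k * mderiv i p).
Proof.
elim: k => [|k IH]; first by rewrite expr0 mul1r scale1r expr1.
by rewrite exprS mderivM IH exprS -!mul_mpolyC !mpolyC_nat; ring.
Qed.

Definition lap p : poly := \sum_i mderiv i (mderiv i p).
Definition gdot p q : poly := \sum_i mderiv i p * mderiv i q.
Definition euler p : poly := \sum_i var i * mderiv i p.

Lemma lap_is_linear : linear lap.
Proof.
move=> c p q; rewrite /lap scaler_sumr -big_split; apply: eq_bigr => i _.
by rewrite !(mderivD, mderivZ).
Qed.
HB.instance Definition _ := GRing.isLinear.Build R poly poly _ lap lap_is_linear.

Lemma lapZ c p : lap (c *: p) = c *: lap p.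
Proof. exact: linearZ. Qed.

Lemma euler_is_linear : linear euler.
Proof.
move=> c p q; rewrite /euler scaler_sumr -big_split; apply: eq_bigr => i _.
by rewrite !(mderivD, mderivZ) mulrDr scalerAr.
Qed.
HB.instance Definition _ := GRing.isLinear.Build R poly poly _ euler euler_is_linear.

Lemma lapM p q : lap (p * q) = lap p * q + 2%:R *: gdot p q + p * lap q.
Proof.
rewrite /lap /gdot mulr_suml mulr_sumr scaler_sumr -!big_split; apply: eq_bigr => i _.
by rewrite /= !(mderivM, mderivD) scaler_nat mulr2n; ring.
Qed.

Lemma eulerM p q : euler (p * q) = euler p * q + p * euler q.
Proof.
rewrite /euler mulr_suml mulr_sumr -big_split; apply: eq_bigr => i _.
by rewrite /= mderivM; ring.
Qed.

Lemma euler_mderiv i p : euler (mderiv i p) = mderiv i (euler p) - mderiv i p.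
Proof.
rewrite /euler raddf_sum /=.
under [in RHS]eq_bigr do rewrite mderivM mderiv_var.
have h : \sum_j (i == j)%:R * mderiv j p = mderiv i p.
  rewrite (bigD1 i)//= eqxx mul1r big1 ?addr0// => j ji.
  by rewrite eq_sym (negbTE ji) mul0r.
rewrite big_split /= h.
rewrite addrAC subrr add0r; apply: eq_bigr => j _.
by rewrite mderiv_comm.
Qed.

Lemma lap_mderiv i p : lap (mderiv i p) = mderiv i (lap p).
Proof.
rewrite /lap raddf_sum; apply: eq_bigr => j _.
by rewrite !(mderiv_comm i j).
Qed.

Lemma lap_varM i p : lap (var i * p) = var i * lap p + 2%:R *: mderiv i p.
Proof.
rewrite lapM addrC; congr (_ + _).
have -> : lap (var i) = 0.
  by rewrite /lap big1// => j _; rewrite mderiv_var -mpolyC_nat mderivC.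
rewrite mul0r add0r /gdot (bigD1 i)//= mderiv_var eqxx mul1r big1 ?addr0// => j ji.
by rewrite mderiv_var (negbTE ji) mul0r.
Qed.

(** Homogeneity of degree k, in the form of Euler's identity: unlike a condition
    on monomials, it passes through products and derivatives by computation. *)
Definition hom (k : nat) p := euler p = k%:R *: p.

Lemma eulerC c : euler (mpolyC d c) = 0.
Proof. by rewrite /euler big1// => i _; rewrite mderivC mulr0. Qed.

Lemma euler_var i : euler (var i) = var i.
Proof.
rewrite /euler (bigD1 i)//= mderiv_var eqxx mulr1 big1 ?addr0// => j ji.
by rewrite mderiv_var (negbTE ji) mulr0.
Qed.

Lemma hom0 k : hom k 0. Proof. by rewrite /hom raddf0 scaler0. Qed.
Lemma homC c : hom 0 (mpolyC d c). Proof. by rewrite /hom eulerC scale0r. Qed.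
Lemma hom_var i : hom 1 (var i). Proof. by rewrite /hom euler_var scale1r. Qed.
Lemma homD k p q : hom k p -> hom k q -> hom k (p + q).
Proof. by rewrite /hom raddfD /= => -> ->; rewrite scalerDr. Qed.
Lemma homZ k c p : hom k p -> hom k (c *: p).
Proof. by rewrite /hom linearZ /= => ->; rewrite !scalerA mulrC. Qed.
Lemma homB k p q : hom k p -> hom k q -> hom k (p - q).
Proof. by move=> hp hq; apply: homD => //; rewrite -scaleN1r; apply: homZ. Qed.
Lemma homM k l p q : hom k p -> hom l q -> hom (k + l) (p * q).
Proof.
rewrite /hom eulerM => -> ->; rewrite natrD scalerDl scalerAl; congr (_ + _).
by rewrite scalerAr.
Qed.
Lemma homXn k l p : hom k p -> hom (k * l) (p ^+ l).
Proof.
move=> hp; elim: l => [|l IH]; first by rewrite muln0 expr0 -mpolyC1; exact: homC.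
by rewrite exprS mulnS; exact: homM.
Qed.
Lemma hom_sum k I (r : seq I) (P : pred I) (F : I -> poly) :
  (forall a, P a -> hom k (F a)) -> hom k (\sum_(i <- r | P i) F i).
Proof. by move=> h; apply: big_ind => //; [exact: hom0|exact: homD]. Qed.

Lemma euler_homX m : euler (mpolyX R m) = (mdeg m)%:R *: mpolyX R m.
Proof.
rewrite /euler mdegE natr_sum scaler_suml; apply: eq_bigr => i _.
rewrite mderivX -scalerAr -mpolyXD; have [->|mi] := eqVneq (m i) 0%N.
  by rewrite !scale0r.
congr (_ *: _); congr mpolyX; rewrite addmC submK//.
by apply/mnm_lepP => j; rewrite mnmE; case: eqP => [<-|//]; rewrite lt0n.
Qed.

Lemma mcoeff_euler m p : mcoeff m (euler p) = (mdeg m)%:R * mcoeff m p.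
Proof.
elim/mpolyind: p => [|c m' p _ _ IH]; first by rewrite raddf0 !mcoeff0 mulr0.
rewrite raddfD /= linearZ /= euler_homX !mcoeffD IH !mcoeffZ mulrDr mcoeffX.
congr (_ + _); case: eqP => [->|_]; last by rewrite !mulr0.
by rewrite !mulr1 mulrC.
Qed.

(** Monomials are eigenvectors of the Euler operator, with their degrees as
    eigenvalues. *)
Lemma hom_mcoeff k p m : hom k p -> mdeg m != k -> mcoeff m p = 0.
Proof.
move=> hp mk; have := congr1 (mcoeff m) hp.
rewrite mcoeff_euler mcoeffZ => /eqP; rewrite -subr_eq0 -mulrBl mulf_eq0.
by rewrite subr_eq0 eqr_nat (negbTE mk) /= => /eqP.
Qed.

Lemma ev_hom k p t x : hom k p -> ev p (t *: x) = t ^+ k * ev p x.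
Proof.
move=> hp; rewrite /ev !mevalE mulr_sumr.
rewrite big_seq_cond [in RHS]big_seq_cond; apply: eq_bigr => m; rewrite andbT => mp.
have mk : mdeg m = k.
  by apply/eqP; move: mp; apply: contraLR => mk; rewrite -mcoeff_eq0 (hom_mcoeff hp).
under eq_bigr do rewrite mxE exprMn.
rewrite big_split /= mulrCA; congr (_ * (_ * _)).
by rewrite -expr_sum -mdegE mk.
Qed.

Lemma hom_mderiv k i p : hom k.+1 p -> hom k (mderiv i p).
Proof.
rewrite /hom euler_mderiv => ->; rewrite mderivZ -[X in _ - X]scale1r -scalerBl.
by rewrite -natr1 addrK.
Qed.

Lemma hom0_const p : hom 0 p -> p = mpolyC d (mcoeff mnm0 p).
Proof.
move=> hp; apply/mpolyP => m; rewrite mcoeffC -mdeg_eq0.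
case: eqP => [/eqP|/eqP m0]; last by rewrite mulr0 (hom_mcoeff hp).
by rewrite mdeg_eq0 => /eqP ->; rewrite mulr1.
Qed.

Lemma hom_mderiv0 i p : hom 0 p -> mderiv i p = 0.
Proof. by move/hom0_const ->; rewrite mderivC. Qed.

Lemma hom_lap k p : hom k.+2 p -> hom k (lap p).
Proof. by move=> hp; apply: hom_sum => i _; do 2 apply: hom_mderiv. Qed.

Lemma hom_lap_small k p : hom k p -> (k < 2)%N -> lap p = 0.
Proof.
move=> hp k2; rewrite /lap big1// => i _.
case: k k2 hp => [_ /(hom_mderiv0 i) ->|[_ h|//]]; first by rewrite raddf0.
exact/hom_mderiv0/hom_mderiv.
Qed.

Lemma iter_lap_hom0 k l p : hom k p -> (k < 2 * l)%N -> iter l lap p = 0.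
Proof.
elim: l k p => [//|l IH] k p hp kl.
rewrite iterSr; case: k hp kl => [|[|k]] hp kl.
- by rewrite (hom_lap_small hp)//; elim: l {IH kl} => //= l ->; rewrite raddf0.
- by rewrite (hom_lap_small hp)//; elim: l {IH kl} => //= l ->; rewrite raddf0.
- apply: (IH k); first exact: hom_lap.
  by rewrite mulnS !ltnS in kl.
Qed.

Lemma iter_lap_mderiv l i p : iter l lap (mderiv i p) = mderiv i (iter l lap p).
Proof. by elim: l => //= l ->; rewrite lap_mderiv. Qed.

Lemma iter_lap_varM l i p :
  iter l lap (var i * p) = var i * iter l lap p + (2 * l)%:R *: mderiv i (iter l.-1 lap p).
Proof.
elim: l => [|l IH]; first by rewrite muln0 scale0r addr0.
rewrite /= IH raddfD /= lap_varM linearZ /= lap_mderiv -addrA; congr (_ + _).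
case: l {IH} => [|l] /=; first by rewrite muln0 scale0r addr0 muln1.
by rewrite -scalerDl -natrD -mulnS.
Qed.

Lemma iter_lap_linear l c p q :
  iter l lap (c *: p + q) = c *: iter l lap p + iter l lap q.
Proof. by elim: l => //= l ->; rewrite linearP. Qed.

Lemma iter_lap0 l : iter l lap 0 = 0.
Proof. by elim: l => //= l ->; rewrite raddf0. Qed.

End PolynomialCalculus.

(** * Harmonic extensions from a coordinate subspace *)

Section HarmonicExtension.
Context {R : realType} {d : nat}.
Local Notation poly := (mpoly d R).
Implicit Types (p q g : poly) (i j l : 'I_d).

Definition r2 : poly := \sum_i var i ^+ 2.

Lemma mderiv_sqr i j : mderiv i (var j ^+ 2 : poly) = (2%:R * (i == j)%:R) *: var j.
Proof.
rewrite mderivXn expr1 mderiv_var -scalerA; congr (_ *: _).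
by case: eqP => _; rewrite ?mulr1 ?scale1r// mulr0 scale0r.
Qed.

Lemma mderiv_r2 i : mderiv i r2 = 2%:R *: var i.
Proof.
rewrite /r2 raddf_sum /= (bigD1 i)//= mderiv_sqr eqxx mulr1 big1 ?addr0// => j ji.
by rewrite mderiv_sqr eq_sym (negbTE ji) mulr0 scale0r.
Qed.

Lemma lap_r2 : lap r2 = mpolyC d (2%:R * d%:R).
Proof.
rewrite /lap; under eq_bigr do rewrite mderiv_r2 mderivZ mderiv_var eqxx.
rewrite sumr_const card_ord scaler_nat -mulrnA -mpolyC_nat.
by rewrite natrM.
Qed.

Lemma lap_r2M p : lap (r2 * p) = r2 * lap p + (2%:R * d%:R) *: p + 4%:R *: euler p.
Proof.
rewrite lapM lap_r2 mul_mpolyC.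
have -> : gdot r2 p = 2%:R *: euler p.
  rewrite /gdot /euler scaler_sumr; apply: eq_bigr => i _.
  by rewrite mderiv_r2 scalerAl.
by rewrite scalerA [LHS]addrC addrA; have -> : (2%:R * 2%:R : R) = 4%:R by ring.
Qed.

Lemma hom_r2 : hom 2 r2.
Proof.
apply: hom_sum => i _.
rewrite -[2%N]/(1 * 2)%N; exact/homXn/hom_var.
Qed.

(** With real degrees, the degree of a derivative is s - 1 in all cases. *)
Definition homR (s : R) p := euler p = s *: p.

Lemma homR_mderiv s i p : homR s p -> homR (s - 1) (mderiv i p).
Proof. by rewrite /homR euler_mderiv => ->; rewrite mderivZ scalerBl scale1r. Qed.

Lemma homR_lap s p : homR s p -> homR (s - 2) (lap p).
Proof.
move=> hp; rewrite /homR /lap raddf_sum /= scaler_sumr; apply: eq_bigr => i _.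
by rewrite (homR_mderiv i (homR_mderiv i hp)); congr (_ *: _); ring.
Qed.

Lemma homR_iter_lap s p k : homR s p -> homR (s - (2 * k)%:R) (iter k lap p).
Proof.
move=> hp; elim: k => [|k IH]; first by rewrite subr0.
by rewrite /= mulnS natrD opprD addrCA addrC; exact: homR_lap.
Qed.

Lemma homRM s s' p q : homR s p -> homR s' q -> homR (s + s') (p * q).
Proof.
rewrite /homR eulerM => -> ->; rewrite scalerDl scalerAl; congr (_ + _).
by rewrite scalerAr.
Qed.

Context (ix iy : 'I_d) (xy : ix != iy).

(** Here x, y are the coordinates of index ix, iy, w stands for the others, and
    z = x + i y. That a polynomial depends on w only, or on z only, is expressed by
    vanishing derivatives, which is how the Leibniz rules use it. *)
Definition wpoly p := mderiv ix p = 0 /\ mderiv iy p = 0.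
Definition zpoly p := forall l, l != ix -> l != iy -> mderiv l p = 0.

Lemma wpolyD p q : wpoly p -> wpoly q -> wpoly (p + q).
Proof. by move=> [a b] [c e]; split; rewrite mderivD ?a ?b ?c ?e addr0. Qed.
Lemma wpolyZ c p : wpoly p -> wpoly (c *: p).
Proof. by move=> [a b]; split; rewrite mderivZ ?a ?b scaler0. Qed.
Lemma wpolyM p q : wpoly p -> wpoly q -> wpoly (p * q).
Proof.
by move=> [a b] [c e]; split; rewrite mderivM ?a ?b ?c ?e mulr0 mul0r addr0.
Qed.
Lemma wpoly_var l : l != ix -> l != iy -> wpoly (var l).
Proof. by move=> /negbTE lx /negbTE ly; split; rewrite mderiv_var eq_sym ?lx ?ly. Qed.
Lemma wpoly_mderiv l p : wpoly p -> wpoly (mderiv l p).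
Proof.
by move=> [a b]; split; [rewrite mderiv_comm a|rewrite mderiv_comm b]; rewrite raddf0.
Qed.
Lemma wpoly0 : wpoly 0. Proof. by split; rewrite raddf0. Qed.
Lemma wpoly_lap p : wpoly p -> wpoly (lap p).
Proof.
move=> wp; rewrite /lap; apply: big_ind => //; first exact: wpoly0.
  exact: wpolyD.
by move=> i _; do 2 apply: wpoly_mderiv.
Qed.
Lemma wpoly_iter_lap k p : wpoly p -> wpoly (iter k lap p).
Proof. by move=> wp; elim: k => //= k; exact: wpoly_lap. Qed.

Lemma zpolyM p q : zpoly p -> zpoly q -> zpoly (p * q).
Proof.
by move=> a b l lx ly; rewrite mderivM a// b// mulr0 mul0r addr0.
Qed.
Lemma zpolyD p q : zpoly p -> zpoly q -> zpoly (p + q).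
Proof. by move=> a b l lx ly; rewrite mderivD a// b// addr0. Qed.
Lemma zpolyN p : zpoly p -> zpoly (- p).
Proof. by move=> a l lx ly; rewrite mderivN a// oppr0. Qed.
Lemma zpolyC c : zpoly (mpolyC d c).
Proof. by move=> l _ _; rewrite mderivC. Qed.
Lemma zpoly_varx : zpoly (var ix).
Proof. by move=> l /negbTE lx ly; rewrite mderiv_var lx. Qed.
Lemma zpoly_vary : zpoly (var iy).
Proof. by move=> l lx /negbTE ly; rewrite mderiv_var ly. Qed.

Lemma gdot_wz p q : wpoly p -> zpoly q -> gdot p q = 0.
Proof.
move=> [px py] zq; rewrite /gdot big1// => l _.
have [->|lx] := eqVneq l ix; first by rewrite px mul0r.
have [->|ly] := eqVneq l iy; first by rewrite py mul0r.
by rewrite zq// mulr0.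
Qed.

Lemma lap_wz p q : wpoly p -> zpoly q -> lap (p * q) = lap p * q + p * lap q.
Proof. by move=> wp zq; rewrite lapM gdot_wz// scaler0 addr0. Qed.

Lemma sum_z (F : 'I_d -> poly) : (forall l, l != ix -> l != iy -> F l = 0) ->
  \sum_l F l = F ix + F iy.
Proof.
move=> h; rewrite (bigD1 ix)//= (bigD1 iy) 1?eq_sym//= big1 ?addr0//.
by move=> l /andP[lx ly]; exact: h.
Qed.

Lemma euler_z q : zpoly q -> euler q = var ix * mderiv ix q + var iy * mderiv iy q.
Proof. by move=> zq; apply: sum_z => l lx ly; rewrite zq// mulr0. Qed.

Lemma lap_z q : zpoly q ->
  lap q = mderiv ix (mderiv ix q) + mderiv iy (mderiv iy q).
Proof. by move=> zq; apply: sum_z => l lx ly; rewrite zq// raddf0. Qed.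

Definition zsq : poly := var ix ^+ 2 + var iy ^+ 2.
Definition wsq : poly := r2 - zsq.

Lemma zsqE : zsq = var ix ^+ 2 + var iy ^+ 2. Proof. by []. Qed.

Lemma zpoly_zsq : zpoly zsq.
Proof.
by apply: zpolyD; rewrite expr2; apply: zpolyM; exact: zpoly_varx || exact: zpoly_vary.
Qed.

Lemma mderivx_zsq : mderiv ix zsq = 2%:R *: var ix.
Proof. by rewrite mderivD !mderiv_sqr eqxx (negbTE xy) mulr1 mulr0 scale0r addr0. Qed.

Lemma mderivy_zsq : mderiv iy zsq = 2%:R *: var iy.
Proof.
by rewrite mderivD !mderiv_sqr eqxx eq_sym (negbTE xy) mulr1 mulr0 scale0r add0r.
Qed.

Lemma lap_zsq : lap zsq = mpolyC d 4%:R.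
Proof.
rewrite lap_z; last exact: zpoly_zsq.
rewrite mderivx_zsq mderivy_zsq !mderivZ !mderiv_var !eqxx.
by rewrite -!mul_mpolyC !mpolyC_nat /=; ring.
Qed.

Lemma wpoly_wsq : wpoly wsq.
Proof.
by split; rewrite mderivB mderiv_r2 ?mderivx_zsq ?mderivy_zsq subrr.
Qed.

Lemma lap_zsqM q : zpoly q -> lap (zsq * q) = zsq * lap q + 4%:R *: (q + euler q).
Proof.
move=> zq; rewrite lapM lap_zsq /gdot sum_z; last first.
  by move=> l lx ly; rewrite zq// mulr0.
rewrite mderivx_zsq mderivy_zsq euler_z//.
by rewrite -!mul_mpolyC !mpolyC_nat; ring.
Qed.

(** The real and imaginary parts of (x + i y)^m. *)
Fixpoint zpow m : poly * poly :=
  if m is m.+1 then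
    (var ix * (zpow m).1 - var iy * (zpow m).2, var ix * (zpow m).2 + var iy * (zpow m).1)
  else (1, 0).
Definition zre m := (zpow m).1.
Definition zim m := (zpow m).2.

Lemma zre0 : zre 0 = 1. Proof. by []. Qed.
Lemma zim0 : zim 0 = 0. Proof. by []. Qed.
Lemma zreS m : zre m.+1 = var ix * zre m - var iy * zim m. Proof. by []. Qed.
Lemma zimS m : zim m.+1 = var ix * zim m + var iy * zre m. Proof. by []. Qed.

Lemma zpoly_zre_zim m : zpoly (zre m) /\ zpoly (zim m).
Proof.
elim: m => [|m [IH1 IH2]].
  by split; rewrite /zre /zim /= -?mpolyC1 -?mpolyC0; exact: zpolyC.
have := (zpoly_varx, zpoly_vary) => -[zx zy].
rewrite zreS zimS; split; apply: zpolyD; try apply: zpolyN; exact: zpolyM.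
Qed.

Lemma mderiv_z m :
  [/\ mderiv ix (zre m) = m%:R *: zre m.-1, mderiv ix (zim m) = m%:R *: zim m.-1,
      mderiv iy (zre m) = - (m%:R *: zim m.-1) & mderiv iy (zim m) = m%:R *: zre m.-1].
Proof.
elim: m => [|m [h1 h2 h3 h4]].
  rewrite /zre /zim /= -mpolyC1 !mderivC !raddf0 !scale0r ?oppr0.
  by split.
have e1 : m%:R *: zre m = m%:R *: (var ix * zre m.-1 - var iy * zim m.-1).
  by case: m {h1 h2 h3 h4} => [|m]; rewrite ?scale0r// zreS.
have e2 : m%:R *: zim m = m%:R *: (var ix * zim m.-1 + var iy * zre m.-1).
  by case: m {h1 h2 h3 h4 e1} => [|m]; rewrite ?scale0r// zimS.
rewrite [m.+1.-1]/= zreS zimS !(mderivD, mderivN, mderivM) !mderiv_var !eqxx.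
rewrite [iy == ix]eq_sym (negbTE xy) h1 h2 h3 h4 -natr1 !scalerDl !scale1r e1 e2.
by rewrite -!mul_mpolyC !mpolyC_nat /=; split; ring.
Qed.

Lemma lap_zim m : lap (zim m) = 0.
Proof.
rewrite lap_z; last exact: (zpoly_zre_zim m).2.
have [_ -> _ ->] := mderiv_z m; have [_ h2 h3 _] := mderiv_z m.-1.
by rewrite !mderivZ h2 h3 scalerN subrr.
Qed.

Lemma homR_zre_zim m : homR m%:R (zre m) /\ homR m%:R (zim m).
Proof.
have [z1 z2] := zpoly_zre_zim m; rewrite /homR !euler_z//.
have [-> -> -> ->] := mderiv_z m.
case: m {z1 z2} => [|m]; first by rewrite !scale0r oppr0 !mulr0 addr0.
rewrite /= zreS zimS; split; rewrite -!mul_mpolyC !mpolyC_nat; ring.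
Qed.

Lemma homR_zsq : homR 2 zsq.
Proof.
rewrite /homR euler_z; last exact: zpoly_zsq.
by rewrite mderivx_zsq mderivy_zsq /zsq -!mul_mpolyC; ring.
Qed.

Lemma homR_wsq : homR 2 wsq.
Proof. by rewrite /homR /wsq raddfB /= homR_zsq hom_r2 scalerBr. Qed.

Lemma homR_zsqXn k : homR (2 * k)%:R (zsq ^+ k).
Proof.
elim: k => [|k IH].
  by rewrite /homR muln0 scale0r expr0 -mpolyC1 eulerC.
by rewrite exprS mulnS natrD; apply: homRM => //; exact: homR_zsq.
Qed.

Let zk m k := zsq ^+ k * zim m.

Lemma zpoly_zk m k : zpoly (zk m k).
Proof.
apply: zpolyM; last exact: (zpoly_zre_zim m).2.
elim: k => [|k IH]; first by rewrite expr0 -mpolyC1; exact: zpolyC.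
by rewrite exprS; apply: zpolyM => //; exact: zpoly_zsq.
Qed.

Lemma homR_zk m k : homR (2 * k + m)%:R (zk m k).
Proof. by rewrite natrD; apply: homRM; [exact: homR_zsqXn|exact: (homR_zre_zim m).2]. Qed.

Lemma lap_zk m k : lap (zk m k) = (4 * k * (k + m))%:R *: zk m k.-1.
Proof.
elim: k => [|k IH]; first by rewrite muln0 mul0n scale0r /zk expr0 mul1r lap_zim.
have -> : zk m k.+1 = zsq * zk m k by rewrite /zk exprS mulrA.
rewrite lap_zsqM; last exact: zpoly_zk.
rewrite IH homR_zk /=.
have -> : zsq * ((4 * k * (k + m))%:R *: zk m k.-1) = (4 * k * (k + m))%:R *: zk m k.
  case: k {IH} => [|k]; first by rewrite muln0 mul0n !scale0r mulr0.
  by rewrite -scalerAr /zk /= exprS mulrA.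
rewrite -[X in 4%:R *: (X + _)]scale1r -scalerDl scalerA -scalerDl; congr (_ *: _).
by rewrite -[1]/1%:R -natrD -natrM -natrD; congr _%:R; ring.
Qed.

(** The coefficients of the harmonic extension: c_0 = 1 and
    4 (k + 1) (k + 1 + m) c_(k+1) = - c_k. *)
Fixpoint hcoef (m k : nat) : R :=
  if k is k.+1 then - hcoef m k / (4 * k.+1 * (k.+1 + m))%:R else 1.

Lemma hcoefS m k : (4 * k.+1 * (k.+1 + m))%:R * hcoef m k.+1 = - hcoef m k.
Proof. by rewrite /= mulrCA divff ?mulr1// pnatr_eq0. Qed.

Arguments hcoef : simpl never.

(** For q depending on w, this is the harmonic polynomial whose expansion in
    powers of |z|^2 starts with q Im z^m. The number N of terms is a parameter because
    all N such that the N-th iterated Laplacian of q vanishes give the same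
    polynomial, and identities between several extensions need a common N. *)
Definition hext (N m : nat) q : poly :=
  \sum_(k < N) hcoef m k *: (iter k lap q * zk m k).

Lemma hextS N m q :
  hext N.+1 m q = hext N m q + hcoef m N *: (iter N lap q * zk m N).
Proof. by rewrite /hext big_ord_recr. Qed.

Lemma hext_le N N' m q : (N <= N')%N -> iter N lap q = 0 -> hext N' m q = hext N m q.
Proof.
move=> /subnK <- q0; elim: (N' - N)%N => [//|k IH].
rewrite addSn hextS IH.
by rewrite iterD q0 iter_lap0 mul0r scaler0 addr0.
Qed.

(** The Laplacian of a term has a part where it acts on q and a part where it acts
    on |z|^(2 k) Im z^m. By the choice of the coefficients, the second part cancels
    the first part of the preceding term, so only the first part of the last term
    remains. *)
Lemma lap_hext N m q : wpoly q -> iter N lap q = 0 -> lap (hext N m q) = 0.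
Proof.
move=> wq q0.
have h k : lap (hcoef m k *: (iter k lap q * zk m k)) = hcoef m k *:
    (iter k.+1 lap q * zk m k + (4 * k * (k + m))%:R *: (iter k lap q * zk m k.-1)).
  rewrite linearZ /= lap_wz; [|exact: wpoly_iter_lap|exact: zpoly_zk].
  by rewrite lap_zk -scalerAr.
case: N q0 => [|N] q0; first by rewrite /hext big_ord0 raddf0.
suff -> : lap (hext N.+1 m q) = hcoef m N *: (iter N.+1 lap q * zk m N).
  by rewrite q0 mul0r scaler0.
elim: N {q0} => [|N IH].
  rewrite hextS /hext big_ord0 add0r h muln0 mul0n scale0r addr0//.
rewrite hextS raddfD /= IH h /= scalerDr scalerA [_ * _%:R]mulrC hcoefS scaleNr.
by rewrite addrCA subrr addr0.
Qed.

Lemma hextD N m c p q : hext N m (c *: p + q) = c *: hext N m p + hext N m q.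
Proof.
rewrite /hext scaler_sumr -big_split; apply: eq_bigr => k _ /=.
rewrite iter_lap_linear mulrDl scalerDr; congr (_ + _).
by rewrite -scalerAl !scalerA mulrC.
Qed.

Lemma hextZ N m c q : hext N m (c *: q) = c *: hext N m q.
Proof.
rewrite -[c *: q]addr0 hextD [hext N m 0]big1 ?addr0// => k _.
by rewrite iter_lap0 mul0r scaler0.
Qed.

Lemma homR_hext N m s q : homR s q -> homR (s + m%:R) (hext N m q).
Proof.
move=> hq; rewrite /homR /hext raddf_sum scaler_sumr; apply: eq_bigr => k _ /=.
rewrite linearZ /= (homRM (homR_iter_lap k hq) (homR_zk m k)) !scalerA mulrC.
by congr (_ *: _); rewrite natrD; ring.
Qed.

Lemma iter_lap_wsqM k s g : wpoly g -> homR s g ->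
  iter k lap (wsq * g) = wsq * iter k lap g +
    (k%:R * (2%:R * d%:R - 4 + 4 * s - 4 * (k%:R - 1))) *: iter k.-1 lap g.
Proof.
move=> wg hg.
have base s' g' : wpoly g' -> homR s' g' ->
    lap (wsq * g') = wsq * lap g' + (2%:R * d%:R - 4 + 4 * s') *: g'.
  move=> wg' hg'.
  rewrite {1}/wsq mulrBl raddfB /= lap_r2M hg' [zsq * _]mulrC lap_wz; last 2 first.
  - exact: wg'.
  - exact: zpoly_zsq.
  by rewrite lap_zsq /wsq -!mul_mpolyC; ring.
elim: k => [|k IH]; first by rewrite mul0r scale0r addr0.
rewrite iterS IH raddfD /= lapZ (base (s - (2 * k)%:R)); last 2 first.
- exact: wpoly_iter_lap.
- exact: homR_iter_lap.
rewrite -addrA; congr (_ + _).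
case: k {IH} => [|k] /=.
  by rewrite mul0r scale0r addr0; congr (_ *: _); ring.
rewrite -scalerDl; congr (_ *: _).
by rewrite natrM -!natr1; ring.
Qed.

(** A coordinate of w times a harmonic polynomial is a harmonic polynomial plus
    |x|^2 times another one; 1 / D is the coefficient that makes the first of them
    harmonic. On the unit sphere this is a combination of harmonic
    extensions. *)
Lemma var_hext N l m s q (D := d%:R - 2 + 2 * (s + m%:R)) :
  wpoly q -> homR s q -> D != 0 -> iter N lap (mderiv l q) = 0 ->
  var l * hext N.+1 m q = hext N.+1 m (var l * q - D^-1 *: (wsq * mderiv l q))
    + D^-1 *: (r2 * hext N.+1 m (mderiv l q)).
Proof.
move=> wq hq D0 q0.
set g := mderiv l q.
have wg : wpoly g by exact: wpoly_mderiv.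
have hg : homR (s - 1) g by exact: homR_mderiv.
suff -> : hext N.+1 m (var l * q - D^-1 *: (wsq * g)) =
   var l * hext N.+1 m q - D^-1 *: (r2 * hext N.+1 m g)
   + D^-1 *: (hcoef m N *: (iter N lap g * zk m N.+1)).
  by rewrite q0 mul0r !scaler0 addr0 subrK.
have zkS k : zk m k.+1 = zsq * zk m k by rewrite /zk exprS mulrA.
have er2 : r2 = wsq + zsq by rewrite subrK.
have gen k : iter k lap (var l * q - D^-1 *: (wsq * g)) =
   var l * iter k lap q - D^-1 *: (wsq * iter k lap g) +
   ((2 * k)%:R - D^-1 * (k%:R * (2%:R * d%:R - 4 + 4 * (s - 1) - 4 * (k%:R - 1))))
     *: iter k.-1 lap g.
  rewrite addrC -scaleNr iter_lap_linear iter_lap_varM (iter_lap_wsqM k wg hg).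
  rewrite -iter_lap_mderiv -/g.
  rewrite -!mul_mpolyC !mpolyCN !mpolyCB !mpolyCM; ring.
elim: N {q0} => [|N IH].
  rewrite !hextS /hext !big_ord0 !add0r !scale1r /= zkS er2.
  by rewrite -!mul_mpolyC; ring.
rewrite hextS IH [hext N.+2 m q]hextS [hext N.+2 m g]hextS gen.
set G := iter N.+1 lap g; set G' := iter N lap g; rewrite /= -/G'.
set H := hext N.+1 m q; set H' := hext N.+1 m g.
rewrite (zkS N.+1) er2.
set Z := zk m N.+1; set c := hcoef m N.+1.
have cN : hcoef m N = - ((4 * N.+1 * (N.+1 + m))%:R * c) by rewrite hcoefS opprK.
rewrite cN.
set e := (X in X *: G').
have he : e = D^-1 * (4 * N.+1 * (N.+1 + m))%:R.
  rewrite /e -[_%:R in LHS](mulfK D0) mulrC -mulrBr; congr (_ * _).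
  by rewrite /D !natrM natrD; ring.
rewrite he -!mul_mpolyC !mpolyCN !mpolyCM; ring.
Qed.

End HarmonicExtension.

(** * Directional derivatives *)

Section DirectionalDerivatives.
Context {R : realType} {V : normedModType R}.
Implicit Types (f g : V -> R) (x v : V).

Lemma line_quotient f x v s : (fun h : R => h^-1 *: ((f \o shift (x + s *: v)) (h *: v) - f (x + s *: v)))
  = (fun h : R => h^-1 *: (((fun s : R^o => f (x + s *: v)) \o shift (s : R^o)) (h *: (1 : R^o)) - f (x + s *: v))).
Proof.
apply/funext => h /=; congr (_ *: (f _ - _)).
by rewrite [h *: 1]mulr1 scalerDl addrCA.
Qed.

Lemma derive_line f x v (s : R) :
  'D_v f (x + s *: v) = 'D_1 (fun s : R => f (x + s *: v)) s.
Proof. by rewrite /derive line_quotient. Qed.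

Lemma derivable_line f x v (s : R) :
  derivable f (x + s *: v) v <-> derivable (fun s : R => f (x + s *: v)) s 1.
Proof. by rewrite /derivable line_quotient. Qed.

Lemma is_derive_line f x v (s : R) L :
  is_derive (x + s *: v) v f L <-> is_derive s 1 (fun s : R => f (x + s *: v)) L.
Proof.
split=> -[h1 h2]; split; first exact/derivable_line.
- by rewrite -derive_line.
- exact/derivable_line.
- by rewrite derive_line.
Qed.

Lemma is_derive_line0 f x v L :
  is_derive x v f L <-> is_derive (0 : R) 1 (fun s : R => f (x + s *: v)) L.
Proof. by rewrite -is_derive_line scale0r addr0. Qed.

Lemma is_derive_compR (phi : R -> R) f x v (a b : R) :
  is_derive (f x) 1 phi a -> is_derive x v f b -> is_derive x v (phi \o f) (a * b).
Proof.
move=> h1 /is_derive_line0 h2; apply/is_derive_line0.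
apply: (@is_derive1_comp R phi (fun s : R => f (x + s *: v)) 0 a b) => //.
by rewrite scale0r addr0.
Qed.

Lemma near_line x v (P : V -> Prop) :
  (\forall y \near x, P y) -> \forall s \near (0 : R), P (x + s *: v).
Proof.
move=> nP; have : (fun s : R => x + s *: v) @ (0 : R) --> x + 0 *: v.
  by apply: cvgD; [exact: cvg_cst|apply: cvgZl; exact: cvg_id].
by rewrite scale0r addr0 => /(_ _ nP).
Qed.

(** If h' had a positive derivative at its zero 0, then it would be positive
    on a right neighbourhood of 0, where h would exceed h 0 by the mean value
    theorem. *)
Lemma max_derive2_line (h h' : R -> R) (L : R) :
  (\forall s \near (0 : R), is_derive (s : R) (1 : R) h (h' s)) -> is_derive (0 : R) (1 : R) h' L ->
  (\forall s \near (0 : R), h s <= h 0) -> L <= 0.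
Proof.
move=> dh [dh' h'L] hmax; rewrite leNgt; apply/negP => L0.
have /nbhs_ballP [e /= e0 He] : \forall s \near (0 : R), is_derive (s : R) (1 : R) h (h' s) /\ h s <= h 0.
  exact: filterI.
have itvb t : t \in `]-e, e[ -> ball 0 e t.
  by rewrite in_itv /= => /andP[? ?]; rewrite /ball /= sub0r normrN ltr_norml; apply/andP.
have e00 : (0 : R) \in `]-e, e[ by rewrite in_itv /= oppr_lt0 e0.
have [_ h0] : is_derive (0 : R) (1 : R) h 0.
  apply: (@derive1_at_max R h (- e) e 0) => //; first lra.
    by move=> t /itvb /He [[]].
  by move=> t /itvb /He [].
have h'0 : h' 0 = 0.
  by have [[_ <-] _] := He 0 (ballxx 0 e0).
have : (fun t : R => t^-1 *: ((h' \o shift (0 : R^o)) (t *: (1 : R^o)) - h' 0)) @ 0^' --> L.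
  by rewrite -h'L.
move=> /cvgrPdist_lt /(_ L L0).
rewrite near_withinE => /(nbhs_ballP (0 : R)) [r /= r0 Hr].
pose m := Num.min e r / 2.
have m0 : 0 < m by rewrite divr_gt0// lt_min e0 r0.
have me : m < e.
  have : Num.min e r <= e by rewrite ge_min lexx.
  by rewrite /m; lra.
have mr : m < r.
  have : Num.min e r <= r by rewrite ge_min lexx orbT.
  by rewrite /m; lra.
have pos t : 0 < t -> t <= m -> 0 < h' t.
  move=> t0 tm; have := Hr t; rewrite /ball /= sub0r normrN gtr0_norm// => /(_ (le_lt_trans tm mr)).
  move=> /(_ (lt0r_neq0 t0)); rewrite h'0 subr0 addr0 [t *: 1]mulr1 => ht.
  have : 0 < t^-1 * h' t.
    by move: ht; rewrite /GRing.scale /= ltr_norml => /andP[_]; lra.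
  by rewrite pmulr_rgt0// invr_gt0.
have [||c] := @MVT R h h' 0 m m0.
- move=> t; rewrite in_itv /= => /andP[? ?]; apply: (He t _).1.
  by apply: itvb; rewrite in_itv /=; apply/andP; split; lra.
- apply: continuous_in_subspaceT => t; rewrite inE /= in_itv /= => /andP[? ?].
  have [[dt _] _] : is_derive (t : R) (1 : R) h (h' t) /\ h t <= h 0.
    by apply: He; apply: itvb; rewrite in_itv /=; apply/andP; split; lra.
  by apply/differentiable_continuous/derivable1_diffP.
rewrite in_itv /= => /andP[c0 cm] hc.
have [_] : is_derive (m : R) (1 : R) h (h' m) /\ h m <= h 0.
  by apply: He; apply: itvb; rewrite in_itv /=; apply/andP; split; lra.
rewrite -subr_le0 hc subr0 leNgt; apply/negP; rewrite negbK.
by rewrite mulr_gt0// pos// ltW.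
Qed.

(** This is the one-variable case on the line through x directed by v. *)
Lemma max_derive2 f x v :
  (\forall y \near x, derivable f y v) -> derivable ('D_v f) x v ->
  (\forall y \near x, f y <= f x) -> 'D_v ('D_v f) x <= 0.
Proof.
move=> df d2 fmax.
apply: (@max_derive2_line (fun s : R => f (x + s *: v)) (fun s : R => 'D_v f (x + s *: v))).
- apply: filterS (near_line v df) => s ds.
  by apply/is_derive_line; split.
- by apply/(is_derive_line0 ('D_v f)); split.
- by rewrite scale0r addr0; exact: (near_line v fmax).
Qed.

End DirectionalDerivatives.

(** * Polynomial functions and the maximum principle *)

Section PolynomialAnalysis.
Context {R : realType} {n : nat}.
Local Notation poly := (mpoly n.+1 R).
Local Notation point := 'rV[R]_n.+1.
Implicit Types (p q : poly) (x y : point) (i j : 'I_n.+1).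
Local Notation e_ i := (delta_mx 0 i : point).

Lemma continuous_ev p : continuous (ev p : point -> R).
Proof.
elim/(@mpoly_ring_ind R n.+1): p => [c|i|p q cp cq|p q cp cq] x.
- have -> : ev (mpolyC n.+1 c) = fun=> c by apply/funext => z; rewrite evC.
  exact: cst_continuous.
- have -> : ev (var i) = fun z : point => z 0 i by apply/funext => z; rewrite ev_var.
  exact: coord_continuous.
- have -> : ev (p + q) = ev p \+ ev q by apply/funext => z; rewrite evD.
  exact: (cvgD (cp x) (cq x)).
- have -> : ev (p * q) = ev p \* ev q by apply/funext => z; rewrite evM.
  exact: (cvgM (cp x) (cq x)).
Qed.

Lemma is_derive_ev p x i : is_derive x (e_ i) (ev p) (ev (mderiv i p) x).
Proof.
elim/(@mpoly_ring_ind R n.+1): p => [c|j|p q dp dq|p q dp dq].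
- have -> : ev (mpolyC n.+1 c) = cst c by apply/funext => z; rewrite evC.
  by rewrite mderivC ev0; exact: is_derive_cst.
- rewrite mderiv_var; apply/is_derive_line0.
  have -> : (fun s : R => ev (var j) (x + s *: e_ i)) = cst (x 0 j) + (i == j)%:R \*: id.
    apply/funext => s; rewrite ev_var !mxE eqxx /= eq_sym mulrC.
    by case: (i == j).
  have -> : ev (i == j)%:R x = 0 + (i == j)%:R *: (1:R^o).
    by rewrite add0r; case: (i == j); rewrite /= ?ev1 ?ev0 ?scale1r ?scale0r.
  by apply: is_deriveD.
- have -> : ev (p + q) = ev p + ev q by apply/funext => z; rewrite evD.
  by rewrite mderivD evD; exact: is_deriveD.
- rewrite (_ : ev (p * q) = ev p * ev q); last by apply/funext => z; rewrite evM.
  have := @is_deriveM _ _ (ev p) (ev q) x (e_ i) _ _ dp dq.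
  suff -> : ev p x *: ev (mderiv i q) x + ev q x *: ev (mderiv i p) x =
    ev (mderiv i (p * q)) x by [].
  by rewrite mderivM evD !evM /GRing.scale /= addrC [ev q x * _]mulrC.
Qed.

Lemma partial_ev p i : partial i (ev p) = ev (mderiv i p).
Proof. by rewrite /partial; apply/funext => x; have [_ <-] := is_derive_ev p x i. Qed.

Lemma derivable_ev p x i : derivable (ev p) x (e_ i).
Proof. by have [] := is_derive_ev p x i. Qed.

Lemma ev_r2 x : ev r2 x = \sum_i x 0 i ^+ 2.
Proof. by rewrite ev_sum; apply: eq_bigr => i _; rewrite evXn ev_var. Qed.

Lemma ev_r2_ge0 x : 0 <= ev r2 x.
Proof. by rewrite ev_r2 sumr_ge0// => i _; rewrite sqr_ge0. Qed.

Lemma coord_le_r2 x i : x 0 i ^+ 2 <= ev r2 x.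
Proof.
rewrite ev_r2 (bigD1 i)//= lerDl sumr_ge0// => j _; exact: sqr_ge0.
Qed.

Lemma enormE x : enorm x = Num.sqrt (ev r2 x).
Proof. by rewrite ev_r2. Qed.

Lemma ev_r2Z t x : ev r2 (t *: x) = t ^+ 2 * ev r2 x.
Proof. exact: (ev_hom _ _ hom_r2). Qed.

Lemma sphereE x : sphere R n x <-> ev r2 x = 1.
Proof.
rewrite /sphere /= enormE; split=> [e|->]; last by rewrite sqrtr1.
by rewrite -[LHS]sqr_sqrtr ?ev_r2_ge0// e expr1n.
Qed.

Lemma compact_closed_r2 (A : set point) (M : R) :
  closed A -> A `<=` [set x | ev r2 x <= M] -> compact A.
Proof.
move=> cA AM; apply: bounded_closed_compact => //.
exists (M + 1); split; first by rewrite num_real.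
move=> K MK x /AM /= xM.
have M0 : 0 <= M := le_trans (ev_r2_ge0 x) xM.
have [_ ->] : True /\ `|x| = mx_norm x by [].
rewrite mx_normrE; apply: bigmax_le => [|[i j] _ /=]; first by lra.
rewrite (ord1 i) -ler_sqr ?nnegrE//; last by lra.
rewrite real_normK ?num_real//; apply: le_trans (coord_le_r2 x j) _.
by apply: (le_trans xM); nra.
Qed.

Definition laplacian_at (f : point -> R) x := \sum_i partial i (partial i f) x.

(** The minimal regularity for the second derivative test, weaker than C^2. *)
Definition twice_derivable_at (f : point -> R) x := forall i,
  (\forall y \near x, derivable f y (e_ i)) /\ derivable (partial i f) x (e_ i).

Lemma laplacian_ev p x : laplacian_at (ev p) x = ev (lap p) x.
Proof.
rewrite /laplacian_at /lap ev_sum; apply: eq_bigr => i _.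
by rewrite partial_ev partial_ev.
Qed.

Lemma twice_derivable_ev p x : twice_derivable_at (ev p) x.
Proof.
move=> i; split; first by apply: (@filterE _ (nbhs x)) => y; exact: derivable_ev.
by rewrite partial_ev; exact: derivable_ev.
Qed.

Lemma partialD (f g : point -> R) x i :
  twice_derivable_at f x -> twice_derivable_at g x ->
  derivable (partial i (f + g)) x (e_ i) /\
  partial i (partial i (f + g)) x = partial i (partial i f) x + partial i (partial i g) x.
Proof.
move=> /(_ i) [df d2f] /(_ i) [dg d2g].
have E : \forall y \near x, (partial i f + partial i g) y = partial i (f + g) y.
  by apply: filterS2 df dg => y dfy dgy; rewrite /partial (deriveD dfy dgy).
have [h1 h2] : is_derive x (e_ i) (partial i f + partial i g)
    (partial i (partial i f) x + partial i (partial i g) x).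
  by split; [exact: derivableD|rewrite (deriveD d2f d2g)].
have [h3 h4] := near_eq_is_derive E (DeriveDef h1 h2).
by split.
Qed.

Lemma twice_derivableD (f g : point -> R) x :
  twice_derivable_at f x -> twice_derivable_at g x -> twice_derivable_at (f + g) x.
Proof.
move=> tf tg i; split; last exact: (partialD _ tf tg).1.
by apply: filterS2 (tf i).1 (tg i).1 => y; exact: derivableD.
Qed.

Lemma laplacianD (f g : point -> R) x :
  twice_derivable_at f x -> twice_derivable_at g x ->
  laplacian_at (f + g) x = laplacian_at f x + laplacian_at g x.
Proof.
move=> tf tg; rewrite /laplacian_at -big_split; apply: eq_bigr => i _.
exact: (partialD i tf tg).2.
Qed.

Lemma local_max_laplacian (f : point -> R) x : twice_derivable_at f x ->
  (\forall y \near x, f y <= f x) -> laplacian_at f x <= 0.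
Proof.
move=> tf fmax; apply: sumr_le0 => i _; have [d1 d2] := tf i.
exact: max_derive2.
Qed.

(** Adding a small multiple of |x|^2 makes the Laplacian positive, which
    excludes an interior maximum. *)
Lemma weak_maximum (Om : set point) (f : point -> R) (M : R) :
  compact Om -> {within Om, continuous f} ->
  (forall x, Om x -> f x <= M \/
     [/\ nbhs x Om, twice_derivable_at f x & 0 <= laplacian_at f x]) ->
  forall x, Om x -> f x <= M.
Proof.
move=> cOm cf h x Omx; rewrite leNgt; apply/negP => Mfx.
have [B B0 r2B] : exists2 B, 0 < B & forall y, Om y -> ev r2 y <= B.
  have [c _ hc] := @EVT_max_rV R _ (ev r2) Om (ex_intro _ x Omx) cOm
    (continuous_subspaceT (@continuous_ev r2)).
  exists (ev r2 c + 1); first by rewrite ltr_wpDl// ev_r2_ge0.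
  by move=> y Omy; rewrite (le_trans (hc y _)) ?lerDl// inE.
pose d := (f x - M) / (2 * B).
have d0 : 0 < d by rewrite divr_gt0 ?subr_gt0// mulr_gt0.
pose g := f + ev (d *: r2).
have cg : {within Om, continuous g}.
  have c2 : {within Om, continuous (ev (d *: r2) : point -> R)}.
    exact/continuous_subspaceT/continuous_ev.
  by move=> z; exact: (cvgD (cf z) (c2 z)).
have [c Omc gmax] := @EVT_max_rV R _ g Om (ex_intro _ x Omx) cOm cg.
rewrite inE in Omc.
have gx : f x <= g x by rewrite /g lerDl evZ mulr_ge0 ?ev_r2_ge0// ltW.
have gc : g x <= g c by apply: gmax; rewrite inE.
have [fcM|[nc tf lf]] := h c Omc.
  have : g c <= M + d * B.
    by rewrite /g; apply: lerD => //; rewrite evZ ler_pM2l// r2B.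
  have -> : d * B = (f x - M) / 2 by rewrite /d; field; rewrite gt_eqF.
  by move=> /(le_trans (le_trans gx gc)); lra.
have tr := twice_derivable_ev (d *: r2) c.
have : laplacian_at g c <= 0.
  apply: local_max_laplacian; first exact: twice_derivableD.
  by apply: filterS nc => y Omy; apply: gmax; rewrite inE.
rewrite laplacianD// laplacian_ev lapZ lap_r2 evZ evC => h1.
have : 0 < d * (2 * n.+1%:R) by rewrite mulr_gt0.
lra.
Qed.

End PolynomialAnalysis.

(** * Bernstein's gradient estimate *)

Section GradientEstimate.
Context {R : realType} {n : nat}.
Local Notation poly := (mpoly n.+1 R).
Local Notation point := 'rV[R]_n.+1.
Implicit Types (p q h : poly) (x y v : point) (i j : 'I_n.+1).

Definition sqd y : poly := \sum_i (var i - mpolyC n.+1 (y 0 i)) ^+ 2.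

Lemma ev_sqd y x : ev (sqd y) x = \sum_i (x 0 i - y 0 i) ^+ 2.
Proof. by rewrite ev_sum; apply: eq_bigr => i _; rewrite !evE. Qed.

Lemma sqd0 : sqd 0 = r2.
Proof. by apply: eq_bigr => i _; rewrite mxE mpolyC0 subr0. Qed.

Lemma mderiv_sqd y i : mderiv i (sqd y) = 2%:R *: (var i - mpolyC n.+1 (y 0 i)).
Proof.
rewrite /sqd raddf_sum /= (bigD1 i)//= big1 ?addr0 => [|j ji];
  rewrite mderivXn expr1 mderivB mderivC subr0 mderiv_var.
  by rewrite eqxx mulr1.
by rewrite eq_sym (negbTE ji) mulr0 scaler0.
Qed.

Lemma lap_sqd y : lap (sqd y) = mpolyC n.+1 (2%:R * n.+1%:R).
Proof.
rewrite /lap; under eq_bigr do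
  rewrite mderiv_sqd mderivZ mderivB mderivC subr0 mderiv_var eqxx.
by rewrite sumr_const card_ord scaler_nat -mulrnA -mpolyC_nat natrM.
Qed.

(** Euclidean balls: the cut-off function of the gradient estimate, which vanishes
    on their boundary, is a polynomial. *)
Definition eball y (s : R) : set point := [set x | ev (sqd y) x <= s ^+ 2].

Lemma eball_compact y s : compact (eball y s).
Proof.
apply: (@compact_closed_r2 _ _ _ (2 * s ^+ 2 + 2 * ev r2 y)).
  have -> : eball y s = ev (sqd y) @^-1` [set t | t <= s ^+ 2] by [].
  by apply: closed_comp; [move=> z _; exact: continuous_ev|exact: closed_le].
move=> x; rewrite /eball /= => xs; apply: (@le_trans _ _ (2 * ev (sqd y) x + 2 * ev r2 y)); last lra.
rewrite ev_sqd !ev_r2 !mulr_sumr -big_split; apply: ler_sum => i _ /=.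
by have := sqr_ge0 (x 0 i - 2 * y 0 i); nra.
Qed.

Lemma eball_max y s p (M : R) :
  (forall x, eball y s x -> 0 <= ev (lap p) x) ->
  (forall x, ev (sqd y) x = s ^+ 2 -> ev p x <= M) ->
  forall x, eball y s x -> ev p x <= M.
Proof.
move=> lp pM; apply: weak_maximum; first exact: eball_compact.
  exact/continuous_subspaceT/continuous_ev.
move=> x xs; have [/pM|xs'] := eqVneq (ev (sqd y) x) (s ^+ 2); first by left.
right; split; [|exact: twice_derivable_ev|by rewrite laplacian_ev lp].
have lt : ev (sqd y) x < s ^+ 2 by rewrite lt_neqAle xs'.
have : nbhs x (ev (sqd y) @^-1` [set t | t < s ^+ 2]).
  apply: open_nbhs_nbhs; split => //; apply: open_comp => [z _|]; last exact: open_lt.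
  exact: continuous_ev.
by apply: filterS => z /ltW.
Qed.

Definition dird v p : poly := \sum_i v 0 i *: mderiv i p.

Lemma dird_is_linear v : linear (dird v).
Proof.
move=> c p q; rewrite /dird scaler_sumr -big_split; apply: eq_bigr => i _.
by rewrite /= mderivD mderivZ scalerDr !scalerA mulrC.
Qed.
HB.instance Definition _ v :=
  GRing.isLinear.Build R poly poly _ (dird v) (dird_is_linear v).

Lemma lap_dird v p : lap (dird v p) = dird v (lap p).
Proof.
rewrite /dird raddf_sum; apply: eq_bigr => i _.
by rewrite /= lapZ lap_mderiv.
Qed.

(** In the Laplacian of phi^2 g^2, with phi and g as below, the gradient terms are
    at least - 24 |x - y|^2 g^2 by completing a square, and phi g^2 times the
    Laplacian of phi gives - 4 (n + 1) phi g^2. Both are compensated by twice this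
    constant times s^2 g^2, a lower bound for the contribution of h^2. *)
Definition bernstein_cst : R := 12 + 2 * n.+1%:R.

Let sum_sqrB (h v : 'I_n.+1 -> R) (G : R) : \sum_i (h i - G * v i) ^+ 2 =
  \sum_i h i ^+ 2 - 2 * G * (\sum_i v i * h i) + G ^+ 2 * (\sum_i v i ^+ 2).
Proof.
by rewrite !mulr_sumr -sumrN -!big_split; apply: eq_bigr => i _ /=; ring.
Qed.

Let sum_cross (z g : 'I_n.+1 -> R) (P G : R) :
  4 * P * G * \sum_i (- 2 * z i * g i) + 2 * \sum_i (P * g i - 2 * z i * G) ^+ 2 =
  2 * \sum_i (P * g i - 4 * z i * G) ^+ 2 - 24 * G ^+ 2 * \sum_i z i ^+ 2.
Proof.
by rewrite !mulr_sumr -sumrN -!big_split; apply: eq_bigr => i _ /=; ring.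
Qed.

(** Bernstein's method: phi^2 g^2 + bernstein_cst s^2 h^2 is subharmonic on the ball, where
    g is a directional derivative of h, and phi = s^2 - |x - y|^2 vanishes on its
    boundary. *)
Lemma gradient_estimate y s v h (M : R) : lap h = 0 -> ev r2 v = 1 ->
  (forall x, eball y s x -> `|ev h x| <= M) ->
  s ^+ 4 * ev (dird v h) y ^+ 2 <= bernstein_cst * s ^+ 2 * M ^+ 2.
Proof.
move=> h0 v1 hM.
pose g := dird v h; pose phi := mpolyC n.+1 (s ^+ 2) - sqd y.
pose c := bernstein_cst * s ^+ 2.
pose F := (phi * g) * (phi * g) + c *: (h * h).
have c0 : 0 <= c by rewrite mulr_ge0 ?sqr_ge0// addr_ge0// mulr_ge0.
have g0 : lap g = 0 by rewrite lap_dird h0 raddf0.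
have dphi i : mderiv i phi = - 2%:R *: (var i - mpolyC n.+1 (y 0 i)).
  by rewrite mderivB mderivC sub0r mderiv_sqd scaleNr.
have lphi : lap phi = - mpolyC n.+1 (2%:R * n.+1%:R).
  rewrite raddfB /= lap_sqd; have -> : lap (mpolyC n.+1 (s ^+ 2)) = 0 :> poly.
    by rewrite /lap big1// => i _; rewrite mderivC raddf0.
  by rewrite sub0r.
have subh x : eball y s x -> 0 <= ev (lap F) x.
  move=> xs; rewrite /F raddfD /= lapZ !lapM h0 mul0r mulr0 addr0 add0r g0 lphi mulr0 addr0.
  rewrite /gdot !evE.
  set G := ev g x; set P := s ^+ 2 - ev (sqd y) x; rewrite !ev_sum.
  pose z i := x 0 i - y 0 i; pose gi i := ev (mderiv i g) x.
  pose hi i := ev (mderiv i h) x.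
  have -> : \sum_i ev (mderiv i phi * mderiv i g) x = \sum_i (- 2 * z i * gi i).
    by apply: eq_bigr => i _; rewrite dphi !evE.
  have -> : \sum_i ev (mderiv i (phi * g) * mderiv i (phi * g)) x =
      \sum_i (P * gi i - 2 * z i * G) ^+ 2.
    apply: eq_bigr => i _; rewrite mderivM dphi !evE -/G -/P /z /gi; ring.
  have -> : \sum_i ev (mderiv i h * mderiv i h) x = \sum_i hi i ^+ 2.
    by apply: eq_bigr => i _; rewrite evM expr2.
  have Gh : G ^+ 2 <= \sum_i hi i ^+ 2.
    have : 0 <= \sum_i (hi i - G * v 0 i) ^+ 2 by apply: sumr_ge0 => i _; exact: sqr_ge0.
    rewrite (sum_sqrB hi (fun i => v 0 i)).
    rewrite -ev_r2 v1; have -> : \sum_i v 0 i * hi i = G.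
      by rewrite /G /g /dird ev_sum; apply: eq_bigr => i _; rewrite evZ.
    nra.
  have Pz : P = s ^+ 2 - \sum_i z i ^+ 2 by rewrite /P ev_sqd.
  have zs : \sum_i z i ^+ 2 <= s ^+ 2 by move: xs; rewrite /eball /= ev_sqd.
  have z0 : 0 <= \sum_i z i ^+ 2 by apply: sumr_ge0 => i _; exact: sqr_ge0.
  have key : 4 * P * G * \sum_i (- 2 * z i * gi i) + 2 * \sum_i (P * gi i - 2 * z i * G) ^+ 2
      = 2 * \sum_i (P * gi i - 4 * z i * G) ^+ 2 - 24 * G ^+ 2 * \sum_i z i ^+ 2.
    exact: sum_cross.
  have sq0 : 0 <= \sum_i (P * gi i - 4 * z i * G) ^+ 2.
    by apply: sumr_ge0 => i _; exact: sqr_ge0.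
  have n0 : 0 <= n.+1%:R :> R by [].
  have G0 := sqr_ge0 G.
  move: key sq0 zs z0 Pz Gh n0 G0; rewrite /c /bernstein_cst.
  set S1 := \sum_i (- 2 * z i * gi i); set S2 := \sum_i (P * gi i - 2 * z i * G) ^+ 2.
  set S3 := \sum_i (P * gi i - _) ^+ 2; set Z := \sum_i z i ^+ 2; set H := \sum_i hi i ^+ 2.
  move: (n.+1%:R : R) => N key sq0 zs z0 Pz Gh n0 G0.
  suff : 0 <= (4 * P * G * S1 + 2 * S2) - 4 * N * P * G ^+ 2
      + 2 * (12 + 2 * N) * s ^+ 2 * H.
    by congr (is_true (0 <= _)); ring.
  rewrite key Pz.
  have e1 : 0 <= s ^+ 2 * (12 + 2 * N) * (H - G ^+ 2).
    by rewrite mulr_ge0 ?subr_ge0// mulr_ge0 ?sqr_ge0//; lra.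
  have e2 : 0 <= (s ^+ 2 - Z) * G ^+ 2 by rewrite mulr_ge0// subr_ge0.
  have e3 : 0 <= N * Z * G ^+ 2 by rewrite mulr_ge0// mulr_ge0.
  by nra.
have bd x : ev (sqd y) x = s ^+ 2 -> ev F x <= c * M ^+ 2.
  move=> xs; rewrite /F !evE xs subrr !mul0r add0r ler_wpM2l//.
  have := hM x; rewrite /eball /= xs lexx => /(_ isT) hx.
  by rewrite -expr2 -real_normK ?num_real// ler_sqr ?nnegrE// (le_trans _ hx).
have yy : eball y s y.
  by rewrite /eball /= ev_sqd big1 ?sqr_ge0// => i _; rewrite subrr expr0n.
have := eball_max subh bd yy.
rewrite /F !evE ev_sqd big1 ?subr0 => [|i _]; last by rewrite subrr expr0n.
have e : s ^+ 4 * ev g y ^+ 2 = s ^+ 2 * ev g y * (s ^+ 2 * ev g y) by ring.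
rewrite -/g e -/c; have := mulr_ge0 c0 (sqr_ge0 (ev h y)); rewrite expr2.
lra.
Qed.

End GradientEstimate.

(** * Homogeneous components of harmonic polynomials *)

Section ComponentBound.
Context {R : realType} {n : nat}.
Local Notation poly := (mpoly n.+1 R).
Local Notation point := 'rV[R]_n.+1.
Implicit Types (p q h : poly) (x y v : point) (i j : 'I_n.+1).

Lemma sum_sqr_triangle (a b : 'I_n.+1 -> R) (al be : R) : 0 < al -> 0 < be ->
  \sum_i a i ^+ 2 <= al ^+ 2 -> \sum_i b i ^+ 2 <= be ^+ 2 ->
  \sum_i (a i + b i) ^+ 2 <= (al + be) ^+ 2.
Proof.
move=> al0 be0 ha hb.
have cs : \sum_i a i * b i <= al * be.
  have : 0 <= \sum_i (be * a i - al * b i) ^+ 2 by apply: sumr_ge0 => i _; exact: sqr_ge0.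
  have -> : \sum_i (be * a i - al * b i) ^+ 2 = be ^+ 2 * (\sum_i a i ^+ 2)
      - 2 * al * be * (\sum_i a i * b i) + al ^+ 2 * (\sum_i b i ^+ 2).
    by rewrite !mulr_sumr -sumrN -!big_split; apply: eq_bigr => i _ /=; ring.
  have h1 : be ^+ 2 * (\sum_i a i ^+ 2) <= be ^+ 2 * al ^+ 2 by rewrite ler_wpM2l ?sqr_ge0.
  have h2 : al ^+ 2 * (\sum_i b i ^+ 2) <= al ^+ 2 * be ^+ 2 by rewrite ler_wpM2l ?sqr_ge0.
  move=> h3; rewrite -(@ler_pM2l _ (al * be)) ?mulr_gt0//.
  move: h1 h2 h3; move: (\sum_i a i ^+ 2) (\sum_i b i ^+ 2) (\sum_i a i * b i) => A B C; lra.
have -> : \sum_i (a i + b i) ^+ 2 =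
    \sum_i a i ^+ 2 + 2 * (\sum_i a i * b i) + \sum_i b i ^+ 2.
  by rewrite mulr_sumr -!big_split; apply: eq_bigr => i _ /=; ring.
move: ha hb cs; move: (\sum_i a i ^+ 2) (\sum_i b i ^+ 2) (\sum_i a i * b i) => A B C; lra.
Qed.

Lemma eball_triangle x y (r s : R) : 0 < r -> 0 < s ->
  eball 0 r y -> eball y s x -> eball 0 (r + s) x.
Proof.
rewrite /eball /= !ev_sqd => r0 s0 yr xs.
have := sum_sqr_triangle r0 s0 yr xs; congr (is_true (_ <= _)).
by apply: eq_bigr => i _; rewrite !mxE; ring.
Qed.

Lemma bernstein_cst_ge1 : 1 <= bernstein_cst (R := R) (n := n).
Proof. by rewrite /bernstein_cst; have : 0 <= n.+1%:R :> R by []; lra. Qed.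

Let g1 := bernstein_cst_ge1.

Lemma dird_bound r s v h (M : R) : lap h = 0 -> ev r2 v = 1 -> 0 < r -> 0 < s ->
  (forall x, eball 0 (r + s) x -> `|ev h x| <= M) ->
  forall y, eball 0 r y -> `|ev (dird v h) y| <= bernstein_cst (n := n) * M / s.
Proof.
move=> h0 v1 r0 s0 hM y yr.
have := @gradient_estimate R n y s v h M h0 v1
  (fun x xs => hM x (eball_triangle r0 s0 yr xs)).
have M0 : 0 <= M.
  apply: le_trans (hM y _); first exact: normr_ge0.
  by rewrite /eball /=; apply: le_trans yr _; nra.
move=> e; rewrite ler_pdivlMr// -ler_sqr ?nnegrE; last 2 first.
- by rewrite mulr_ge0// ltW.
- by rewrite mulr_ge0//; have := g1; lra.
rewrite exprMn real_normK ?num_real//.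
have e1 : s ^+ 2 * (ev (dird v h) y ^+ 2 * s ^+ 2) <= s ^+ 2 * (bernstein_cst (n := n) * M ^+ 2).
  have -> : s ^+ 2 * (ev (dird v h) y ^+ 2 * s ^+ 2) = s ^+ 4 * ev (dird v h) y ^+ 2 by ring.
  by have -> : s ^+ 2 * (bernstein_cst (n := n) * M ^+ 2) = bernstein_cst (n := n) * s ^+ 2 * M ^+ 2 by ring.
rewrite ler_pM2l ?exprn_gt0// in e1; apply: le_trans e1 _.
rewrite exprMn ler_wpM2r ?sqr_ge0//.
by have := g1; nra.
Qed.

(** The gradient estimate is applied k times, on balls whose radii decrease by
    1 / (k + 1) each time. *)
Lemma iter_dird_bound v h (M : R) (k : nat) : lap h = 0 -> ev r2 v = 1 ->
  (forall x, eball 0 1 x -> `|ev h x| <= M) ->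
  `|ev (iter k (dird v) h) 0| <= (bernstein_cst (n := n) * k.+1%:R) ^+ k * M.
Proof.
move=> h0 v1 hM.
have k0 : 0 < k.+1%:R :> R by [].
have lapit (j : nat) : lap (iter j (dird v) h) = 0.
  by elim: j => [|j IH]; rewrite ?iterS ?lap_dird ?IH ?raddf0.
have main (j : nat) : (j <= k)%N -> forall y, eball 0 (1 - j%:R / k.+1%:R) y ->
    `|ev (iter j (dird v) h) y| <= (bernstein_cst (n := n) * k.+1%:R) ^+ j * M.
  elim: j => [|j IH] jk y.
    by rewrite mul0r subr0 expr0 mul1r; exact: hM.
  move=> yr /=.
  have := @dird_bound (1 - j.+1%:R / k.+1%:R) k.+1%:R^-1 v (iter j (dird v) h)
    ((bernstein_cst (n := n) * k.+1%:R) ^+ j * M) (lapit j) v1.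
  rewrite subr_gt0 ltr_pdivrMr// mul1r ltr_nat ltnS jk invr_gt0 k0 => /(_ isT isT).
  have -> : 1 - j.+1%:R / k.+1%:R + k.+1%:R^-1 = 1 - j%:R / k.+1%:R :> R.
    by rewrite -natr1 mulrDl opprD addrA mul1r subrK.
  move=> /(_ (IH (ltnW jk)) y yr).
  by congr (is_true (_ <= _)); rewrite invrK exprS; ring.
apply: main => //; rewrite /eball /= ev_sqd big1 ?sqr_ge0// => i _.
by rewrite subrr expr0n.
Qed.

Lemma ev_euler v q : ev (dird v q) v = ev (euler q) v.
Proof.
by rewrite /dird /euler !ev_sum; apply: eq_bigr => i _; rewrite evZ evM ev_var.
Qed.

Lemma hom_dird k v q : hom k.+1 q -> hom k (dird v q).
Proof. by move=> hq; apply: hom_sum => i _; apply/homZ/hom_mderiv. Qed.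

Lemma dird_hom0 v q : hom 0 q -> dird v q = 0.
Proof. by move=> hq; rewrite /dird big1// => i _; rewrite hom_mderiv0// scaler0. Qed.

Lemma iter_dird0 k v : iter k (dird v) 0 = 0.
Proof. by elim: k => //= k ->; rewrite raddf0. Qed.

(** The k-th derivative at the origin isolates the component of degree k. *)
Lemma iter_dird_hom (k j : nat) v q : hom j q ->
  ev (iter k (dird v) q) 0 = if j == k then k`!%:R * ev q v else 0.
Proof.
elim: k j q => [|k IH] j q hq.
  have := ev_hom 0 v hq; rewrite scale0r /= => ->.
  by case: j {hq} => [|j]; rewrite ?expr0// exprS !mul0r.
rewrite iterSr; case: j hq => [|j] hq.
  by rewrite dird_hom0// iter_dird0 ev0.
rewrite (IH j); last exact: hom_dird.
rewrite eqSS; case: eqP => // <-.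
by rewrite ev_euler hq evZ factS natrM; ring.
Qed.

(** This follows from (k + 1)^k k! <= (2 k)! <= 4^k (k!)^2. *)
Lemma expn_le_fact k : (k.+1 ^ k <= 4 ^ k * k`!)%N.
Proof.
have h1 (j : nat) : (k.+1 ^ j * k`! <= (k + j)`!)%N.
  elim: j => [|j IH]; first by rewrite mul1n addn0.
  by rewrite expnS addnS factS -mulnA leq_mul// ltnS leq_addr.
have h2 (l : nat) : ((l + l)`! <= 4 ^ l * l`! * l`!)%N.
  elim: l => [//|l IH]; rewrite addnS addSn !factS expnS.
  apply: (@leq_trans (4 * l.+1 * l.+1 * (4 ^ l * l`! * l`!))); last by apply/eq_leq; ring.
  by rewrite mulnA leq_mul//; lia.
rewrite -(@leq_pmul2r k`!) ?fact_gt0//.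
exact: leq_trans (h1 k) (h2 k).
Qed.

(** A Cauchy estimate: the value of P k at v is the k-th derivative along v at the
    origin, divided by k!, of the sum of the components, and the maximum principle
    bounds this sum on the unit ball. The factor grows only geometrically with the
    degree because (k + 1)^k does so relatively to k!, and it does not depend on
    the number of components. *)
Lemma component_bound N (P : nat -> poly) v (M : R) :
  (forall k, hom k (P k)) -> (forall k, lap (P k) = 0) -> ev r2 v = 1 ->
  (forall x, ev r2 x = 1 -> `|\sum_(k < N) ev (P k) x| <= M) ->
  forall k, (k < N)%N -> `|ev (P k) v| <= (4 * bernstein_cst (n := n)) ^+ k * M.
Proof.
move=> hP lP v1 PM k kN.
pose p : poly := \sum_(k < N) P k.
have lp : lap p = 0 by rewrite raddf_sum big1 => [//|i _]; exact: lP.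
have pM x : eball 0 1 x -> `|ev p x| <= M.
  move=> xb; rewrite ler_norml; apply/andP; split.
    rewrite lerNl -evN; apply: (@eball_max R n 0 1 (- p)) xb => [y _|y].
      by rewrite raddfN /= lp oppr0 ev0.
    rewrite sqd0 expr1n => /PM; rewrite -ev_sum -/p evN ler_norml => /andP[? _].
    by rewrite lerNl.
  apply: (@eball_max R n 0 1 p) xb => [y _|y]; first by rewrite lp ev0.
  by rewrite sqd0 expr1n => /PM; rewrite -ev_sum -/p ler_norml => /andP[].
have := @iter_dird_bound v p M k lp v1 pM.
have -> : ev (iter k (dird v) p) 0 = k`!%:R * ev (P k) v.
  have -> : iter k (dird v) p = \sum_(j < N) iter k (dird v) (P j).
    by elim: (k) => //= l ->; rewrite raddf_sum.
  rewrite ev_sum (bigD1 (Ordinal kN))//= (iter_dird_hom k v (hP k)) eqxx.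
  rewrite big1 ?addr0// => j jk; rewrite (iter_dird_hom k v (hP j)).
  by case: eqP => // jk'; move: jk; rewrite -val_eqE /= jk' eqxx.
have M0 : 0 <= M := le_trans (normr_ge0 _) (PM _ v1).
rewrite normrM ger0_norm// => h.
have f0 : 0 < k`!%:R :> R by rewrite ltr0n fact_gt0.
rewrite -(ler_pM2l f0); apply: (le_trans h).
rewrite mulrA ler_wpM2r//.
have g0 : 0 <= bernstein_cst (n := n) ^+ k :> R.
  by rewrite exprn_ge0//; have := g1; lra.
have -> : k`!%:R * (4 * bernstein_cst (n := n)) ^+ k = bernstein_cst (n := n) ^+ k * (4 ^+ k * k`!%:R) :> R.
  by rewrite exprMn; ring.
rewrite exprMn ler_wpM2l// -!natrX -natrM ler_nat.
exact: expn_le_fact.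
Qed.

End ComponentBound.

(** * Antiinvariant harmonic polynomials *)

Section AntiinvariantHarmonics.
Context {R : realType} {n : nat}.
Local Notation poly := (mpoly n.+1 R).
Local Notation point := 'rV[R]_n.+1.
Implicit Types (q P Q : poly) (x y : point) (f g : point -> R) (l : 'I_n.+1).
Context (ix iy : 'I_n.+1) (xy : ix != iy) (p : nat).

Local Notation zre := (zre (R := R) ix iy).
Local Notation zim := (zim (R := R) ix iy).
Local Notation zsq := (zsq (R := R) ix iy).
Local Notation hext := (hext (R := R) ix iy).

Lemma zre_zimD a b :
  zre (a + b) = zre a * zre b - zim a * zim b /\
  zim (a + b) = zre a * zim b + zim a * zre b.
Proof.
elim: a => [|a [IH1 IH2]].
  by rewrite add0n !(zre0, zim0) !mul1r !mul0r subr0 addr0.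
by rewrite addSn !zreS !zimS IH1 IH2; split; ring.
Qed.

Lemma zsqXn a : zsq ^+ a = zre a ^+ 2 + zim a ^+ 2.
Proof.
elim: a => [|a IH]; first by rewrite !(zre0, zim0) expr0 expr1n expr0n addr0.
by rewrite exprS IH zreS zimS zsqE; ring.
Qed.

(** The formula 2 cos (p t) sin ((p + b) t) = sin ((2 p + b) t) + sin (b t). *)
Lemma zre_zim_rec b : zre p * zim (p + b) =
  2^-1 *: (zim (p + (p + b)) + zsq ^+ p * zim b).
Proof.
rewrite (zre_zimD p (p + b)).2 (zre_zimD p b).1 zsqXn (zre_zimD p b).2.
set B := zim b; set A := zre b; set C := zre p; set S := zim p.
have -> : C * (C * B + S * A) + S * (C * A - S * B) + (C ^+ 2 + S ^+ 2) * B =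
    2%:R *: (C * (C * B + S * A)) by rewrite scaler_nat mulr2n; ring.
by rewrite scalerA mulVf ?scale1r// pnatr_eq0.
Qed.

(** The homogeneous harmonic polynomials that change sign under the reflections in
    the lines of angles multiple of pi / p in the z-plane: their angular frequencies
    are positive multiples of p. The inductive form serves to prove properties by
    adding one harmonic extension at a time. *)
Inductive aharm (k : nat) : poly -> Prop :=
| aharm0 : aharm k 0
| aharm_hext s j q P : (0 < j)%N -> (s + j * p)%N = k -> wpoly ix iy q -> hom s q ->
    aharm k P -> aharm k (hext s.+1 (j * p) q + P).

Lemma aharmD k P Q : aharm k P -> aharm k Q -> aharm k (P + Q).
Proof.
move=> aP aQ; elim: aP => [|s j q {}P j0 sk wq hq _ IH]; first by rewrite add0r.
by rewrite -addrA; apply: aharm_hext.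
Qed.

Lemma aharm1 k s j q : (0 < j)%N -> (s + j * p)%N = k -> wpoly ix iy q -> hom s q ->
  aharm k (hext s.+1 (j * p) q).
Proof. by move=> *; rewrite -[hext _ _ _]addr0; apply: aharm_hext => //; exact: aharm0. Qed.

Lemma aharmZ k c P : aharm k P -> aharm k (c *: P).
Proof.
elim=> [|s j q {}P j0 sk wq hq _ IH]; first by rewrite scaler0; exact: aharm0.
by rewrite scalerDr -hextZ; apply: aharm_hext => //; [exact: wpolyZ|exact: homZ].
Qed.

Lemma hom_iter_lap0 s q : hom s q -> iter s.+1 lap q = 0.
Proof. by move=> hq; apply: (iter_lap_hom0 hq); lia. Qed.

Lemma aharm_lap k P : aharm k P -> lap P = 0.
Proof.
elim=> [|s j q {}P j0 sk wq hq _ IH]; first by rewrite raddf0.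
by rewrite raddfD /= IH addr0 lap_hext//; exact: hom_iter_lap0.
Qed.

Lemma aharm_hom k P : aharm k P -> hom k P.
Proof.
elim=> [|s j q {}P j0 sk wq hq _ IH]; first exact: hom0.
apply: homD => //; rewrite -sk /hom natrD; exact: (homR_hext xy).
Qed.

Lemma aharm_small k P : (k < p)%N -> aharm k P -> P = 0.
Proof.
move=> kp; elim=> // s j q {}P j0 sk; have : (j * p <= k)%N by lia.
by case: j j0 {sk} => // j _; rewrite mulSn; lia.
Qed.

Lemma zim_mulp j x : ev (zim p) x = 0 -> ev (zim (j * p)) x = 0.
Proof.
move=> z0; elim: j => [|j IH]; first by rewrite mul0n ev0.
by rewrite mulSn (zre_zimD _ _).2 !evE z0 IH mulr0 mul0r addr0.
Qed.

Lemma ev_hext N m q x : ev (hext N m q) x =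
  (\sum_(k < N) hcoef m k * ev (iter k lap q) x * ev zsq x ^+ k) * ev (zim m) x.
Proof.
rewrite ev_sum mulr_suml; apply: eq_bigr => k _.
by rewrite evZ !evM evXn; ring.
Qed.

(** Im z^p divides Im z^(j p). *)
Lemma aharm_vanish k P x : aharm k P -> ev (zim p) x = 0 -> ev P x = 0.
Proof.
move=> + z0; elim=> [|s j q {}P j0 sk wq hq _ IH]; first by rewrite ev0.
by rewrite evD IH ev_hext zim_mulp// mulr0 addr0.
Qed.

(** The components are a function on nat that vanishes from N on, so that the
    lengths of two sums can be made equal. *)
Definition sums_of_aharm f := exists (N : nat) (P : nat -> poly),
  [/\ forall k, aharm k (P k), forall k, (N <= k)%N -> P k = 0 &
      forall x, ev r2 x = 1 -> f x = \sum_(k < N) ev (P k) x].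

Lemma sums_widen N M (P : nat -> poly) x : (N <= M)%N -> (forall k, (N <= k)%N -> P k = 0) ->
  \sum_(k < N) ev (P k) x = \sum_(k < M) ev (P k) x.
Proof.
move=> NM P0; rewrite -(big_mkord xpredT (fun k => ev (P k) x)) -(big_mkord xpredT (fun k => ev (P k) x)).
rewrite [RHS](big_cat_nat (n := N))//= [X in _ + X]big_nat_cond.
by rewrite [X in _ + X]big1 ?addr0// => k /andP[/andP[Nk _] _]; rewrite P0// ev0.
Qed.

Lemma sumsD f g : sums_of_aharm f -> sums_of_aharm g -> sums_of_aharm (fun x => f x + g x).
Proof.
move=> [N [P [aP P0 fP]]] [M [Q [aQ Q0 gQ]]]; exists (maxn N M), (fun k => P k + Q k); split.
- by move=> k; apply: aharmD.
- by move=> k; rewrite geq_max => /andP[Nk Mk]; rewrite P0// Q0// addr0.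
move=> x x1; rewrite fP// gQ// (sums_widen _ (leq_maxl N M))// (sums_widen _ (leq_maxr N M))//.
by rewrite -big_split; apply: eq_bigr => k _; rewrite evD.
Qed.

Lemma sumsZ c f : sums_of_aharm f -> sums_of_aharm (fun x => c * f x).
Proof.
move=> [N [P [aP P0 fP]]]; exists N, (fun k => c *: P k); split.
- by move=> k; apply: aharmZ.
- by move=> k Nk; rewrite P0// scaler0.
by move=> x x1; rewrite fP// mulr_sumr; apply: eq_bigr => k _; rewrite evZ.
Qed.

Lemma sums_ext f g : (forall x, ev r2 x = 1 -> f x = g x) ->
  sums_of_aharm g -> sums_of_aharm f.
Proof.
by move=> fg [N [P [aP P0 fP]]]; exists N, P; split=> // x x1; rewrite fg// fP.
Qed.

Lemma sums_ev k P : aharm k P -> sums_of_aharm (ev P).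
Proof.
move=> aP; exists k.+1, (fun j => if j == k then P else 0); split.
- by move=> j; case: eqP => [->//|_]; exact: aharm0.
- by move=> j; case: eqP => [->|//]; rewrite ltnn.
move=> x _; rewrite (bigD1 ord_max)//= eqxx big1 ?addr0// => j jk.
by case: eqP => [jk'|]; rewrite ?ev0//; move: jk; rewrite -val_eqE /= jk' eqxx.
Qed.

Lemma sums0 : sums_of_aharm (fun=> 0).
Proof. by apply: sums_ext (sums_ev (aharm0 0)) => x _; rewrite ev0. Qed.

(** On the sphere |x|^2 = 1, so that the decomposition of the product in
    var_hext is a sum of two harmonic extensions of the same angular
    frequency. *)
Lemma sums_var_ev l k P : (1 < n)%N -> l != ix -> l != iy -> aharm k P ->
  sums_of_aharm (fun x => x 0 l * ev P x).
Proof.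
move=> n1 lx ly; elim=> [|s j q {}P j0 sk wq hq _ IH].
  by apply: sums_ext sums0 => x _; rewrite ev0 mulr0.
have -> : (fun x => x 0 l * ev (hext s.+1 (j * p) q + P) x) =
    (fun x => x 0 l * ev (hext s.+1 (j * p) q) x + x 0 l * ev P x).
  by apply/funext => x; rewrite evD mulrDr.
apply: sumsD => //; set m := (j * p)%N in sk *.
have D0 : n.+1%:R - 2 + 2 * (s%:R + m%:R) != 0 :> R.
  have : 3%:R <= n.+1%:R :> R by rewrite ler_nat.
  have : 0 <= s%:R + m%:R :> R by rewrite addr_ge0.
  move=> h1 h2; apply/eqP; lra.
have wg : wpoly ix iy (mderiv l q) by exact: wpoly_mderiv.
have hg : homR (s%:R - 1) (mderiv l q) by exact: homR_mderiv.
have g0 : iter s.+1 lap (mderiv l q) = 0.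
  by rewrite iter_lap_mderiv hom_iter_lap0// raddf0.
have := var_hext xy wq hq D0 g0.
set q1 := var l * q - _ => e.
have hq1 : hom s.+1 q1.
  apply: homB; first exact: (homM (hom_var l)).
  apply: homZ; rewrite /hom eulerM hg (homR_wsq xy).
  by rewrite -scalerAr -scalerAl -scalerDl; congr (_ *: _); rewrite -natr1; ring.
have wq1 : wpoly ix iy q1.
  rewrite /q1 -scaleNr; apply: wpolyD; first by apply: wpolyM => //; exact: wpoly_var.
  by apply/wpolyZ/wpolyM => //; exact: wpoly_wsq.
have a1 : aharm k.+1 (hext s.+2 m q1) by apply: aharm1 => //; rewrite -/m addSn sk.
have a2 : sums_of_aharm (ev (hext s.+2 m (mderiv l q))).
  have [s0|s0] := posnP s.
    have -> : mderiv l q = 0 by apply: hom_mderiv0; rewrite -s0.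
    apply: sums_ext sums0 => x _; rewrite ev_hext big1 ?mul0r// => i _.
    by rewrite iter_lap0 ev0 mulr0 mul0r.
  have hg' : hom s.-1 (mderiv l q) by apply: hom_mderiv; rewrite prednK.
  have -> : hext s.+2 m (mderiv l q) = hext s.-1.+1 m (mderiv l q).
    by apply: hext_le; [rewrite prednK//; lia|exact: hom_iter_lap0].
  by apply: (@sums_ev k.-1); apply: aharm1 => //; rewrite -/m; lia.
have := sumsD (sums_ev a1) (sumsZ (n.+1%:R - 2 + 2 * (s%:R + m%:R))^-1 a2).
apply: sums_ext => x x1.
rewrite -[x 0 l]ev_var -evM -(@hext_le _ _ _ _ s.+1 s.+2)//; last exact: hom_iter_lap0.
by rewrite e evD evZ evM x1 mul1r.
Qed.

Lemma sums_big N (F : nat -> point -> R) : (forall k, sums_of_aharm (F k)) ->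
  sums_of_aharm (fun x => \sum_(k < N) F k x).
Proof.
move=> aF; elim: N => [|N IH].
  by apply: sums_ext sums0 => x _; rewrite big_ord0.
by apply: sums_ext (sumsD IH (aF N)) => x _; rewrite big_ord_recr.
Qed.

Lemma sums_var l f : (1 < n)%N -> l != ix -> l != iy -> sums_of_aharm f ->
  sums_of_aharm (fun x => x 0 l * f x).
Proof.
move=> n1 lx ly [N [P [aP P0 fP]]].
have := @sums_big N (fun k x => x 0 l * ev (P k) x) (fun k => sums_var_ev n1 lx ly (aP k)).
by apply: sums_ext => x x1; rewrite fP// mulr_sumr.
Qed.

Lemma sums_zim j : (0 < j)%N -> sums_of_aharm (ev (zim (j * p))).
Proof.
move=> j0; have a : aharm (0 + j * p) (hext 1 (j * p) 1).
  apply: aharm1 => //; last by rewrite -mpolyC1; exact: homC.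
  by split; rewrite -mpolyC1 mderivC.
apply: sums_ext (sums_ev a) => x _.
by rewrite ev_hext big_ord1 expr0 mulr1 ev1 /hcoef mulr1 mul1r.
Qed.

(** Closing this module under equality on the sphere gives it the stability
    under Re z^p of a module over a larger ring, shown below. *)
Inductive zim_module : (point -> R) -> Prop :=
| zm_zim j : (0 < j)%N -> zim_module (ev (zim (j * p)))
| zm_D f g : zim_module f -> zim_module g -> zim_module (fun x => f x + g x)
| zm_Z c f : zim_module f -> zim_module (fun x => c * f x)
| zm_var l f : l != ix -> l != iy -> zim_module f -> zim_module (fun x => x 0 l * f x)
| zm_ext f g : (forall x, ev r2 x = 1 -> f x = g x) -> zim_module g -> zim_module f.

Lemma zim_module_sums f : (1 < n)%N -> zim_module f -> sums_of_aharm f.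
Proof.
move=> n1; elim=> {f} [j j0|f g _ af _ ag|c f _ af|l f lx ly _ af|f g fg _ ag].
- exact: sums_zim.
- exact: sumsD.
- exact: sumsZ.
- exact: sums_var.
- exact: sums_ext ag.
Qed.

Lemma ev_zsq x : ev zsq x = ev r2 x - \sum_(l | (l != ix) && (l != iy)) x 0 l ^+ 2.
Proof.
rewrite ev_r2 (bigD1 ix)//= (bigD1 iy) 1?eq_sym//= addrA addrK.
by rewrite zsqE evD !evXn !ev_var.
Qed.

(** On the sphere |z|^2 = 1 - |w|^2. *)
Lemma zm_zsq f : zim_module f -> zim_module (fun x => ev zsq x * f x).
Proof.
move=> zf; have h (s : seq 'I_n.+1) : zim_module
    (fun x => (\sum_(l <- s | (l != ix) && (l != iy)) x 0 l ^+ 2) * f x).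
  elim: s => [|l s IH].
    by apply: zm_ext (zm_Z 0 zf) => x _; rewrite big_nil.
  have [/andP[lx ly]|nl] := boolP ((l != ix) && (l != iy)); last first.
    by apply: zm_ext IH => x _; rewrite big_cons (negbTE nl).
  apply: zm_ext (zm_D (zm_var lx ly (zm_var lx ly zf)) IH) => x _.
  by rewrite big_cons lx ly /= mulrDl expr2 mulrA.
apply: zm_ext (zm_D zf (zm_Z (-1) (h _))) => x x1.
by rewrite ev_zsq x1 mulrBl mul1r mulN1r.
Qed.

(** The product of Re z^p and Im z^((j + 1) p) is half the sum of Im z^((j + 2) p) and
    |z|^(2 p) Im z^(j p). *)
Lemma zm_zre f : zim_module f -> zim_module (fun x => ev (zre p) x * f x).
Proof.
elim=> {f} [j j0|f g zf IHf zg IHg|c f zf IH|l f lx ly zf IH|f g fg _ IH].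
- case: j j0 => // j _.
  have h : zim_module (fun x => ev zsq x ^+ p * ev (zim (j * p)) x).
    case: j => [|j].
      by apply: zm_ext (zm_Z 0 (zm_zim (isT : (0 < 1)%N))) => x _; rewrite mul0r mul0n ev0 mulr0.
    have h k : zim_module (fun x => ev zsq x ^+ k * ev (zim (j.+1 * p)) x).
      elim: k => [|k IH].
        by apply: zm_ext (zm_zim (isT : (0 < j.+1)%N)) => x _; rewrite expr0 mul1r.
      by apply: zm_ext (zm_zsq IH) => x _; rewrite exprS mulrA.
    exact: h.
  apply: zm_ext (zm_Z 2^-1 (zm_D (zm_zim (isT : (0 < j.+2)%N)) h)) => x _.
  by rewrite -evM mulSn zre_zim_rec -mulSn -mulSn evZ evD evM evXn.
- by apply: zm_ext (zm_D IHf IHg) => x _; rewrite mulrDr.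
- by apply: zm_ext (zm_Z c IH) => x _; rewrite mulrCA.
- by apply: zm_ext (zm_var lx ly IH) => x _; rewrite mulrCA.
- by apply: zm_ext IH => x x1; rewrite fg.
Qed.

(** An algebra of functions invariant under the reflections, large enough to
    separate the points of the lune. *)
Inductive invariant_algebra : (point -> R) -> Prop :=
| ia_cst c : invariant_algebra (fun=> c)
| ia_var l : l != ix -> l != iy -> invariant_algebra (fun x => x 0 l)
| ia_zre : invariant_algebra (ev (zre p))
| ia_D f g : invariant_algebra f -> invariant_algebra g ->
    invariant_algebra (fun x => f x + g x)
| ia_M f g : invariant_algebra f -> invariant_algebra g ->
    invariant_algebra (fun x => f x * g x).

Lemma ia_zm g f : invariant_algebra g -> zim_module f -> zim_module (fun x => g x * f x).
Proof.
move=> ag; elim: ag f => {g} [c|l lx ly||g h _ IHg _ IHh|g h _ IHg _ IHh] f zf.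
- exact: zm_Z.
- exact: zm_var.
- exact: zm_zre.
- by apply: zm_ext (zm_D (IHg _ zf) (IHh _ zf)) => x _; rewrite mulrDl.
- by apply: zm_ext (IHg _ (IHh _ zf)) => x _; rewrite mulrA.
Qed.

Lemma continuous_ia g : invariant_algebra g -> continuous g.
Proof.
elim=> {g} [c|l _ _||g h _ cg _ ch|g h _ cg _ ch] x.
- exact: cst_continuous.
- exact: coord_continuous.
- exact: continuous_ev.
- exact: (cvgD (cg x) (ch x)).
- exact: (cvgM (cg x) (ch x)).
Qed.

End AntiinvariantHarmonics.

(** * Geometry of the lune *)

Section Polar.
Context {R : realType}.

Lemma polar_upper (a b : R) : 0 <= b ->
  exists r t, [/\ 0 <= r, 0 <= t <= pi, a = r * cos t & b = r * sin t].
Proof.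
move=> b0; pose r := Num.sqrt (a ^+ 2 + b ^+ 2).
have r2 : r ^+ 2 = a ^+ 2 + b ^+ 2 by rewrite sqr_sqrtr// addr_ge0// sqr_ge0.
have [r0|r0] := eqVneq r 0.
  have /eqP := r2; rewrite r0 expr0n eq_sym paddr_eq0 ?sqr_ge0// !sqrf_eq0.
  move=> /andP[/eqP -> /eqP ->]; exists 0, 0.
  by rewrite !mul0r !lexx pi_ge0.
have r0' : 0 < r by rewrite lt_neqAle eq_sym r0 sqrtr_ge0.
have ar : -1 <= a / r <= 1.
  rewrite ler_pdivlMr// ler_pdivrMr// mul1r mulN1r -ler_norml -ler_sqr ?nnegrE ?(ltW r0')//.
  by rewrite real_normK ?num_real// r2 lerDl sqr_ge0.
exists r, (acos (a / r)); split; first exact: ltW.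
- by rewrite acos_ge0// acos_lepi.
- by rewrite acosK ?in_itv//= mulrC divfK.
have e : 1 - (a / r) ^+ 2 = (b / r) ^+ 2.
  apply: (mulIf (expf_neq0 2 r0)); rewrite mulrBl -!exprMn !divfK// mul1r r2; ring.
by rewrite sin_acos// e sqrtr_sqr ger0_norm ?divr_ge0 ?(ltW r0')// mulrC divfK.
Qed.

Lemma polar (a b : R) :
  exists r t, [/\ 0 <= r, 0 <= t, a = r * cos t & b = r * sin t].
Proof.
have [b0|b0] := leP 0 b.
  by have [r [t [r0 /andP[t0 _] -> ->]]] := polar_upper a b0; exists r, t.
have nb0 : 0 <= - b by rewrite oppr_ge0 ltW.
have [r [t [r0 /andP[t0 tpi] -> bE]]] := polar_upper a nb0.
exists r, (- t + pi *+ 2); split => //.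
- by rewrite mulr2n; have := pi_ge0 R; lra.
- by rewrite cosD2pi cosN.
- by rewrite sinD2pi sinN mulrN -bE opprK.
Qed.

(** Reflections in the walls of the dihedral arrangement reduce any angle to
    [0, pi / p], with one sign for all the multiples of p. *)
Lemma fold_angle (p : nat) (t : R) : (0 < p)%N -> 0 <= t ->
  exists t' s, [/\ 0 <= t' <= pi / p%:R, s ^+ 2 = 1 &
    forall j, sin ((j * p)%:R * t) = s * sin ((j * p)%:R * t')].
Proof.
move=> p0 t0; have p0' : 0 < p%:R :> R by rewrite ltr0n.
have pp : 0 < pi / p%:R :> R by rewrite divr_gt0// pi_gt0.
pose k := Num.truncn (t / (pi / p%:R)).
have /andP[k1 k2] : k%:R <= t / (pi / p%:R) < k.+1%:R.
  by apply: truncn_itv; rewrite divr_ge0// ltW.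
rewrite ler_pdivlMr// in k1; rewrite ltr_pdivrMr// -natr1 mulrDl mul1r in k2.
pose t1 := t - k%:R * (pi / p%:R).
have tE : t = t1 + k%:R * (pi / p%:R) by rewrite subrK.
have E (j : nat) : (j * p)%:R * t = (j * p)%:R * t1 + pi *+ (j * k).
  rewrite tE mulrDr; congr (_ + _); rewrite -mulr_natl !natrM.
  by field; rewrite gt_eqF.
have sE (j : nat) : sin ((j * p)%:R * t) = (-1) ^+ (j * k) * sin ((j * p)%:R * t1).
  by rewrite E (alternatingn (@sinDpi R)).
have [ok|ek] := boolP (odd k); last first.
  exists t1, 1; rewrite expr1n; split => //; first by rewrite /t1; apply/andP; split; lra.
  by move=> j; rewrite sE -signr_odd oddM (negbTE ek) andbF.
exists (pi / p%:R - t1), (-1); rewrite sqrrN expr1n; split => //.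
  by rewrite /t1; apply/andP; split; lra.
move=> j; rewrite sE -signr_odd oddM ok andbT signr_odd.
have -> : (j * p)%:R * (pi / p%:R - t1) = - ((j * p)%:R * t1) + pi *+ j.
  rewrite mulrBr addrC; congr (_ + _); rewrite -mulr_natl natrM.
  by field; rewrite gt_eqF.
by rewrite (alternatingn (@sinDpi R)) sinN; ring.
Qed.

End Polar.

Section Lune.
Context {R : realType} (n p : nat) (n1 : (1 < n)%N) (p0 : (0 < p)%N).
Local Notation point := 'rV[R]_n.+1.
Implicit Types (x y : point).

Definition ix : 'I_n.+1 := inord n.-1.
Definition iy : 'I_n.+1 := inord n.

Let n0 : (0 < n)%N := ltnW n1.

Lemma val_ix : ix = n.-1 :> nat.
Proof. by rewrite inordK// ltnS leq_pred. Qed.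

Lemma val_iy : iy = n :> nat.
Proof. by rewrite inordK. Qed.

Lemma ix_iy : ix != iy.
Proof. by clear p0; rewrite -val_eqE /= val_ix val_iy; lia. Qed.

Lemma r2_split x : ev r2 x = \sum_(i < n.-1) x 0 (inord i) ^+ 2 + (x 0 ix ^+ 2 + x 0 iy ^+ 2).
Proof.
rewrite ev_r2 -(big_mkord xpredT (fun i => x 0 (inord i) ^+ 2)) /=.
rewrite (eq_bigr (fun i : 'I_n.+1 => x 0 (inord i) ^+ 2)); last by move=> i _; rewrite inord_val.
rewrite -(big_mkord xpredT (fun i => x 0 (inord i) ^+ 2)).
have recr (G : nat -> R) m : (0 < m)%N ->
    \sum_(0 <= i < m) G i = \sum_(0 <= i < m.-1) G i + G m.-1.
  by case: m => // m _; rewrite big_nat_recr.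
by rewrite recr//= recr// -addrA.
Qed.

Definition polar_at x (r t : R) := x 0 ix = r * cos t /\ x 0 iy = r * sin t.

Lemma zsq_polar x r t : polar_at x r t -> ev (zsq ix iy) x = r ^+ 2.
Proof.
move=> [a b]; rewrite /zsq evD !evXn !ev_var a b !exprMn -mulrDr cos2Dsin2 mulr1.
by [].
Qed.

Lemma lune_polar x : lune R n p x <-> ev r2 x = 1 /\
  exists r t, [/\ 0 <= r, 0 <= t <= pi / p%:R & polar_at x r t].
Proof.
split=> [[/sphereE x1 [w [t [w1 tp xw xx xy]]]]|[x1 [r [t [r0 tp [xx xy]]]]]].
  by split => //; exists (Num.sqrt (1 - enorm w ^+ 2)), t; split => //; exact: sqrtr_ge0.
split; first exact/sphereE.
pose w : 'rV[R]_n.-1 := \row_i x 0 (inord i).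
have w2 : enorm w ^+ 2 = 1 - r ^+ 2.
  rewrite sqr_sqrtr ?sumr_ge0// => [|i _]; last exact: sqr_ge0.
  under eq_bigr do rewrite mxE.
  have := r2_split x; rewrite x1 xx xy !exprMn -mulrDr cos2Dsin2 mulr1 => ->.
  by rewrite addrK.
have rE : Num.sqrt (1 - enorm w ^+ 2) = r.
  by rewrite w2 opprB addrC subrK sqrtr_sqr ger0_norm.
exists w, t; rewrite rE; split => //.
  rewrite -(@expr_le1 _ 2) ?sqrtr_ge0// w2 gerDl oppr_le0; exact: sqr_ge0.
by move=> i; rewrite mxE.
Qed.

(** A linear form vanishing on the wall of angle pi / p, nonnegative on the
    lune. *)
Definition wall x : R := sin (pi / p%:R) * x 0 ix - cos (pi / p%:R) * x 0 iy.

Lemma continuous_wall : continuous (wall : point -> R).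
Proof.
have -> : wall = ev (sin (pi / p%:R) *: var ix - cos (pi / p%:R) *: var iy).
  by apply/funext => x; rewrite /wall !evE.
exact: continuous_ev.
Qed.

Lemma wall_polar x r t : polar_at x r t -> wall x = r * sin (pi / p%:R - t).
Proof. by move=> [a b]; rewrite /wall a b sinB; ring. Qed.

Let pip : 0 < pi / p%:R :> R.
Proof. by rewrite divr_gt0 ?pi_gt0// ltr0n. Qed.

Let pip1 : pi / p%:R <= pi :> R.
Proof. by rewrite ler_pdivrMr ?ltr0n// ler_peMr ?pi_ge0// ler1n. Qed.

(** For a polar angle t in [0, pi], the sign of sin (pi / p - t) tells whether
    t <= pi / p. *)
Lemma lune_wall x :
  lune R n p x <-> [/\ ev r2 x = 1, 0 <= x 0 iy & 0 <= wall x].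
Proof.
rewrite lune_polar; split=> [[x1 [r [t [r0 /andP[t0 tp] h]]]]|[x1 y0 w0]].
  split => //; first by rewrite h.2 mulr_ge0// sin_ge0_pi// t0 (le_trans tp).
  by rewrite (wall_polar h) mulr_ge0// sin_ge0_pi//; apply/andP; split; have := pip1; lra.
split => //; have [r [t [r0 /andP[t0 tpi] a b]]] := polar_upper (x 0 ix) y0.
have [rz|rz] := eqVneq r 0.
  by exists 0, 0; rewrite lexx (ltW pip) /polar_at a b rz !mul0r; split.
exists r, t; split => //; rewrite t0 /= leNgt; apply/negP => pt.
move: w0; rewrite (wall_polar (conj a b)) pmulr_rge0; last by rewrite lt_neqAle eq_sym rz.
rewrite -opprB sinN oppr_ge0 leNgt sin_gt0_pi//.
by apply/andP; split; have := pip; lra.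
Qed.

Lemma zre_zim_polar m x r t : polar_at x r t ->
  ev (zre ix iy m) x = r ^+ m * cos (m%:R * t) /\
  ev (zim ix iy m) x = r ^+ m * sin (m%:R * t).
Proof.
move=> [a b]; elim: m => [|m [IH1 IH2]].
  by rewrite /zre /zim /= ev1 ev0 mul0r cos0 sin0 mulr1 mulr0.
rewrite zreS zimS !evE IH1 IH2 a b exprS -natr1 mulrDl mul1r cosD sinD.
by split; ring.
Qed.

Lemma lune_interior_wall x : ev r2 x = 1 -> 0 < x 0 iy -> 0 < wall x ->
  sphere_interior (lune R n p) x.
Proof.
move=> x1 y0 w0; split; first exact/sphereE.
have cw := continuous_wall.
have h1 : nbhs x [set y : point | 0 < y 0 iy].
  apply: open_nbhs_nbhs; split => //.
  apply: (@open_comp _ _ (fun y : point => y 0 iy) [set t | 0 < t]); last exact: open_gt.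
  by move=> z _; exact: coord_continuous.
have h2 : nbhs x [set y : point | 0 < wall y].
  apply: open_nbhs_nbhs; split => //.
  apply: (@open_comp _ _ wall [set t | 0 < t]); last exact: open_gt.
  by move=> z _; exact: cw.
rewrite /within /=; apply: filterS2 h1 h2 => y y1 y2 /sphereE ys.
by apply/lune_wall; split => //; exact: ltW.
Qed.

(** Where Im z^p does not vanish, z is not 0 and its angle is strictly between 0
    and pi / p. *)
Lemma lune_zim_interior x : lune R n p x -> ev (zim ix iy p) x != 0 ->
  sphere_interior (lune R n p) x.
Proof.
move=> /lune_polar [x1 [r [t [r0 /andP[t0 tp] h]]]].
rewrite (zre_zim_polar p h).2 mulf_eq0 negb_or => /andP[rp st].
have rz : 0 < r.
  by rewrite lt_neqAle r0 andbT; apply: contraNneq rp => <-; rewrite expr0n gtn_eqF.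
have p0' : 0 < p%:R :> R by rewrite ltr0n.
have tz : 0 < t.
  by rewrite lt_neqAle t0 andbT; apply: contraNneq st => <-; rewrite mulr0 sin0.
have tlt : t < pi / p%:R.
  rewrite lt_neqAle tp andbT; apply: contraNneq st => ->.
  by rewrite mulrC divfK ?sinpi// gt_eqF.
apply: lune_interior_wall => //.
  by rewrite h.2 mulr_gt0// sin_gt0_pi// tz (lt_le_trans tlt).
by rewrite (wall_polar h) mulr_gt0// sin_gt0_pi//; apply/andP; split; have := pip1; lra.
Qed.

Lemma lune_boundary_zim x : sphere_boundary (lune R n p) x -> ev (zim ix iy p) x = 0.
Proof.
by move=> [Dx nint]; apply/eqP/negPn/negP => /(lune_zim_interior Dx).
Qed.

Lemma closed_lune : closed (lune R n p).
Proof.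
have -> : lune R n p = ev r2 @^-1` [set t | t = 1] `&`
   ((fun x : point => x 0 iy) @^-1` [set t | 0 <= t] `&` wall @^-1` [set t | 0 <= t]).
  apply/seteqP; split => x; first by move/lune_wall => [].
  by move=> [a [b c]]; apply/lune_wall.
have cw := continuous_wall.
apply: closedI; last apply: closedI.
- by apply: closed_comp; [move=> z _; exact: continuous_ev|exact: closed_eq].
- by apply: closed_comp; [move=> z _; exact: coord_continuous|exact: closed_ge].
- by apply: closed_comp; [move=> z _; exact: cw|exact: closed_ge].
Qed.

Lemma compact_lune : compact (lune R n p).
Proof.
apply: (@compact_closed_r2 _ _ _ 1); first exact: closed_lune.
by move=> x /lune_wall [x1 _ _] /=; rewrite x1.
Qed.

End Lune.

(** * Uniform approximation on the lune *)

Section Density.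
Context {R : realType} (n p : nat) (n1 : (1 < n)%N) (p0 : (0 < p)%N).
Local Notation point := 'rV[R]_n.+1.
Implicit Types (x y : point).
Local Notation ix := (ix n).
Local Notation iy := (iy n).
Local Notation aharm := (@aharm R n ix iy p).
Local Notation sums_of_aharm := (@sums_of_aharm R n ix iy p).

Let xy : ix != iy := ix_iy n1.

Lemma wpoly_mcoeff q (m : multinom n.+1) : wpoly (R := R) ix iy q ->
  mcoeff m q != 0 -> m ix = 0%N /\ m iy = 0%N.
Proof.
have aux i : mderiv i q = 0 -> mcoeff m q != 0 -> m i = 0%N.
  move=> di; apply: contra_neqP => /eqP; rewrite -lt0n => mi.
  have mU : m = mnm_add (mnm_sub m (mnm1 i)) (mnm1 i).
    apply/esym/submK; apply/mnm_lepP => j; rewrite mnmE; case: eqP => [<-|//].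
    by rewrite lt0n -lt0n.
  have := congr1 (mcoeff (mnm_sub m (mnm1 i))) di.
  rewrite mcoeff_mderiv -mU mcoeff0 => /eqP.
  by rewrite mulrn_eq0 /= => /eqP.
by move=> [dx dy] mq; split; apply: aux.
Qed.

Lemma ev_wpoly q x y : wpoly ix iy q ->
  (forall l, l != ix -> l != iy -> x 0 l = y 0 l) -> ev q x = ev q y.
Proof.
move=> wq xyE; rewrite /ev !mevalE big_seq_cond [RHS]big_seq_cond.
apply: eq_bigr => m; rewrite andbT => mq.
have [mx my] : m ix = 0%N /\ m iy = 0%N.
  by apply: (wpoly_mcoeff wq); rewrite mcoeff_eq0 negbK.
congr (_ * _); apply: eq_bigr => l _.
have [->|lx] := eqVneq l ix; first by rewrite mx.
have [->|ly] := eqVneq l iy; first by rewrite my.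
by rewrite xyE.
Qed.

(** Folding the angle of z into [0, pi / p] preserves w and |z| and multiplies all
    the Im z^(j p) by one sign. *)
Lemma aharm_fold x : ev r2 x = 1 -> exists y s, [/\ lune R n p y, s ^+ 2 = 1 &
  forall k P, aharm k P -> ev P x = s * ev P y].
Proof.
move=> x1; have [r [t [r0 t0 a b]]] := polar (x 0 ix) (x 0 iy).
have [t' [s [tp s1 st]]] := fold_angle p0 t0.
pose y : point := \row_l if l == ix then r * cos t' else
                         if l == iy then r * sin t' else x 0 l.
have yw l : l != ix -> l != iy -> x 0 l = y 0 l.
  by move=> /negbTE lx /negbTE ly; rewrite mxE lx ly.
have px : polar_at x r t by [].
have py : polar_at y r t'.
  by split; rewrite mxE eqxx// eq_sym (negbTE xy).
have y1 : ev r2 y = 1.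
  have := ev_zsq xy x; rewrite (zsq_polar px) x1.
  have := ev_zsq xy y; rewrite (zsq_polar py).
  have -> : \sum_(l | (l != ix) && (l != iy)) y 0 l ^+ 2 =
            \sum_(l | (l != ix) && (l != iy)) x 0 l ^+ 2.
    by apply: eq_bigr => l /andP[lx ly]; rewrite yw.
  move=> -> /eqP; rewrite subr_eq subrK => /eqP ->//.
exists y, s; split => //; first by apply/(lune_polar p n1 y); split => //; exists r, t'.
move=> k P; elim=> [|m j q {}P j0 mk wq hq _ IH]; first by rewrite !ev0 mulr0.
rewrite !evD IH mulrDr; congr (_ + _).
rewrite !ev_hext (zsq_polar px) (zsq_polar py).
rewrite (zre_zim_polar _ px).2 (zre_zim_polar _ py).2 st.
under eq_bigr do rewrite (ev_wpoly (wpoly_iter_lap _ wq) yw).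
by ring.
Qed.

(** On the sphere w determines |z|, and cos is injective on [0, pi], so that Re z^p
    determines the angle of z. *)
Lemma invariant_separates x y : lune R n p x -> lune R n p y -> x <> y ->
  exists2 f, invariant_algebra ix iy p f & f x <> f y.
Proof.
move=> Dx Dy nxy; apply: contrapT => nsep; apply: nxy.
have eqf f : invariant_algebra ix iy p f -> f x = f y.
  by move=> af; apply: contrapT => ne; apply: nsep; exists f.
have w l : l != ix -> l != iy -> x 0 l = y 0 l.
  by move=> lx ly; apply: (eqf (fun x : point => x 0 l)); exact: ia_var.
have [x1 [r [t [r0 /andP[t0 tp] px]]]] := (lune_polar p n1 x).1 Dx.
have [y1 [r' [t' [r'0 /andP[t'0 t'p] py]]]] := (lune_polar p n1 y).1 Dy.
have rr : r = r'.
  apply/eqP; rewrite -(@eqrXn2 _ 2)//; apply/eqP.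
  rewrite -(zsq_polar px) -(zsq_polar py) !(ev_zsq xy) x1 y1; congr (_ - _).
  by apply: eq_bigr => l /andP[lx ly]; rewrite w.
have [ex ey] : x 0 ix = y 0 ix /\ x 0 iy = y 0 iy.
  rewrite px.1 px.2 py.1 py.2 -rr; have [->|rz] := eqVneq r 0; first by rewrite !mul0r.
  have := eqf _ (ia_zre ix iy p).
  rewrite (zre_zim_polar p px).1 (zre_zim_polar p py).1 -rr => /(mulfI (expf_neq0 p rz)).
  have p0' : 0 < p%:R :> R by rewrite ltr0n.
  have rng (a : R) : 0 <= a -> a <= pi / p%:R -> p%:R * a \in `[0, pi].
    move=> a0 ap; rewrite in_itv /=; apply/andP; split; first by rewrite mulr_ge0.
    by rewrite mulrC -ler_pdivlMr.
  move=> /cos_inj e; have -> : t = t'.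
    by apply: (mulfI (lt0r_neq0 p0')); apply: e; exact: rng.
  by [].
apply/matrixP => i l; rewrite (ord1 i).
have [->//|lx] := eqVneq l ix; have [->//|ly] := eqVneq l iy.
exact: w.
Qed.

Lemma zim_le1 x : ev r2 x = 1 -> `|ev (zim ix iy p) x| <= 1.
Proof.
move=> x1; rewrite -(@expr_le1 _ 2)// real_normK ?num_real//.
have z01 : 0 <= ev (zsq ix iy) x <= 1.
  apply/andP; split; first by rewrite /zsq evD !evXn addr_ge0// sqr_ge0.
  by rewrite (ev_zsq xy) x1 gerBl; apply: sumr_ge0 => l _; exact: sqr_ge0.
have e : ev (zsq ix iy) x ^+ p = ev (zre ix iy p) x ^+ 2 + ev (zim ix iy p) x ^+ 2.
  by rewrite -!evXn zsqXn evD.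
move: z01 => /andP[z0 z1].
apply: (@le_trans _ _ (ev (zsq ix iy) x ^+ p)); last exact: exprn_ile1.
by rewrite e lerDr sqr_ge0.
Qed.

(** Since u vanishes on the boundary, truncating its small values by h gives a
    function that vanishes near the boundary and is within e / 2 of u. Its quotient by
    Im z^p is continuous on the lune, so the invariant algebra approximates it,
    and multiplying back by Im z^p leads to the module of the harmonics. *)
Theorem aharm_dense (u : point -> R) : cont_on (lune R n p) u ->
  (forall x, lune R n p x -> ev (zim ix iy p) x = 0 -> u x = 0) ->
  forall e, 0 < e -> exists2 f, sums_of_aharm f &
    forall x, lune R n p x -> `|u x - f x| <= e.
Proof.
move=> cu u0 e e0; have e2 : 0 < e / 2 by rewrite divr_gt0.
set d := e / 2 in e2.
pose h (t : R) := Num.max (t - d) 0 + Num.min (t + d) 0.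
have hd t : `|t - h t| <= d.
  rewrite /h ler_norml; case: (leP (t - d) 0) => ?; case: (leP (t + d) 0) => ?;
  by apply/andP; split; lra.
have h0 t : `|t| < d -> h t = 0.
  rewrite /h ltr_norml => /andP[? ?].
  by case: (leP (t - d) 0) => ?; case: (leP (t + d) 0) => ?; lra.
have hlip a b : `|h a - h b| <= `|a - b| *+ 2.
  have : h a - h b <= `|a - b| *+ 2 /\ h b - h a <= `|a - b| *+ 2; last first.
    by move=> [h1 h2]; rewrite ler_norml; apply/andP; split; lra.
  have := ler_norm (a - b); have := ler_norm (b - a); rewrite (distrC b) mulr2n /h.
  move: `|a - b| => c c1 c2.
  case: (leP (a - d) 0) => ?; case: (leP (a + d) 0) => ?;
  case: (leP (b - d) 0) => ?; case: (leP (b + d) 0) => ?; split; lra.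
pose S := ev (zim (R := R) ix iy p).
pose v x := h (u x) / S x.
have chu y : lune R n p y -> forall a, 0 < a ->
    \forall z \near y, lune R n p z -> `|h (u z) - h (u y)| < a.
  move=> Dy a a0; have a2 : 0 < a / 2 by rewrite divr_gt0.
  apply: filterS (cu y Dy _ a2) => z hz /hz {}hz.
  by apply: le_lt_trans (hlip _ _) _; rewrite mulr2n; lra.
have cv : cont_on (lune R n p) v.
  apply: cont_on_cvg => y Dy.
  have [Sy|Sy] := eqVneq (S y) 0.
    have uy : u y = 0 by exact: u0.
    apply/cvgrPdist_lt => a a0; rewrite near_withinE.
    apply: filterS (cu y Dy _ e2) => z hz Dz; have := hz Dz; rewrite uy subr0 => uz.
    by rewrite /v uy !h0 ?normr0// !mul0r subrr normr0.
  apply: cvgM; last first.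
    apply: cvgV => //; apply: cvg_within_filter; exact: continuous_ev.
  apply/cvgrPdist_lt => a a0; rewrite near_withinE.
  by apply: filterS (chu y Dy a a0) => z hz /hz; rewrite distrC.
have cA f : invariant_algebra ix iy p f -> cont_on (lune R n p) f.
  by move=> af; apply/cont_onP/continuous_subspaceT; exact: (continuous_ia af).
have [g ag gv] := stone_weierstrass (compact_lune n1 p0) cA (ia_cst ix iy p)
  (@ia_D _ _ ix iy p) (@ia_M _ _ ix iy p) invariant_separates cv e2.
exists (fun x => g x * S x).
  apply: (zim_module_sums xy n1); apply: ia_zm => //.
  by have := @zm_zim R n ix iy p 1 isT; rewrite mul1n.
move=> x Dx; have [x1 _ _] := (lune_wall n1 p0 x).1 Dx.
have -> : u x - g x * S x = (u x - h (u x)) + (v x - g x) * S x.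
  rewrite mulrBl; have [Sx|Sx] := eqVneq (S x) 0.
    by rewrite (u0 _ Dx Sx) h0 ?normr0// Sx !mulr0; ring.
  by rewrite /v divfK//; ring.
rewrite (le_trans (ler_normD _ _))// [e]splitr lerD// normrM.
apply: (@le_trans _ _ (`|v x - g x| * 1)); first by rewrite ler_wpM2l// zim_le1.
by rewrite mulr1 ltW// gv.
Qed.

End Density.

(** * Continuously differentiable functions *)

Section SmoothFunctions.
Context {R : realType} {n : nat}.
Local Notation point := 'rV[R]_n.+1.
Local Notation e_ i := (delta_mx 0 i : point).
Implicit Types (x y v : point) (f g : point -> R) (i : 'I_n.+1).

Lemma mean_value_bound (g g' : R -> R) (c e t : R) : 0 <= e ->
  (forall s, `|s| <= `|t| -> is_derive (s : R) (1 : R) g (g' s)) ->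
  (forall s, `|s| <= `|t| -> `|g' s - c| <= e) ->
  `|g t - g 0 - t * c| <= e * `|t|.
Proof.
move=> e0 dg hc.
have bd a b : a < b -> (forall s, a <= s <= b -> `|s| <= `|t|) ->
    `|g b - g a - (b - a) * c| <= e * (b - a).
  move=> ab st.
  have [||s] := @MVT R g g' a b ab.
  - by move=> s; rewrite in_itv /= => /andP[? ?]; apply/dg/st; rewrite !ltW.
  - apply: continuous_in_subspaceT => s; rewrite inE /= in_itv /= => sab.
    have [ds _] := dg s (st s sab).
    by apply/differentiable_continuous/derivable1_diffP.
  rewrite in_itv /= => /andP[sa sb] ->.
  rewrite [g' s * _]mulrC -mulrBr normrM gtr0_norm ?subr_gt0// mulrC.
  by rewrite ler_wpM2r ?subr_ge0 ?(ltW ab)//; apply/hc/st; rewrite !ltW.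
have [t0|t0|->] := ltgtP t 0; last by rewrite subrr mul0r subr0 normr0 mulr0.
  have := bd t 0 t0; rewrite ltr0_norm// sub0r mulNr opprK => h.
  have -> : g t - g 0 - t * c = - (g 0 - g t + t * c) by ring.
  rewrite normrN; apply: h => s /andP[ts s0].
  by rewrite ler0_norm// lerN2.
have := bd 0 t t0; rewrite subr0 [`|t|]gtr0_norm// => -> // s /andP[s0 st].
by rewrite ger0_norm.
Qed.

Lemma e_line i x (s : R) l : (x + s *: e_ i) 0 l = x 0 l + (if l == i then s else 0).
Proof. by rewrite !mxE eqxx /=; case: eqP => _; rewrite ?mulr1 ?mulr0. Qed.

Lemma in_ballP x y (r : R) : 0 < r ->
  (forall l, `|x 0 l - y 0 l| < r) -> ball x r y.
Proof. by move=> r0 h; split=> // i j; rewrite (ord1 i); exact: h. Qed.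

(** Continuous partial derivatives give all directional derivatives: the increment
    along v is split coordinate by coordinate. *)
Lemma is_derive_C1 f x v :
  (\forall y \near x, forall i, derivable f y (e_ i)) ->
  (forall i, {for x, continuous (partial i f)}) ->
  is_derive x v f (\sum_i v 0 i * partial i f x).
Proof.
move=> df cf.
set L := \sum_i _.
suff main : (fun h : R => h^-1 *: ((f \o shift x) (h *: v) - f x)) @ 0^' --> L.
  by split; [apply/cvg_ex; exists L|exact: cvg_lim main].
apply/cvgrPdist_lt => e e0.
pose B := \sum_i `|v 0 i| + 1.
have B0 : 0 < B by rewrite ltr_wpDl// sumr_ge0.
pose d := e / (2 * B); have d0 : 0 < d by rewrite divr_gt0// mulr_gt0.
have : \forall y \near x, forall i, derivable f y (e_ i) /\
    `|partial i f y - partial i f x| < d.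
  have h i : \forall y \near x, derivable f y (e_ i) /\ `|partial i f y - partial i f x| < d.
    have c1 : \forall y \near x, `|partial i f x - partial i f y| < d.
      by have /cvgrPdist_lt := cf i; apply.
    by apply: filterS2 df c1 => y dy; rewrite distrC => h; split => //; exact: dy.
  exact: (filter_forall (nbhs_filter x) h).
move=> /nbhs_ballP [r /= r0 Hr].
rewrite near_withinE; apply/nbhs_ballP; exists (r / B); first by rewrite /= divr_gt0.
move=> s; rewrite /ball /= sub0r normrN ltr_pdivlMr// => sr s0.
have vB l : `|v 0 l| <= B.
  rewrite /B (bigD1 l)//= -addrA lerDl addr_ge0// sumr_ge0//.
pose z (k : nat) : point := \row_l (if (l < k)%N then x 0 l + s * v 0 l else x 0 l).
have z0 : z 0%N = x by apply/matrixP => i l; rewrite mxE (ord1 i).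
have zn : z n.+1 = s *: v + x.
  by apply/matrixP => i l; rewrite !mxE (ord1 i) ltn_ord addrC.
have zS (k : 'I_n.+1) : z k.+1 = z k + (s * v 0 k) *: e_ k.
  apply/matrixP => i l; rewrite (ord1 i) e_line !mxE ltnS leq_eqVlt -(inj_eq val_inj).
  by case: eqP => /= [/val_inj ->|_]; rewrite ?ltnn ?addr0.
have step (k : 'I_n.+1) :
    `|f (z k.+1) - f (z k) - s * v 0 k * partial k f x| <= d * `|s * v 0 k|.
  rewrite zS.
  have zb (t : R) : `|t| <= `|s * v 0 k| -> ball x r (z k + t *: e_ k).
    move=> ts; apply: in_ballP => // l; rewrite e_line mxE.
    have svr l' : `|s * v 0 l'| < r.
      by apply: le_lt_trans sr; rewrite normrM ler_wpM2l.
    have [->|_] := eqVneq l k.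
      rewrite ltnn opprD addrA subrr sub0r normrN; exact: le_lt_trans ts (svr k).
    rewrite addr0; case: ifP => _; last by rewrite subrr normr0.
    by rewrite opprD addrA subrr sub0r normrN.
  have := @mean_value_bound (fun t : R => f (z k + t *: e_ k))
    (fun t => partial k f (z k + t *: e_ k)) (partial k f x) d (s * v 0 k) (ltW d0).
  rewrite scale0r addr0; apply.
    move=> t tb; have [dk _] := Hr _ (zb t tb) k.
    exact: ((is_derive_line f (z k) (e_ k) t _).1 (DeriveDef dk erefl)).
  by move=> t /zb /Hr /(_ k) [_ /ltW].
have tele : f (s *: v + x) - f x - s * L =
    \sum_(k < n.+1) (f (z k.+1) - f (z k) - s * v 0 k * partial k f x).
  rewrite sumrB -(big_mkord xpredT (fun k => f (z k.+1) - f (z k))) telescope_sumr//.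
  rewrite zn z0; congr (_ - _); rewrite /L mulr_sumr.
  by apply: eq_bigr => k _; rewrite mulrA.
have bound : `|f (s *: v + x) - f x - s * L| <= d * `|s| * B.
  rewrite tele (le_trans (ler_norm_sum _ _ _))//.
  apply: (@le_trans _ _ (\sum_(k < n.+1) d * `|s * v 0 k|)).
    by apply: ler_sum => k _; exact: step.
  have -> : \sum_(k < n.+1) d * `|s * v 0 k| = d * `|s| * \sum_i `|v 0 i|.
    by rewrite mulr_sumr; apply: eq_bigr => k _; rewrite normrM mulrA.
  apply: ler_wpM2l; first by rewrite mulr_ge0// ltW.
  by rewrite /B lerDl.
have -> : L - s^-1 *: (f (s *: v + x) - f x) = - s^-1 * (f (s *: v + x) - f x - s * L).
  by rewrite mulrBr !mulNr mulKf// opprK addrC.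
rewrite normrM normrN normfV.
have s0' : 0 < `|s| by rewrite normr_gt0.
apply: (@le_lt_trans _ _ (d * B)).
  by rewrite mulrC ler_pdivrMr// mulrAC.
have -> : d * B = e / 2 by rewrite /d; field; rewrite gt_eqF.
by rewrite ltr_pdivrMr// ltr_pMr// ltr1n.
Qed.

(** The sum is the derivative of f along the ray through x. *)
Lemma euler_of_homog0 f x :
  (\forall y \near x, forall i, derivable f y (e_ i)) ->
  (forall i, {for x, continuous (partial i f)}) ->
  (forall t, 0 < t -> f (t *: x) = f x) ->
  \sum_i x 0 i * partial i f x = 0.
Proof.
move=> df cf f0.
have /is_derive_line0 h := is_derive_C1 x df cf.
have : is_derive (0 : R) (1 : R) (fun s : R => f (x + s *: x)) 0.
  apply: near_eq_is_derive (is_derive_cst (f x) (0 : R) (1 : R)).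
  have : \forall s \near (0 : R), - 1 < s.
    by apply: lt_nbhsr; rewrite oppr_lt0.
  apply: filterS => s s1; have -> : x + s *: x = (1 + s) *: x by rewrite scalerDl scale1r.
  by rewrite f0//; lra.
by move=> [_ h2]; case: h => _; rewrite h2.
Qed.

Lemma is_derive_homog f x i (t c : R) : 0 < t ->
  (\forall y \near x, f (t *: y) = c * f y) -> derivable f x (e_ i) ->
  is_derive (t *: x) (e_ i) f (c * t^-1 * partial i f x).
Proof.
move=> t0 fc df; apply/is_derive_line0.
have h1 : is_derive (0 : R) (1 : R)
    (c \*: ((fun s : R => f (x + s *: e_ i)) \o (t^-1 \*: id))) (c * (t^-1 * partial i f x)).
  apply: is_deriveZ; rewrite mulrC; apply: is_derive1_comp.
    have -> : (t^-1 \*: id) 0 = 0 :> R by rewrite /= scaler0.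
    exact: ((is_derive_line0 f x (e_ i) _).1 (DeriveDef df erefl)).
  apply: is_derive_eq (is_deriveZ t^-1 (is_derive_id (0 : R) (1 : R))) _.
  exact: mulr1.
rewrite -mulrA; apply: near_eq_is_derive h1.
apply: filterS (near_line (t^-1 *: e_ i) fc) => s; rewrite scalerA [s * _]mulrC => h.
have -> : t *: x + s *: e_ i = t *: (x + (t^-1 * s) *: e_ i).
  by rewrite scalerDr scalerA mulVKf ?gt_eqF.
by rewrite h.
Qed.

End SmoothFunctions.

(** * Radial functions and the Laplace-Beltrami operator *)

Section Radial.
Context {R : realType} {n : nat}.
Local Notation point := 'rV[R]_n.+1.
Local Notation e_ i := (delta_mx 0 i : point).
Implicit Types (x y v : point) (f g : point -> R) (i : 'I_n.+1).

(** This is |x|^(2 b). *)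
Definition radial (b : R) x : R := ev r2 x `^ b.

Lemma radial_gt0 b x : 0 < ev r2 x -> 0 < radial b x.
Proof. exact: powR_gt0. Qed.

Lemma radialD b c x : 0 < ev r2 x -> radial (b + c) x = radial b x * radial c x.
Proof. by move=> x0; rewrite /radial powRD// (gt_eqF x0) implybT. Qed.

Lemma radial1 x : radial 1 x = ev r2 x.
Proof. by rewrite /radial powRr1// ev_r2_ge0. Qed.

Lemma radialS b x : 0 < ev r2 x -> radial b x = radial (b - 1) x * ev r2 x.
Proof. by move=> x0; rewrite -radial1 -radialD// subrK. Qed.

Lemma is_derive_radial b x i : 0 < ev r2 x ->
  is_derive x (e_ i) (radial b) (2 * b * x 0 i * radial (b - 1) x).
Proof.
move=> x0.
have := is_derive_compR (is_derive1_powR b x0) (is_derive_ev r2 x i).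
congr (is_derive _ _ _ _).
by rewrite mderiv_r2 evZ ev_var /radial; ring.
Qed.

Lemma r2_gt0_near x : 0 < ev r2 x -> \forall y \near x, 0 < ev r2 y.
Proof.
move=> x0; apply: open_nbhs_nbhs; split => //.
apply: (@open_comp _ _ (ev r2) [set t | 0 < t]); last exact: open_gt.
by move=> z _; exact: continuous_ev.
Qed.

Lemma continuous_radial b x : 0 < ev r2 x -> {for x, continuous (radial b)}.
Proof.
move=> x0; apply: (@continuous_comp _ _ _ (ev r2) (fun t => t `^ b)).
  exact: continuous_ev.
have [d _] := is_derive1_powR b x0.
by apply/differentiable_continuous/derivable1_diffP.
Qed.

Lemma radial_mul_derive b g x i : 0 < ev r2 x -> derivable g x (e_ i) ->
  is_derive x (e_ i) (radial b * g)
    (2 * b * x 0 i * radial (b - 1) x * g x + radial b x * partial i g x).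
Proof.
move=> x0 dg.
have := is_deriveM (is_derive_radial b i x0) (DeriveDef dg erefl).
by congr (is_derive _ _ _ _); rewrite /GRing.scale /= /partial; ring.
Qed.

Lemma radial_mul_derive2 b g x i : 0 < ev r2 x -> twice_derivable_at g x ->
  is_derive x (e_ i) (partial i (radial b * g))
    (2 * b * radial (b - 1) x * g x
     + 4 * b * (b - 1) * x 0 i ^+ 2 * radial (b - 2) x * g x
     + 4 * b * radial (b - 1) x * (x 0 i * partial i g x)
     + radial b x * partial i (partial i g) x).
Proof.
move=> x0 /(_ i) [d1 d2].
have dgx : derivable g x (e_ i) := nbhs_singleton d1.
pose F := (2 * b) \*: (ev (var i) * (radial (b - 1) * g)) + radial b * partial i g.
have FE : \forall y \near x, F y = partial i (radial b * g) y.
  apply: filterS2 (r2_gt0_near x0) d1 => y y0 dy.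
  rewrite /partial; have [_ ->] := radial_mul_derive b y0 dy.
  have -> : F y = 2 * b * (ev (var i) y * (radial (b - 1) y * g y)) + radial b y * partial i g y by [].
  by rewrite ev_var /partial; ring.
have dF := is_deriveD (is_deriveZ (2 * b)
   (is_deriveM (is_derive_ev (var i) x i) (radial_mul_derive (b - 1) x0 dgx)))
   (is_deriveM (is_derive_radial b i x0) (DeriveDef d2 erefl)).
have := near_eq_is_derive FE dF; congr (is_derive _ _ _ _).
have -> : b - 2 = b - 1 - 1 by ring.
rewrite /GRing.scale /= ev_var mderiv_var eqxx ev1 /partial.
have -> : (radial (b - 1) * g) x = radial (b - 1) x * g x by [].
by ring.
Qed.

Lemma radial_mul_twice b g x : 0 < ev r2 x -> twice_derivable_at g x ->
  twice_derivable_at (radial b * g) x.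
Proof.
move=> x0 tg i; split; last by have [] := radial_mul_derive2 b i x0 tg.
apply: filterS2 (r2_gt0_near x0) (tg i).1 => y y0 dy.
by have [] := radial_mul_derive b y0 dy.
Qed.

(** The hypothesis on c is Euler's identity for a function that is homogeneous of
    degree c near x. *)
Lemma laplacian_radial_mul b c g x : 0 < ev r2 x -> twice_derivable_at g x ->
  \sum_i x 0 i * partial i g x = c * g x ->
  laplacian_at (radial b * g) x = radial b x * laplacian_at g x
    + (2 * b * n.+1%:R + 4 * b * (b - 1) + 4 * b * c) * radial (b - 1) x * g x.
Proof.
move=> x0 tg eg; rewrite /laplacian_at.
pose r1 := radial (b - 1) x; pose r2' := radial (b - 2) x; pose r0 := radial b x.
transitivity (\sum_i (2 * b * r1 * g x + 4 * b * (b - 1) * r2' * g x * x 0 i ^+ 2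
     + 4 * b * r1 * (x 0 i * partial i g x) + r0 * partial i (partial i g) x)).
  apply: eq_bigr => i _; have [_ h] := radial_mul_derive2 b i x0 tg.
  by rewrite {1}/partial h /r1 /r2' /r0; ring.
rewrite !big_split /= sumr_const card_ord -!mulr_sumr -ev_r2 eg.
have e : r1 = r2' * ev r2 x.
  by rewrite /r1 radialS//; congr (radial _ _ * _); ring.
rewrite -/r0 -/r1 -mulr_natl e; move: (\sum_(i < _) _) => S.
by ring.
Qed.

End Radial.

Section Cones.
Context {R : realType} {n : nat}.
Local Notation point := 'rV[R]_n.+1.
Implicit Types (x y v : point) (f g : point -> R) (i : 'I_n.+1) (D : set point).

Lemma enorm_gt0 x : (0 < enorm x) = (0 < ev r2 x).
Proof. by rewrite enormE sqrtr_gt0. Qed.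

Lemma enorm_radial x : enorm x = radial 2^-1 x.
Proof. by rewrite enormE /radial powR12_sqrt// ev_r2_ge0. Qed.

Lemma r2_normalize x : 0 < ev r2 x -> ev r2 (normalize x) = 1.
Proof.
move=> x0; rewrite /normalize ev_r2Z exprVn enormE sqr_sqrtr ?ltW//.
by rewrite mulVf ?gt_eqF.
Qed.

Lemma normalize_id x : ev r2 x = 1 -> normalize x = x.
Proof. by move=> x1; rewrite /normalize enormE x1 sqrtr1 invr1 scale1r. Qed.

Lemma normalizeZ (t : R) x : 0 < t -> normalize (t *: x) = normalize x.
Proof.
move=> t0; rewrite /normalize enormE ev_r2Z sqrtrM ?sqr_ge0// sqrtr_sqr gtr0_norm//.
rewrite -enormE scalerA; have [->|x0] := eqVneq (enorm x) 0.
  by rewrite mulr0 invr0 mul0r.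
by congr (_ *: _); rewrite invfM mulrAC mulVf ?mul1r// gt_eqF.
Qed.

Lemma normalize_gt0 D x : sphere_interior D (normalize x) -> 0 < ev r2 x.
Proof.
move=> [/sphereE + _]; rewrite /normalize ev_r2Z => h.
rewrite lt_neqAle ev_r2_ge0 andbT; apply/eqP => e.
by move: h; rewrite -e mulr0 => /esym/eqP; rewrite oner_eq0.
Qed.

Lemma continuous_normalize x : 0 < ev r2 x -> {for x, continuous (@normalize R n.+1)}.
Proof.
move=> x0; have -> : @normalize R n.+1 = (fun y => radial (- 2^-1) y *: y).
  by apply/funext => y; rewrite /normalize enorm_radial /radial powRN.
have h1 := continuous_radial (b := - 2^-1) x0.
have h2 : {for x, continuous (@id point)} by [].
exact: (cvgZ h1 h2).
Qed.

Lemma sphere_interior_near D x : sphere_interior D x ->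
  \forall y \near x, sphere R n y -> sphere_interior D y.
Proof.
move=> [_ /nbhs_interior]; apply: filterS => y yD ys; split => //.
Qed.

Lemma cone_near D x : sphere_interior D (normalize x) ->
  \forall y \near x, sphere_interior D (normalize y).
Proof.
move=> xD; have x0 := normalize_gt0 xD.
have := continuous_normalize x0 (sphere_interior_near xD).
move=> h; apply: filterS2 (r2_gt0_near x0) h => y y0; apply.
by apply/sphereE; exact: r2_normalize.
Qed.

Lemma cone_interior D x : sphere_interior D x -> sphere_interior D (normalize x).
Proof.
move=> Dx; have [/sphereE x1 _] := Dx.
by rewrite normalize_id.
Qed.

Lemma ray_extZ T (u : point -> T) (t : R) x : 0 < t -> ray_ext u (t *: x) = ray_ext u x.
Proof. by move=> t0; rewrite /ray_ext /= normalizeZ. Qed.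

Context (D : set point) (u : point -> R).
Hypothesis C2u : sphere_C2_on (sphere_interior D) u.
Let f := ray_ext u.

Lemma twice_derivable_ray x : sphere_interior D (normalize x) -> twice_derivable_at f x.
Proof.
move=> Dx i; split.
  by apply: filterS (cone_near Dx) => y Dy; have [] := C2u Dy i.
by have [_ _ /(_ i) []] := C2u Dx i.
Qed.

Lemma euler_ray x : sphere_interior D (normalize x) -> \sum_i x 0 i * partial i f x = 0.
Proof.
move=> Dx; apply: euler_of_homog0.
- by apply: filterS (cone_near Dx) => y Dy i; have [] := C2u Dy i.
- by move=> i; have [] := C2u Dx i.
- by move=> t t0; exact: ray_extZ.
Qed.

Lemma partial_rayZ x (t : R) i : sphere_interior D (normalize x) -> 0 < t ->
  partial i f (t *: x) = t^-1 * partial i f x.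
Proof.
move=> Dx t0; have [dx _ _] := C2u Dx i.
have h : \forall y \near x, f (t *: y) = 1 * f y.
  by apply: filterE => y; rewrite mul1r /f ray_extZ.
by have [_] := is_derive_homog t0 h dx; rewrite mul1r.
Qed.

Lemma partial2_rayZ x (t : R) i : sphere_interior D (normalize x) -> 0 < t ->
  partial i (partial i f) (t *: x) = t^-1 * t^-1 * partial i (partial i f) x.
Proof.
move=> Dx t0; have [_ _ /(_ i) [dx _]] := C2u Dx i.
have h : \forall y \near x, partial i f (t *: y) = t^-1 * partial i f y.
  by apply: filterS (cone_near Dx) => y Dy; exact: partial_rayZ.
by have [_] := is_derive_homog t0 h dx.
Qed.

Lemma laplacian_rayZ x (t : R) : sphere_interior D (normalize x) -> 0 < t ->
  laplacian_at f (t *: x) = t^-1 * t^-1 * laplacian_at f x.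
Proof.
move=> Dx t0; rewrite /laplacian_at mulr_sumr; apply: eq_bigr => i _.
exact: partial2_rayZ.
Qed.

(** The partial derivatives of f are homogeneous of degree - 1, so the gradient on
    the sphere, extended constantly along rays, is |x| times the gradient of f. Its
    divergence exceeds the Laplacian of f by the radial derivative of f, which is
    zero. *)
Lemma laplace_beltramiE x : sphere_interior D x -> laplace_beltrami u x = laplacian_at f x.
Proof.
move=> Dx; have Dnx := cone_interior Dx; have [/sphereE x1 _] := Dx.
have x0 : 0 < ev r2 x by rewrite x1.
suff h i : partial i (fun y => ray_ext (sphere_grad u) y 0 i) x =
    x 0 i * partial i f x + partial i (partial i f) x.
  rewrite /laplace_beltrami /sphere_div (eq_bigr _ (fun i _ => h i)) big_split /=.
  by rewrite euler_ray// add0r.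
have [_ tdi] := twice_derivable_ray Dnx i.
have E : \forall y \near x, (radial 2^-1 * partial i f) y = ray_ext (sphere_grad u) y 0 i.
  apply: filterS (cone_near Dnx) => y Dy; have y0 := normalize_gt0 Dy.
  have Ny : 0 < enorm y by rewrite enorm_gt0.
  rewrite /ray_ext /= /sphere_grad mxE -/f /normalize partial_rayZ ?invr_gt0//.
  by rewrite invrK enorm_radial.
have [_] := near_eq_is_derive E (radial_mul_derive 2^-1 x0 tdi).
rewrite /partial => ->.
by rewrite /radial x1 !powR1 divff// !mul1r mulr1.
Qed.

End Cones.

(** * Absence of nonpositive eigenvalues *)

Section NonpositiveEigenvalues.
Context {R : realType} (n p : nat) (n1 : (1 < n)%N) (p0 : (0 < p)%N).
Local Notation point := 'rV[R]_n.+1.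
Local Notation ix := (ix n).
Local Notation iy := (iy n).
Local Notation D := (lune R n p).
Implicit Types (x y : point) (f g : point -> R).

Lemma interior_sub (E : set point) x : sphere_interior E x -> E x.
Proof. by move=> [xs /nbhs_singleton]; apply. Qed.

(** A half-space bounding the lune contains its interior points strictly: moving
    across the bounding hyperplane leaves the lune. *)
Lemma interior_half_space (L : point -> R) (v x : point) :
  (forall (t : R) y, L (t *: y) = t * L y) -> (forall s : R, L (x + s *: v) = L x - s) ->
  (forall y, D y -> 0 <= L y) -> sphere_interior D x -> 0 < L x.
Proof.
move=> LZ Lv L0 Dx; rewrite lt_neqAle L0 ?andbT; last exact: interior_sub.
apply/eqP => Lx.
have := near_line v (cone_near (cone_interior Dx)).
move=> /nbhs_ballP [d /= d0 /(_ (d / 2))].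
have d2 : 0 < d / 2 by rewrite divr_gt0.
rewrite /ball /= sub0r normrN gtr0_norm// => h.
have /h Dn : d / 2 < d by lra.
have z0 := normalize_gt0 Dn; have := L0 _ (interior_sub Dn).
rewrite /normalize LZ Lv -Lx pmulr_rge0 ?invr_gt0 ?enorm_gt0//.
by lra.
Qed.

Lemma lune_interior_gt0 x : sphere_interior D x -> 0 < x 0 iy.
Proof.
apply: (@interior_half_space (fun y => y 0 iy) (- delta_mx 0 iy)).
- by move=> t y; rewrite mxE.
- by move=> s; rewrite scalerN -scaleNr e_line eqxx.
- by move=> y /(lune_wall n1 p0) [].
Qed.

Lemma wallZ (t : R) x : wall p (t *: x) = t * wall p x.
Proof. by rewrite /wall !mxE; ring. Qed.

Lemma lune_interior_wall_gt0 x : sphere_interior D x -> 0 < wall p x.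
Proof.
pose c := cos (pi / p%:R : R); pose s := sin (pi / p%:R : R).
apply: (@interior_half_space (wall p) (c *: delta_mx 0 iy - s *: delta_mx 0 ix)).
- exact: wallZ.
- move=> t; rewrite /wall !mxE !eqxx /= [iy == ix]eq_sym (negbTE (ix_iy n1)) /= -/c -/s.
  have := cos2Dsin2 (pi / p%:R : R); rewrite -/c -/s !mulr0 !mulr1 !sub0r !subr0 => cs.
  have -> : s * (x 0 ix + t * - s) - c * (x 0 iy + t * c) =
    s * x 0 ix - c * x 0 iy - t * (c ^+ 2 + s ^+ 2) by ring.
  by rewrite cs mulr1.
- by move=> y /(lune_wall n1 p0) [].
Qed.

Lemma lune_interior_zim x : sphere_interior D x -> 0 < ev (zim ix iy p) x.
Proof.
move=> Ix; have y0 := lune_interior_gt0 Ix; have w0 := lune_interior_wall_gt0 Ix.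
have [x1 [r [t [r0 /andP[t0 tp] h]]]] := (lune_polar p n1 x).1 (interior_sub Ix).
have p0' : 0 < p%:R :> R by rewrite ltr0n.
move: y0 w0; rewrite (wall_polar p h) h.2 (zre_zim_polar p h).2 => y0 w0.
have rz : 0 < r.
  by rewrite lt_neqAle r0 andbT; apply: contraTneq y0 => <-; rewrite mul0r ltxx.
have tz : 0 < t.
  by rewrite lt_neqAle t0 andbT; apply: contraTneq y0 => <-; rewrite sin0 mulr0 ltxx.
have tlt : t < pi / p%:R.
  rewrite lt_neqAle tp andbT; apply: contraTneq w0 => ->.
  by rewrite subrr sin0 mulr0 ltxx.
rewrite mulr_gt0 ?exprn_gt0// sin_gt0_pi// mulr_gt0//=.
by rewrite mulrC -ltr_pdivlMr.
Qed.

Lemma twice_derivableZ (c : R) f x : twice_derivable_at f x ->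
  twice_derivable_at (c \*: f) x /\ laplacian_at (c \*: f) x = c * laplacian_at f x.
Proof.
move=> tf.
have pE i : is_derive x (delta_mx 0 i) (partial i (c \*: f)) (c * partial i (partial i f) x).
  have [d1 d2] := tf i.
  have E : \forall y \near x, (c \*: partial i f) y = partial i (c \*: f) y.
    by apply: filterS d1 => y dy; rewrite /partial; have [_ ->] := is_deriveZ c (DeriveDef dy erefl).
  exact: near_eq_is_derive E (is_deriveZ c (DeriveDef d2 erefl)).
split.
  move=> i; split; last by have [] := pE i.
  apply: filterS (tf i).1 => y dy.
  by have [] := is_deriveZ c (DeriveDef dy erefl).
rewrite /laplacian_at mulr_sumr; apply: eq_bigr => i _.
by have [_ h] := pE i; rewrite {1}/partial h.
Qed.

(** For small d > 0, if s u is positive somewhere then s u - d y has a positive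
    maximum, attained at an interior point. As y is a spherical harmonic of degree
    1, with eigenvalue n, the Laplacian of this function there is
    - lambda s u + n d y, which is positive. *)
Lemma nonpos_eigen_sign (u : point -> R) (lambda s : R) :
  dirichlet_eigenspace D lambda u -> lambda <= 0 -> forall x, D x -> s * u x <= 0.
Proof.
move=> [u0 cu C2u eqn ub] l0 x1 Dx1; rewrite leNgt; apply/negP => sux.
have yc x : D x -> 0 <= x 0 iy <= 1.
  move=> /(lune_wall n1 p0 _).1 [r1 -> _] /=.
  have := coord_le_r2 x iy; rewrite r1 => h.
  by rewrite leNgt; apply/negP => h1; nra.
pose d := s * u x1 / 2; have d0 : 0 < d by rewrite divr_gt0.
pose V := s \*: u + (- d) \*: ev (var iy).
have cV : {within D, continuous V}.
  have c2 : {within D, continuous (ev (var iy) : point -> R)}.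
    exact/continuous_subspaceT/continuous_ev.
  by move=> z; exact: (cvgD (cvgM (@cvg_cst _ s _ _ _) (cu z)) (cvgM (@cvg_cst _ (- d) _ _ _) (c2 z))).
have [c Dc cmax] := @EVT_max_rV R _ V D (ex_intro _ x1 Dx1) (compact_lune n1 p0) cV.
rewrite inE in Dc.
have VE x : V x = s * u x - d * x 0 iy.
  have -> : V x = s * u x + - d * ev (var iy) x by [].
  by rewrite ev_var mulNr.
have Vc : 0 < V c.
  apply: lt_le_trans (cmax x1 _); last by rewrite inE.
  rewrite VE; have /andP[_ y1] := yc x1 Dx1.
  have : d * x1 0 iy <= d by rewrite ler_piMr// ltW.
  by rewrite /d; lra.
have /andP[cy0 cy1] := yc c Dc.
have suc : 0 < s * u c.
  by move: Vc; rewrite VE; have := mulr_ge0 (ltW d0) cy0; lra.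
have Ic : sphere_interior D c.
  apply: contrapT => nI; have uc : u c = 0 by apply: ub; split.
  by move: suc; rewrite uc mulr0 ltxx.
have [/sphereE c1 _] := Ic.
have c0 : 0 < ev r2 c by rewrite c1.
have Inc := cone_interior Ic.
pose f := ray_ext u; pose h : point -> R := radial (- 2^-1) * ev (var iy).
pose g := s \*: f + (- d) \*: h.
have tf := twice_derivable_ray C2u Inc.
have tev := twice_derivable_ev (var iy) c.
have th : twice_derivable_at h c by exact: radial_mul_twice.
have [tsf lsf] := twice_derivableZ s tf.
have [tdh ldh] := twice_derivableZ (- d) th.
have gE x : 0 < ev r2 x -> g x = V (normalize x).
  move=> x0; have nx : normalize x 0 iy = radial (- 2^-1) x * x 0 iy.
    by rewrite mxE enorm_radial /radial -powRN.
  rewrite VE nx.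
  have -> : g x = s * u (normalize x) + - d * (radial (- 2^-1) x * ev (var iy) x) by [].
  by rewrite ev_var mulNr.
have gmax : \forall y \near c, g y <= g c.
  apply: filterS (cone_near Inc) => y Dy; have y0 := normalize_gt0 Dy.
  rewrite !gE//; apply: le_trans (cmax _ _) _; first by rewrite inE; exact: interior_sub.
  by rewrite (normalize_id c1).
have := local_max_laplacian (twice_derivableD tsf tdh) gmax.
rewrite laplacianD// lsf ldh -(laplace_beltramiE C2u Ic).
have -> : laplacian_at h c = - n%:R * c 0 iy.
  rewrite /h (@laplacian_radial_mul _ _ _ 1)//; last first.
    have := congr1 (fun q => ev q c) (euler_var iy).
    rewrite /euler ev_sum mul1r => <-.
    by apply: eq_bigr => i _; rewrite evM ev_var partial_ev.
  rewrite laplacian_ev; have -> : lap (var iy) = 0 :> mpoly n.+1 R.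
    by rewrite /lap big1// => i _; rewrite mderiv_var -mpolyC_nat mderivC.
  rewrite ev0 mulr0 add0r /radial c1 powR1 mulr1 ev_var -natr1.
  by congr (_ * _); field.
have : laplace_beltrami u c = - lambda * u c.
  by apply/eqP; rewrite mulNr -addr_eq0; apply/eqP; exact: eqn.
move=> ->; have cy := lune_interior_gt0 Ic.
have n0 : 0 < n%:R :> R by rewrite ltr0n; exact: ltnW.
have h1 : 0 < d * (n%:R * c 0 iy) by apply: mulr_gt0 => //; exact: mulr_gt0.
have h2 : 0 <= (- lambda) * (s * u c) by rewrite mulr_ge0 ?oppr_ge0// ltW.
have -> : s * (- lambda * u c) + - d * (- n%:R * c 0 iy) =
  - lambda * (s * u c) + d * (n%:R * c 0 iy) by ring.
by move=> h3; have := ltr_wpDl h2 h1; rewrite ltNge h3.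
Qed.

Lemma nonpos_eigen (u : point -> R) (lambda : R) :
  dirichlet_eigenspace D lambda u -> lambda <= 0 -> forall x, u x = 0.
Proof.
move=> eu l0 x; have [Dx|nDx] := pselect (D x); last by have [-> ] := eu.
have h1 := nonpos_eigen_sign 1 eu l0 Dx.
have h2 := nonpos_eigen_sign (- 1) eu l0 Dx.
lra.
Qed.

End NonpositiveEigenvalues.

(** * The maximum principle on the cone over the lune *)

Section ConeMaximum.
Context {R : realType} (n p : nat) (n1 : (1 < n)%N) (p0 : (0 < p)%N).
Local Notation point := 'rV[R]_n.+1.
Local Notation ix := (ix n).
Local Notation iy := (iy n).
Local Notation D := (lune R n p).
Local Notation aharm := (@aharm R n ix iy p).
Implicit Types (x y : point) (f g : point -> R).

Lemma cont_on_within (K : set point) f : cont_on K f -> {within K, continuous f}.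
Proof.
move=> cf; apply/subspace_continuousP => y Ky; apply/cvgrPdist_lt => e e0.
rewrite near_withinE; apply: filterS (cf y Ky e e0) => z h Kz.
by rewrite distrC; exact: h.
Qed.

(** The part in the closed unit ball of the cone over the lune. *)
Definition sector : set point := [set x | [/\ ev r2 x <= 1, 0 <= x 0 iy & 0 <= wall p x]].

Lemma sector_normalize x : sector x -> 0 < ev r2 x -> D (normalize x).
Proof.
move=> [_ y0 w0] x0; apply/(lune_wall n1 p0); rewrite r2_normalize//.
have N0 : 0 < enorm x by rewrite enorm_gt0.
by rewrite /normalize wallZ mxE; split=> //; rewrite mulr_ge0// invr_ge0 ltW.
Qed.

Lemma normalize_sector x : ev r2 x <= 1 -> 0 < ev r2 x -> D (normalize x) -> sector x.
Proof.
move=> xs x0 /(lune_wall n1 p0) [_ y0 w0]; split => //.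
  by move: y0; rewrite mxE pmulr_rge0// invr_gt0 enorm_gt0.
by move: w0; rewrite wallZ pmulr_rge0// invr_gt0 enorm_gt0.
Qed.

Lemma compact_sector : compact sector.
Proof.
apply: (@compact_closed_r2 _ _ _ 1); last by move=> x [].
have -> : sector = ev r2 @^-1` [set t | t <= 1] `&`
   ((fun x : point => x 0 iy) @^-1` [set t | 0 <= t] `&` wall p @^-1` [set t | 0 <= t]).
  by apply/seteqP; split => x; [move=> []|move=> [? []]].
apply: closedI; last apply: closedI.
- by apply: closed_comp; [move=> z _; exact: continuous_ev|exact: closed_le].
- by apply: closed_comp; [move=> z _; exact: coord_continuous|exact: closed_ge].
- by apply: closed_comp; [move=> z _; exact: continuous_wall|exact: closed_ge].
Qed.

Context (u : point -> R) (lambda a : R).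
Hypothesis eu : dirichlet_eigenspace D lambda u.
Hypothesis a0 : 0 < a.
Hypothesis al : a * (a + n%:R - 1) = lambda.

Let b := a / 2.
Let U := radial b * ray_ext u.

Let b0 : 0 < b. Proof. by rewrite divr_gt0. Qed.

Let cu : cont_on D u.
Proof. by have [_ + _ _ _] := eu; exact: cont_onP. Qed.

Let UE x : U x = radial b x * u (normalize x). Proof. by []. Qed.

Lemma eigen_bounded : exists2 M, 0 < M & forall x, D x -> `|u x| <= M.
Proof. exact: (cont_on_bounded (compact_lune n1 p0) cu). Qed.

Lemma ev_r2_0 : ev r2 (0 : point) = 0.
Proof. by rewrite ev_r2 big1// => i _; rewrite mxE expr0n. Qed.

Lemma r2_eq0 x : ev r2 x = 0 -> x = 0.
Proof.
move=> h; apply/matrixP => i l; rewrite (ord1 i) mxE; apply/eqP.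
by rewrite -sqrf_eq0 eq_le sqr_ge0 andbT -h coord_le_r2.
Qed.

Lemma radial0 : radial b (0 : point) = 0.
Proof. by rewrite /radial ev_r2_0 powR0// gt_eqF. Qed.

(* At the origin, continuity comes from a > 0 and the boundedness of u. *)
Let cU : cont_on sector U.
Proof.
move=> x sx e e0.
have [xz|xz] := eqVneq (ev r2 x) 0.
  have -> : x = 0 by exact: r2_eq0.
  have [M M0 uM] := eigen_bounded.
  have U0 : U 0 = 0 by rewrite UE radial0 mul0r.
  have eM : 0 < e / M by rewrite divr_gt0.
  have d0 : 0 < (e / M) `^ b^-1 by exact: powR_gt0.
  have : nbhs (0 : point) (ev r2 @^-1` [set t | t < (e / M) `^ b^-1] : set point).
    apply: open_nbhs_nbhs; split; last by rewrite /= ev_r2_0.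
    by apply: open_comp => [z _|]; [exact: continuous_ev|exact: open_lt].
  apply: filterS => z /= zd sz; rewrite U0 subr0 UE.
  have [zz|zz] := eqVneq (ev r2 z) 0.
    by rewrite (r2_eq0 zz) radial0 mul0r normr0.
  have z0 : 0 < ev r2 z by rewrite lt_neqAle eq_sym zz ev_r2_ge0.
  have rz : radial b z < e / M.
    have z1 : ev r2 z \is Num.nneg by rewrite nnegrE ev_r2_ge0.
    have d1 : (e / M) `^ b^-1 \is Num.nneg by rewrite nnegrE ltW.
    have := gt0_ltr_powR b0 z1 d1 zd.
    by rewrite -powRrM mulVf ?gt_eqF// powRr1// ltW.
  have rz0 := radial_gt0 b z0.
  rewrite normrM gtr0_norm//.
  apply: (@le_lt_trans _ _ (radial b z * M)); last by rewrite -ltr_pdivlMr.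
  by rewrite ler_wpM2l ?(ltW rz0)// uM//; exact: sector_normalize.
have x0 : 0 < ev r2 x by rewrite lt_neqAle eq_sym xz ev_r2_ge0.
move: x sx {xz} x0 e e0; suff : cont_on (sector `&` [set x | 0 < ev r2 x]) U.
  move=> h x sx x0 e e0; apply: filterS2 (r2_gt0_near x0) (h x (conj sx x0) e e0) => z z0 hz sz.
  by apply: hz; split.
apply: cont_on_cvg => x [sx x0].
apply: cvgM; first by apply: cvg_within_filter; exact: continuous_radial.
apply/cvgrPdist_lt => e e0; rewrite near_withinE.
have Dx := sector_normalize sx x0.
have hz : \forall z \near x, D (normalize z) -> `|u (normalize z) - u (normalize x)| < e.
  exact: (continuous_normalize x0 (cu Dx e0)).
apply: filterS hz => z h [sz z0]; rewrite distrC; apply: h.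
exact: sector_normalize.
Qed.

Let n0r : n%:R + 1 = n.+1%:R :> R. Proof. by rewrite natr1. Qed.

(* The choice of a makes the radial term a (a + n - 1) |x|^(a - 2) u cancel the
   Laplacian of the ray-constant extension of u. *)
Let U_harmonic x : sphere_interior D (normalize x) ->
  twice_derivable_at U x /\ laplacian_at U x = 0.
Proof.
have [_ _ C2u eqn _] := eu.
move=> Dx; have x0 := normalize_gt0 Dx.
have tf := twice_derivable_ray C2u Dx.
split; first exact: radial_mul_twice.
rewrite /U (@laplacian_radial_mul _ _ _ 0)//; last first.
  by rewrite mul0r; exact: (euler_ray C2u).
have N0 : 0 < enorm x by rewrite enorm_gt0.
have xE : x = enorm x *: normalize x.
  by rewrite /normalize scalerA divff ?scale1r// gt_eqF.
have Dnx : sphere_interior D (normalize (normalize x)) := cone_interior Dx.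
have -> : laplacian_at (ray_ext u) x = - lambda * (ev r2 x)^-1 * ray_ext u x.
  rewrite {1}xE (laplacian_rayZ C2u Dnx N0) -(laplace_beltramiE C2u Dx).
  have -> : laplace_beltrami u (normalize x) = - lambda * u (normalize x).
    by apply/eqP; rewrite mulNr -addr_eq0; apply/eqP; exact: eqn.
  rewrite -invfM -expr2 enormE sqr_sqrtr ?ev_r2_ge0//.
  by rewrite /ray_ext /=; ring.
have -> : radial b x = radial (b - 1) x * ev r2 x by exact: radialS.
rewrite -al -n0r /b; field; exact: lt0r_neq0.
Qed.

Context (N : nat) (P : nat -> mpoly n.+1 R) (e : R).
Hypothesis aP : forall k, aharm k (P k).
Hypothesis uP : forall x, D x -> `|u x - \sum_(k < N) ev (P k) x| <= e.

Let pol := \sum_(k < N) P k.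

Let ev_pol x : ev pol x = \sum_(k < N) ev (P k) x. Proof. exact: ev_sum. Qed.

Let pol_vanish x : ev (zim ix iy p) x = 0 -> ev pol x = 0.
Proof.
by move=> z0; rewrite ev_pol big1// => k _; exact: aharm_vanish (aP k) z0.
Qed.

Let zim_normalize x : 0 < ev r2 x ->
  ev (zim ix iy p) (normalize x) = 0 -> ev (zim (R := R) ix iy p) x = 0.
Proof.
move=> x0; have hz : hom p (zim (R := R) ix iy p) by exact: (homR_zre_zim (ix_iy n1) p).2.
rewrite /normalize (ev_hom _ _ hz) => /eqP; rewrite mulf_eq0 expf_eq0 invr_eq0.
by rewrite gt_eqF ?enorm_gt0// andbF /= => /eqP.
Qed.

Let zim0 : ev (zim ix iy p) (0 : point) = 0.
Proof.
case: (p) p0 => // q _; rewrite zimS !evE !mxE; ring.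
Qed.

Let sector_sign (s : R) : s ^+ 2 = 1 -> forall x, sector x -> s * (U x - ev pol x) <= e.
Proof.
move=> s1.
have e0 : 0 <= e.
  have D1 : D (delta_mx 0 ix).
    apply/(lune_wall n1 p0); rewrite ev_r2 (bigD1 ix)//= big1 => [|l lx].
      rewrite /wall !mxE !eqxx /= eq_sym (negbTE (ix_iy n1)) addr0 expr1n !mulr0 mulr1 subr0.
      split => //; apply: sin_ge0_pi; rewrite divr_ge0 ?pi_ge0//=.
      by rewrite ler_pdivrMr ?ltr0n// ler_peMr ?pi_ge0// ler1n.
    by rewrite !mxE (negbTE lx) expr0n.
  exact: le_trans (uP D1).
pose V := s \*: (U + (- 1) \*: ev pol).
have VE x : V x = s * (U x - ev pol x).
  have -> : V x = s * (U x + -1 * ev pol x) by [].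
  by rewrite mulN1r.
suff : forall x, sector x -> V x <= e by move=> h x /h; rewrite VE.
apply: weak_maximum; first exact: compact_sector.
  apply: cont_on_within => x sx d d0.
  have cpol : cont_on sector (ev pol) by exact/cont_onP/continuous_subspaceT/continuous_ev.
  apply: filterS (cont_onB cU cpol sx d0) => z h sz; have := h sz.
  by rewrite !VE -mulrBr normrM (_ : `|s| = 1) ?mul1r//; apply/eqP; rewrite -sqrp_eq1// real_normK ?num_real// s1.
move=> x sx; have [xz|xz] := eqVneq (ev r2 x) 0.
  left; rewrite VE (r2_eq0 xz) UE radial0 mul0r pol_vanish ?subrr ?mulr0//.
have x0 : 0 < ev r2 x by rewrite lt_neqAle eq_sym xz ev_r2_ge0.
have Dx := sector_normalize sx x0.
have [Ix|nI] := pselect (sphere_interior D (normalize x)); last first.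
  left; have bx : sphere_boundary D (normalize x) by split.
  have [_ _ _ _ ub] := eu.
  rewrite VE UE ub// mulr0 pol_vanish ?subrr ?mulr0//.
  exact/zim_normalize/(lune_boundary_zim n1 p0).
have [x1|x1] := eqVneq (ev r2 x) 1.
  left; rewrite VE UE normalize_id// /radial x1 powR1 mul1r ev_pol.
  have := uP Dx; rewrite normalize_id//; move: (u x - _) => r hr.
  apply: le_trans (ler_norm _) _; rewrite normrM.
  by rewrite (_ : `|s| = 1) ?mul1r//; apply/eqP; rewrite -sqrp_eq1// real_normK ?num_real// s1.
right; have lt1 : ev r2 x < 1 by rewrite lt_neqAle x1; case: sx.
have [tU lU] := U_harmonic Ix.
have [tp lp] := twice_derivableZ (- 1) (twice_derivable_ev pol x).
have [tV lV] := twice_derivableZ s (twice_derivableD tU tp).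
split => //.
  have h1 : nbhs x (ev r2 @^-1` [set t | t < 1] : set point).
    apply: open_nbhs_nbhs; split => //.
    by apply: open_comp => [z _|]; [exact: continuous_ev|exact: open_lt].
  apply: filterS2 h1 (cone_near Ix) => y y1 Iy.
  by apply: normalize_sector; [exact: ltW|exact: normalize_gt0 Iy|exact: interior_sub].
have pol0 : lap pol = 0.
  by rewrite /pol raddf_sum big1// => k _; apply: aharm_lap (aP k) => //; exact: ix_iy.
by rewrite lV laplacianD// lU lp laplacian_ev pol0 ev0 mulr0 addr0 mulr0.
Qed.

(** Both |x|^a u(x / |x|) and the sum of the P k are harmonic in the sector and vanish
    on its two flat sides, so the bound e for their difference extends from the spherical
    side to the whole sector, in particular to the points t x. *)
Lemma cone_maximum x (t : R) : D x -> 0 < t <= 1 ->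
  `|t `^ a * u x - \sum_(k < N) t ^+ k * ev (P k) x| <= e.
Proof.
move=> Dx /andP[t0 t1].
have [x1 y0 w0] := (lune_wall n1 p0 x).1 Dx.
have st : sector (t *: x).
  split; first by rewrite ev_r2Z x1 mulr1 expr_le1// ltW.
    by rewrite mxE mulr_ge0// ltW.
  by rewrite wallZ mulr_ge0// ltW.
have UtE : U (t *: x) = t `^ a * u x.
  rewrite UE normalizeZ// normalize_id// /radial ev_r2Z x1 mulr1; congr (_ * _).
  by rewrite -powR_mulrn ?(ltW t0)// -powRrM /b mulrC divfK.
have PtE : ev pol (t *: x) = \sum_(k < N) t ^+ k * ev (P k) x.
  by rewrite ev_pol; apply: eq_bigr => k _; rewrite (ev_hom _ _ (aharm_hom (ix_iy n1) (aP k))).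
rewrite -UtE -PtE ler_norml.
have := sector_sign (expr1n _ 2) st; have := @sector_sign (-1) _ _ st.
rewrite sqrrN expr1n => /(_ erefl); rewrite mul1r mulN1r => h1 h2.
by apply/andP; split; lra.
Qed.

End ConeMaximum.

(** * Eigenfunctions as limits of homogeneous harmonics *)

Section EigenLimit.
Context {R : realType} (n p : nat) (n1 : (1 < n)%N) (p0 : (0 < p)%N).
Local Notation point := 'rV[R]_n.+1.
Local Notation ix := (ix n).
Local Notation iy := (iy n).
Local Notation D := (lune R n p).
Local Notation aharm := (@aharm R n ix iy p).
Implicit Types (x y : point) (f g : point -> R).

Lemma geometric_tail (q : R) m N : 0 <= q -> 2 * q <= 1 -> (m <= N)%N ->
  \sum_(m <= k < N) q ^+ k <= 2 * q ^+ m.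
Proof.
move=> q0 q1 mN.
suff : \sum_(m <= k < N) q ^+ k <= 2 * q ^+ m - 2 * q ^+ N.
  move=> /le_trans; apply; rewrite gerBl mulr_ge0// exprn_ge0//.
elim: N mN => [|N IH]; first by rewrite leqn0 => /eqP ->; rewrite big_geq// subrr.
rewrite leq_eqVlt => /orP[/eqP <-|]; first by rewrite big_geq// subrr.
rewrite ltnS => mN; rewrite big_nat_recr//=.
have := IH mN; have qN : 0 <= q ^+ N by rewrite exprn_ge0.
rewrite [q ^+ N.+1]exprSr; move: (q ^+ N) qN (\sum_(m <= i < N) q ^+ i) (q ^+ m) => Q Q0 S T h.
nra.
Qed.

(** By antiinvariance, the values on the sphere are up to sign those on the
    lune. *)
Lemma aharm_sphere_bound N (P : nat -> mpoly n.+1 R) (M : R) :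
  (forall k, aharm k (P k)) -> (forall x, D x -> `|\sum_(k < N) ev (P k) x| <= M) ->
  forall x, ev r2 x = 1 -> `|\sum_(k < N) ev (P k) x| <= M.
Proof.
move=> aP PM x x1; have [y [s [Dy s1 sP]]] := aharm_fold n1 p0 x1.
under eq_bigr do rewrite (sP _ _ (aP _)).
rewrite -mulr_sumr normrM (_ : `|s| = 1) ?mul1r; first exact: PM.
by apply/eqP; rewrite -sqrp_eq1// real_normK ?num_real// s1.
Qed.

Context (u : point -> R) (lambda a : R).
Hypothesis eu : dirichlet_eigenspace D lambda u.
Hypothesis a0 : 0 < a.
Hypothesis al : a * (a + n%:R - 1) = lambda.

Let half : R := 2^-1.
Let h : R := half `^ a.

Let half0 : 0 < half. Proof. by rewrite invr_gt0. Qed.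

Let h01 : 0 < h <= 1.
Proof.
rewrite powR_gt0//= -(powRr0 half) ger_powR ?(ltW a0)//.
by rewrite half0 /half; lra.
Qed.

(** Let the sum S of the P k approximate u. Both S (x / 2) and 2^(-a) S (x) are
    close to 2^(-a) u (x), so the components of their difference, which are
    (2^(-k) - 2^(-a)) P k, are small, and so are the P k of bounded degree k <> a.
    For large degrees only the bound B^k M is available; it suffices at the points
    t x for small t, where t^k P k is negligible compared with t^a u. *)
Theorem eigen_limit (eta : R) : 0 < eta -> exists (P : nat -> mpoly n.+1 R) (m : nat),
  (forall k, aharm k (P k)) /\
  forall x, D x -> `|u x - \sum_(k < m | a == k%:R) ev (P k) x| <= eta.
Proof.
move=> eta0.
have [M0 M00 uM] := eigen_bounded n1 p0 eu.
pose M := M0 + 1; have M1 : 0 < M by rewrite addr_gt0.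
pose B : R := 4 * bernstein_cst (n := n).
have B1 : 1 <= B by rewrite /B; have := @bernstein_cst_ge1 R n; lra.
have B0 : 0 < B := lt_le_trans ltr01 B1.
pose m := (Num.truncn a).+2.
have am : a <= m.-1%:R by rewrite ltW// truncnS_gt.
pose c (k : nat) := B ^+ k * 2 / `|half ^+ k - h|.
pose C := \sum_(k < m | a != k%:R) c k.
have C0 : 0 <= C.
  by apply: sumr_ge0 => k _; rewrite divr_ge0// mulr_ge0// exprn_ge0// ltW.
(* t makes the degrees from m on, where m > a + 1, contribute at most t^a eta / 2;
   the precision eps is adapted to this t. *)
pose t := Num.min (2 * B)^-1 (eta / (4 * B ^+ m * M)).
have Bm : 0 < B ^+ m by rewrite exprn_gt0.
have B2 : 0 < 2 * B by exact: mulr_gt0.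
have BM : 0 < 4 * B ^+ m * M by apply: mulr_gt0 => //; exact: mulr_gt0.
have t0 : 0 < t by rewrite lt_min invr_gt0 B2 divr_gt0.
have tB : 2 * (t * B) <= 1.
  have : t <= 1 / (2 * B) by rewrite div1r ge_min lexx.
  by rewrite ler_pdivlMr// mulrCA.
have teta : 4 * B ^+ m * M * t <= eta.
  have : t <= eta / (4 * B ^+ m * M) by rewrite ge_min lexx orbT.
  by rewrite ler_pdivlMr// [t * _]mulrC.
have t1 : t <= 1 by nra.
have ta0 : 0 < t `^ a by exact: powR_gt0.
have tm : t ^+ m <= t * t `^ a.
  rewrite exprS ler_wpM2l ?(ltW t0)// -powR_mulrn ?(ltW t0)//.
  by apply: ger_powR => //; apply/andP.
pose eps := Num.min 1 (t `^ a * eta / (2 * (1 + C))).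
have C1 : 0 < 1 + C by rewrite ltr_pwDl.
have eps0 : 0 < eps by rewrite lt_min ltr01 /= divr_gt0// !mulr_gt0.
have eps1 : eps <= 1 by rewrite ge_min lexx.
have epsC : eps * (1 + C) * 2 <= t `^ a * eta.
  have : eps <= t `^ a * eta / (2 * (1 + C)) by rewrite ge_min lexx orbT.
  by rewrite ler_pdivlMr ?mulr_gt0// [2 * _]mulrC mulrA.
have [_ cu C2u eqn ub] := eu.
have u0 x : D x -> ev (zim ix iy p) x = 0 -> u x = 0.
  move=> Dx zx; apply: ub; split => // Ix.
  by have := lune_interior_zim n1 p0 Ix; rewrite zx ltxx.
have [f [N0 [P [aP P0 fP]]] uf] := aharm_dense n1 p0 (cont_onP cu) u0 eps0.
pose N := maxn N0 m.
have uP x : D x -> `|u x - \sum_(k < N) ev (P k) x| <= eps.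
  move=> Dx; have [x1 _ _] := (lune_wall n1 p0 x).1 Dx.
  by rewrite -(sums_widen x (leq_maxl N0 m) P0) -fP//; exact: uf.
have tP := cone_maximum n1 p0 eu a0 al aP uP.
have hP k : hom k (P k) by exact: (aharm_hom (ix_iy n1) (aP k)).
have lP k : lap (P k) = 0 by exact: (aharm_lap (ix_iy n1) (aP k)).
have bdP k x : (k < N)%N -> D x -> `|ev (P k) x| <= B ^+ k * M.
  move=> kN Dx; have [x1 _ _] := (lune_wall n1 p0 x).1 Dx.
  apply: (component_bound hP lP x1) kN; apply: aharm_sphere_bound => // y Dy.
  have := uP y Dy; have := uM y Dy; rewrite /M.
  move: (\sum_(k < N) _) => S h1 h2.
  have -> : S = u y - (u y - S) by ring.
  by rewrite (le_trans (ler_normB _ _))//; lra.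
have bdQ k x : (k < N)%N -> D x -> a != k%:R -> `|ev (P k) x| <= c k * eps.
  move=> kN Dx ak; have [x1 _ _] := (lune_wall n1 p0 x).1 Dx.
  pose Q j := (half ^+ j - h) *: P j.
  have hk : half ^+ k - h != 0.
    rewrite subr_eq0; apply: contraNneq ak => /(congr1 (@ln R)).
    rewrite -powR_mulrn ?ltW// !ln_powR => /mulIf -> //.
    by rewrite lt_eqF// ln_lt0// half0 /half; lra.
  have : `|ev (Q k) x| <= B ^+ k * (2 * eps).
    apply: (@component_bound _ _ N Q) kN => //.
    - by move=> j; exact: homZ.
    - by move=> j; rewrite lapZ lP scaler0.
    apply: aharm_sphere_bound => [j|y Dy]; first exact: aharmZ.
    have -> : \sum_(k < N) ev (Q k) y = (h * u y - \sum_(k < N) ev (P k) y * h)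
        - (half `^ a * u y - \sum_(k < N) half ^+ k * ev (P k) y).
      have -> : \sum_(k < N) ev (Q k) y =
          \sum_(k < N) half ^+ k * ev (P k) y - \sum_(k < N) ev (P k) y * h.
        by rewrite -sumrB; apply: eq_bigr => j _; rewrite evZ; ring.
      by rewrite -/h; ring.
    have h1 : `|half `^ a * u y - \sum_(k < N) half ^+ k * ev (P k) y| <= eps.
      apply: tP => //; rewrite invr_gt0 ltr0n /= invf_le1//; lra.
    rewrite (le_trans (ler_normB _ _))// [2 * eps]mulr_natl mulr2n lerD//.
    rewrite -mulr_suml [h * _]mulrC -mulrBl normrM.
    have /andP[hh0 hh1] := h01.
    apply: (@le_trans _ _ (`|u y - \sum_(k < N) ev (P k) y| * 1)); last by rewrite mulr1 uP.
    by rewrite ler_wpM2l// gtr0_norm.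
  rewrite /Q evZ normrM mulrC -ler_pdivlMr ?normr_gt0// => /le_trans; apply.
  by rewrite /c le_eqVlt; apply/orP; left; apply/eqP; field; rewrite normr_eq0.
exists P, m; split => // x Dx.
have mN : (m <= N)%N by exact: leq_maxr.
have tail : `|\sum_(m <= k < N) t ^+ k * ev (P k) x| <= 2 * (t * B) ^+ m * M.
  apply: (@le_trans _ _ (\sum_(m <= k < N) (t * B) ^+ k * M)).
    rewrite (le_trans (ler_norm_sum _ _ _))// big_nat_cond [leRHS]big_nat_cond.
    apply: ler_sum => k /andP[/andP[_ kN] _].
    rewrite normrM (ger0_norm (exprn_ge0 _ (ltW t0))) exprMn -mulrA.
    by rewrite ler_wpM2l ?exprn_ge0 ?(ltW t0)// bdP.
  rewrite -mulr_suml ler_wpM2r ?(ltW M1)//.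
  by apply: geometric_tail => //; rewrite mulr_ge0// ltW.
have small : `|\sum_(k < m | a != k%:R) t ^+ k * ev (P k) x| <= C * eps.
  rewrite (le_trans (ler_norm_sum _ _ _))// /C mulr_suml; apply: ler_sum => k ak.
  rewrite normrM (ger0_norm (exprn_ge0 _ (ltW t0))).
  have tk : t ^+ k <= 1 by rewrite exprn_ile1// ltW.
  apply: (@le_trans _ _ (1 * `|ev (P k) x|)); first by rewrite ler_wpM2r.
  by rewrite mul1r bdQ// (leq_trans (ltn_ord k)).
have main := tP x t Dx (introT andP (conj t0 t1)).
have sel : \sum_(k < m | a == k%:R) t ^+ k * ev (P k) x =
    t `^ a * \sum_(k < m | a == k%:R) ev (P k) x.
  rewrite mulr_sumr; apply: eq_bigr => k /eqP ->.
  by rewrite powR_mulrn// ltW.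
have split3 : \sum_(k < N) t ^+ k * ev (P k) x =
    t `^ a * (\sum_(k < m | a == k%:R) ev (P k) x)
    + \sum_(k < m | a != k%:R) t ^+ k * ev (P k) x
    + \sum_(m <= k < N) t ^+ k * ev (P k) x.
  rewrite -(big_mkord xpredT (fun k => t ^+ k * ev (P k) x)).
  rewrite (big_cat_nat (n := m))//= big_mkord; congr (_ + _).
  by rewrite (bigID (fun k : 'I_m => a == k%:R)) /= sel.
rewrite split3 in main.
move: main tail small; set S1 := \sum_(k < m | a == k%:R) _.
set S2 := \sum_(k < m | a != k%:R) _; set S3 := \sum_(m <= k < N) _ => main tail small.
rewrite -(ler_pM2l ta0).
have -> : t `^ a * `|u x - S1| = `|t `^ a * u x - (t `^ a * S1 + S2 + S3) + (S2 + S3)|.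
  rewrite -{1}(gtr0_norm ta0) -normrM; congr `|_|; ring.
rewrite (le_trans (ler_normD _ _))//.
have h23 := ler_normD S2 S3.
have tailt : 2 * (t * B) ^+ m * M <= t `^ a * eta / 2.
  rewrite exprMn.
  have e1 : 2 * (t ^+ m * B ^+ m) * M <= 2 * ((t * t `^ a) * B ^+ m) * M.
    by rewrite ler_wpM2r ?(ltW M1)// ler_wpM2l// ler_wpM2r// ltW.
  apply: (le_trans e1).
  have -> : 2 * (t * t `^ a * B ^+ m) * M = t `^ a * (4 * B ^+ m * M * t) / 2 by field.
  by rewrite ler_wpM2r// ler_wpM2l// ltW.
nra.
Qed.

End EigenLimit.

(** * Eigenfunctions from harmonic polynomials *)

Section PolynomialEigenfunctions.
Context {R : realType} {n : nat}.
Local Notation point := 'rV[R]_n.+1.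
Local Notation e_ i := (delta_mx 0 i : point).
Implicit Types (x y : point) (f g F : point -> R) (Q : mpoly n.+1 R) (E : set point).

(** The products |x|^(2 b) Q with Q a polynomial are stable under partial
    derivatives: this is the polynomial factor of the derivative. *)
Definition radial_mderiv (b : R) (i : 'I_n.+1) Q : mpoly n.+1 R :=
  (2 * b) *: (var i * Q) + r2 * mderiv i Q.

Lemma is_derive_radial_ev b Q x i : 0 < ev r2 x ->
  is_derive x (e_ i) (radial b * ev Q) ((radial (b - 1) * ev (radial_mderiv b i Q)) x).
Proof.
move=> x0; have := radial_mul_derive b x0 (@derivable_ev _ _ Q x i).
congr (is_derive _ _ _ _); rewrite partial_ev (radialS b x0).
have -> : (radial (b - 1) * ev (radial_mderiv b i Q)) x =
  radial (b - 1) x * ev (radial_mderiv b i Q) x by [].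
by rewrite /radial_mderiv !evE; ring.
Qed.

Lemma continuous_radial_ev b Q x : 0 < ev r2 x -> {for x, continuous (radial b * ev Q)}.
Proof. by move=> x0; exact: (cvgM (continuous_radial x0) (continuous_ev (p := Q) (x := x))). Qed.

Lemma near_continuous f g x : (\forall y \near x, f y = g y) ->
  {for x, continuous g} -> {for x, continuous f}.
Proof.
move=> fg cg; have fgx : f x = g x := nbhs_singleton fg.
have gf : \forall y \near x, g y = f y by apply: filterS fg.
rewrite /prop_for /continuous_at fgx; apply: cvg_trans cg.
exact: near_eq_cvg gf.
Qed.

Lemma near_radial_ev F b Q x i : 0 < ev r2 x ->
  (\forall y \near x, F y = (radial b * ev Q) y) ->
  [/\ derivable F x (e_ i), {for x, continuous F} &
      \forall y \near x, partial i F y = (radial (b - 1) * ev (radial_mderiv b i Q)) y].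
Proof.
move=> x0 FE; split.
- have FE' : \forall y \near x, (radial b * ev Q) y = F y by apply: filterS FE.
  by have [] := near_eq_is_derive FE' (is_derive_radial_ev b Q i x0).
- exact: near_continuous FE (continuous_radial_ev x0).
apply: filterS2 (r2_gt0_near x0) (nbhs_interior FE) => y y0 FEy.
have FE' : \forall z \near y, (radial b * ev Q) z = F z by apply: filterS FEy.
by have [_] := near_eq_is_derive FE' (is_derive_radial_ev b Q i y0).
Qed.

Lemma laplacian_near f g x : (\forall y \near x, f y = g y) ->
  laplacian_at f x = laplacian_at g x.
Proof.
move=> fg; apply: eq_bigr => i _; apply: near_eq_derive.
apply: filterS (nbhs_interior fg) => y fgy.
exact: near_eq_derive.
Qed.

Definition restrict E f : point -> R := fun x => if `[< E x >] then f x else 0.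

Lemma restrict_in E f x : E x -> restrict E f x = f x.
Proof. by move=> Ex; rewrite /restrict asboolT. Qed.

Lemma restrict_out E f x : ~ E x -> restrict E f x = 0.
Proof. by move=> Ex; rewrite /restrict asboolF. Qed.

Context (E : set point) (K : nat) (Q : mpoly n.+1 R).
Hypothesis hQ : hom K Q.
Hypothesis lQ : lap Q = 0.
Hypothesis bQ : forall x, sphere_boundary E x -> ev Q x = 0.

Let u := restrict E (ev Q).
Let b : R := - (K%:R / 2).

Let rayE x : sphere_interior E (normalize x) ->
  \forall y \near x, ray_ext u y = (radial b * ev Q) y.
Proof.
move=> Ex; apply: filterS (cone_near Ex) => y Ey; have y0 := normalize_gt0 Ey.
rewrite /ray_ext /= /u restrict_in; last exact: interior_sub.
have -> : (radial b * ev Q) y = radial b y * ev Q y by [].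
rewrite /normalize (ev_hom _ _ hQ); congr (_ * _).
rewrite enorm_radial /radial -powRN -powR_mulrn ?powR_ge0// -powRrM /b.
by congr (_ `^ _); rewrite mulNr mulrC.
Qed.

(** The ray-constant extension of Q is |x|^(- K) Q on the cone over the interior of E, and its
    Laplacian is a multiple of |x|^(- K - 2) Q because Q is harmonic. *)
Theorem harmonic_eigenfunction :
  dirichlet_eigenspace E (K%:R * (K%:R + n%:R - 1)) u.
Proof.
have C2 : sphere_C2_on (sphere_interior E) u.
  move=> x Ex i; have x0 := normalize_gt0 Ex.
  have [h1 _ E1] := near_radial_ev i x0 (rayE Ex).
  split => //.
    by have [_ h _] := near_radial_ev i x0 E1.
  move=> j; have [h2 _ E2] := near_radial_ev j x0 E1.
  by split => //; have [_ h _] := near_radial_ev j x0 E2.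
split => //.
- by move=> x Ex; exact: restrict_out.
- apply: cont_on_within => x Ex d d0.
  have := @continuous_ev R n Q x; move=> /cvgrPdist_lt /(_ d d0).
  by apply: filterS => y h Ey; rewrite /u !restrict_in// distrC.
- move=> x Ex; have [/sphereE x1 _] := Ex.
  have x0 : 0 < ev r2 x by rewrite x1.
  rewrite (laplace_beltramiE C2 Ex) (laplacian_near (rayE (cone_interior Ex))).
  rewrite (@laplacian_radial_mul _ _ _ K%:R)//; last 2 first.
  + exact: twice_derivable_ev.
  + have := congr1 (fun q => ev q x) hQ; rewrite evZ => <-.
    by rewrite /euler ev_sum; apply: eq_bigr => i _; rewrite evM ev_var partial_ev.
  rewrite laplacian_ev lQ ev0 mulr0 add0r /radial x1 powR1 mulr1.
  rewrite /u restrict_in; last exact: interior_sub.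
  by rewrite /b -natr1; field.
- by move=> x Bx; rewrite /u restrict_in ?bQ//; case: Bx.
Qed.

End PolynomialEigenfunctions.

(** * Uniform limits in a finite-dimensional span *)

Section SpanClosed.
Context {R : realType} {X : Type} (S : set X) (d : nat) (b : 'I_d -> X -> R).
Hypothesis indep : forall c : 'I_d -> R,
  (forall x, S x -> \sum_i c i * b i x = 0) -> forall i, c i = 0.

Let row_at x : 'rV[R]_d := \row_i b i x.

(* As long as the rank is less than d, some nonzero combination vanishes at all
   the chosen points, and by independence it is nonzero at some further point. *)
Let evaluation_points k : (k <= d)%N -> exists N (x : 'I_N -> X),
  (forall j, S (x j)) /\ (k <= \rank (\matrix_(j < N) row_at (x j)))%N.
Proof.
elim: k => [|k IH] kd.
  have x0 : 'I_0 -> X by case.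
  by exists 0%N, x0; split => // -[].
have [N [x [Sx rk]]] := IH (ltnW kd).
set A := \matrix_j row_at (x j) in rk.
have [kA|kA] := ltnP k (\rank A); first by exists N, x.
have rA : \rank A = k by apply/eqP; rewrite eqn_leq kA rk.
have /rowV0Pn [v vk v0] : kermx A^T != 0.
  by rewrite -mxrank_eq0 mxrank_ker mxrank_tr rA -lt0n subn_gt0.
have vA : v *m A^T = 0 by apply/sub_kermxP.
have [y Sy yv] : exists2 y, S y & \sum_i v 0 i * b i y != 0.
  apply: contrapT => h; move/eqP: v0; apply; apply/matrixP => i j; rewrite (ord1 i) mxE.
  apply: indep => y Sy; apply/eqP/negPn/negP => h2; apply: h; by exists y.
exists (N + 1)%N, (fun j => match fintype.split j with inl j => x j | inr _ => y end).
split; first by move=> j; case: (fintype.split j).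
have -> : \matrix_(j < N + 1) row_at (match fintype.split j with inl j => x j | inr _ => y end) =
    col_mx A (row_at y).
  apply/matrixP => i j; rewrite mxE [RHS]mxE; case: (fintype.split i) => l; rewrite !mxE//.
apply/negPn/negP => /negP le.
have AC : (A <= col_mx A (row_at y))%MS by rewrite -addsmxE addsmxSl.
have yC : (row_at y <= col_mx A (row_at y))%MS by rewrite -addsmxE addsmxSr.
have sA : (col_mx A (row_at y) <= A)%MS.
  have [l1 <-] := mxrank_leqif_sup AC.
  by rewrite eqn_leq l1 /= leqNgt; apply/negP => l2; apply: le; rewrite -rA.
have := submx_trans yC sA.
move=> /submxP [D yD]; move/eqP: yv; apply.
have : v *m (row_at y)^T = 0 by rewrite yD trmx_mul mulmxA vA mul0mx.
move=> /matrixP /(_ 0 0); rewrite mxE [RHS]mxE => h; apply: etrans h.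
by apply: eq_bigr => i _; rewrite !mxE.
Qed.

(** The coefficients are linear functions of the values at finitely many points,
    so those of better and better approximations converge to the coefficients of
    u. *)
Lemma span_closed (u : X -> R) :
  (forall eta, 0 < eta -> exists c : 'I_d -> R,
     forall x, S x -> `|u x - \sum_i c i * b i x| <= eta) ->
  exists c : 'I_d -> R, forall x, S x -> u x = \sum_i c i * b i x.
Proof.
move=> uc; have [N [x [Sx rk]]] := evaluation_points (leqnn d).
have /row_fullP [B BA] : row_full (\matrix_(j < N) row_at (x j)).
  by rewrite /row_full eqn_leq rk rank_leq_col.
have dual (c : 'I_d -> R) i : \sum_j B i j * (\sum_k c k * b k (x j)) = c i.
  transitivity (\sum_k c k * (1%:M : 'M[R]_d) i k).
    under eq_bigr do rewrite mulr_sumr.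
    rewrite exchange_big /=; apply: eq_bigr => k _.
    rewrite -BA mxE mulr_sumr; apply: eq_bigr => j _; rewrite !mxE; ring.
  rewrite (bigD1 i)//= mxE eqxx mulr1 big1 ?addr0// => k ki.
  by rewrite mxE eq_sym (negbTE ki) mulr0.
pose c i := \sum_j B i j * u (x j).
exists c => z Sz; apply/eqP; rewrite -subr_eq0 -normr_le0; apply/ler_addgt0Pl => e e0.
rewrite addr0.
pose C := 1 + \sum_i (\sum_j `|B i j|) * `|b i z|.
have C0 : 0 < C.
  by rewrite ltr_pwDl// sumr_ge0// => i _; rewrite mulr_ge0// sumr_ge0.
have eC : 0 < e / C by rewrite divr_gt0.
have [c' hc'] := uc _ eC.
have cc i : `|c' i - c i| <= (\sum_j `|B i j|) * (e / C).
  rewrite -(dual c' i) /c -sumrB (le_trans (ler_norm_sum _ _ _))// mulr_suml.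
  by apply: ler_sum => j _; rewrite -mulrBr normrM ler_wpM2l// distrC hc'.
have -> : u z - \sum_i c i * b i z =
    (u z - \sum_i c' i * b i z) + \sum_i (c' i - c i) * b i z.
  by under [X in _ = _ + X]eq_bigr do rewrite mulrBl; rewrite sumrB addrA subrK.
rewrite (le_trans (ler_normD _ _))//.
have -> : e = (e / C) + (\sum_i (\sum_j `|B i j|) * `|b i z|) * (e / C).
  by rewrite -[X in X + _]mul1r -mulrDl -/C mulrC divfK// gt_eqF.
rewrite lerD ?hc'//.
rewrite (le_trans (ler_norm_sum _ _ _))// mulr_suml; apply: ler_sum => i _.
by rewrite normrM mulrAC ler_wpM2r.
Qed.

End SpanClosed.

(** * Polynomial identities and rotations *)

Section PolynomialIdentity.
Context {R : realType} {n : nat}.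
Local Notation poly := (mpoly n.+1 R).
Local Notation point := 'rV[R]_n.+1.

Lemma ev_at0 (q : poly) : ev q 0 = mcoeff mnm0 q.
Proof.
elim/mpolyind: q => [|c m q _ _ IH]; first by rewrite ev0 mcoeff0.
rewrite evD evZ IH mcoeffD mcoeffZ mcoeffX; congr (_ * _ + _).
rewrite /ev mevalX; have [->|m0] := eqVneq m mnm0.
  by rewrite big1// => i _; rewrite mnm0E expr0.
have [i mi] : exists i, (0 < m i)%N.
  apply: contrapT => h; move/eqP: m0; apply; apply/mnmP => i; rewrite mnm0E.
  by apply/eqP; rewrite -leqn0 leqNgt; apply/negP => mi; apply: h; exists i.
by rewrite (bigD1 i)//= mxE expr0n gtn_eqF// mul0r.
Qed.

Lemma ev_is_derive_zero (q : poly) i : (forall x : point, ev q x = 0) ->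
  forall x : point, ev (mderiv i q) x = 0.
Proof.
move=> q0 x; have [_ <-] := is_derive_ev q x i.
have -> : ev q = cst 0 by apply/funext => z; rewrite q0.
by have [_ ->] := is_derive_cst (0 : R) x (delta_mx 0 i).
Qed.

(** All the derivatives of q vanish identically, and up to factorials their values
    at the origin are the coefficients. *)
Lemma ev_eq0 (q : poly) : (forall x : point, ev q x = 0) -> q = 0.
Proof.
move=> q0; apply/mpolyP => m; rewrite mcoeff0.
have [k] := ubnP (mdeg m); elim: k m q q0 => // k IH m q q0 mk.
have [->|m0] := eqVneq m mnm0; first by rewrite -ev_at0.
have [i mi] : exists i, (0 < m i)%N.
  apply: contrapT => h; move/eqP: m0; apply; apply/mnmP => i; rewrite mnm0E.
  by apply/eqP; rewrite -leqn0 leqNgt; apply/negP => mi; apply: h; exists i.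
have mU : m = mnm_add (mnm_sub m (mnm1 i)) (mnm1 i).
  apply/esym/submK; apply/mnm_lepP => j; rewrite mnmE; case: eqP => [<-|//].
  by rewrite lt0n -lt0n.
have := IH (mnm_sub m (mnm1 i)) (mderiv i q) (ev_is_derive_zero i q0).
have -> : (mdeg (mnm_sub m (mnm1 i)) < k)%N.
  by move: mk; rewrite {1}mU mdegD mdeg1 addn1.
by move=> /(_ isT); rewrite mcoeff_mderiv -mU => /eqP; rewrite mulrn_eq0 /= => /eqP.
Qed.

(** Applying T to the relation and subtracting a multiple of it removes one
    vector. *)
Lemma eigenvectors_independent (V : lmodType R) (T : {linear V -> V}) (I : eqType)
    (s : seq I) (v : I -> V) (lam : I -> R) :
  uniq s -> {in s &, injective lam} -> (forall i, T (v i) = lam i *: v i) ->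
  \sum_(i <- s) v i = 0 -> {in s, forall i, v i = 0}.
Proof.
move=> + + + ; elim: s v => // a s IH v /= /andP[as_ us] inj Tv.
rewrite big_cons => e.
have h i : i \in s -> v i = 0.
  move=> si.
  have : (lam i - lam a) *: v i = 0.
    apply: (IH (fun i => (lam i - lam a) *: v i)) si => //.
    - by move=> j k js ks; apply: inj; rewrite inE ?js ?ks orbT.
    - by move=> j; rewrite linearZ /= Tv !scalerA mulrC.
    have := congr1 T e; rewrite linear0 linearD /= linear_sum /= Tv.
    have -> : v a = - \sum_(j <- s) v j by apply/eqP; rewrite -addr_eq0 e.
    rewrite scalerN scaler_sumr addrC => /eqP; rewrite subr_eq0 => /eqP h.
    under eq_bigr do rewrite scalerBl -Tv.
    by rewrite sumrB h subrr.
  move=> /eqP; rewrite scaler_eq0 subr_eq0 => /orP[/eqP il|/eqP//].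
  have ia : i = a by apply: inj; rewrite ?inE ?eqxx ?si ?orbT.
  by move: as_; rewrite -ia si.
move=> i; rewrite inE => /orP[/eqP ->|/h//].
by move: e; rewrite big_seq big1 ?addr0// => j /h.
Qed.

End PolynomialIdentity.

Section Rotation.
Context {R : realType} {d : nat} (ix iy : 'I_d) (xy : ix != iy).
Local Notation poly := (mpoly d R).
Implicit Types (q f g : poly).

(** The infinitesimal rotation of the z-plane; its square acts as - m^2 on the
    harmonics of angular frequency m. *)
Definition rot q : poly := var ix * mderiv iy q - var iy * mderiv ix q.

Lemma rot_is_linear : linear rot.
Proof.
move=> c f g; rewrite /rot !mderivD !mderivZ -!mul_mpolyC; ring.
Qed.
HB.instance Definition _ := GRing.isLinear.Build R poly poly _ rot rot_is_linear.

Lemma rotM f g : rot (f * g) = rot f * g + f * rot g.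
Proof. by rewrite /rot !mderivM; ring. Qed.

Lemma rot_wpoly q : wpoly ix iy q -> rot q = 0.
Proof. by move=> [qx qy]; rewrite /rot qx qy !mulr0 subr0. Qed.

Lemma rot_zsqXn k : rot (zsq ix iy ^+ k) = 0.
Proof.
elim: k => [|k IH]; first by rewrite expr0 /rot -mpolyC1 !mderivC !mulr0 subr0.
rewrite exprS rotM IH mulr0 addr0 /rot (mderivx_zsq xy) (mderivy_zsq xy).
by rewrite -!mul_mpolyC; ring.
Qed.

Lemma rot_z m : rot (zre ix iy m) = - m%:R *: zim ix iy m /\
  rot (zim ix iy m) = m%:R *: zre ix iy m.
Proof.
rewrite /rot; have [-> -> -> ->] := @mderiv_z R d ix iy xy m.
case: m => [|m]; first by rewrite !scale0r !oppr0 scale0r !mulr0 subr0.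
rewrite /= zreS zimS scaleNr -!mul_mpolyC; split; ring.
Qed.

Definition hext_factor N m q : poly :=
  \sum_(k < N) hcoef m k *: (iter k lap q * zsq ix iy ^+ k).

Lemma hextE N m q : hext ix iy N m q = hext_factor N m q * zim ix iy m.
Proof.
by rewrite /hext /hext_factor mulr_suml; apply: eq_bigr => k _; rewrite -scalerAl mulrA.
Qed.

Lemma rot_hext_factor N m q : wpoly ix iy q -> rot (hext_factor N m q) = 0.
Proof.
move=> wq; rewrite raddf_sum big1// => k _ /=; rewrite linearZ /= rotM rot_zsqXn.
by rewrite rot_wpoly ?mul0r ?mulr0 ?addr0 ?scaler0//; exact: wpoly_iter_lap.
Qed.

Lemma rot2_hext N m q : wpoly ix iy q ->
  rot (rot (hext ix iy N m q)) = - (m%:R ^+ 2) *: hext ix iy N m q.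
Proof.
move=> wq; rewrite hextE; set F := hext_factor N m q.
have F0 : rot F = 0 by exact: rot_hext_factor.
rewrite rotM F0 mul0r add0r (rot_z m).2 -scalerAr linearZ /= rotM F0 mul0r add0r.
by rewrite (rot_z m).1 -!scalerAr !scalerA; congr (_ *: _); ring.
Qed.

End Rotation.

(** * A basis of the antiinvariant harmonics *)

Lemma rising_factorial_bin (N t : nat) :
  (rising_factorial N.+1 t = 'C(t + N, t) * t`!)%N.
Proof.
have h : (rising_factorial N.+1 t * N`! = (t + N)`!)%N.
  elim: t => [|t IH]; first by rewrite /rising_factorial big_geq// mul1n.
  rewrite /rising_factorial big_nat_recr//= -/(rising_factorial _ _).
  by rewrite mulnAC IH !addSn factS mulnC addnC.
have := bin_fact (leq_addr N t); rewrite addnC addnK addnC -h mulnA => /eqP.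
by rewrite eqn_pmul2r ?fact_gt0// => /eqP ->.
Qed.

Lemma card_compositions (k N : nat) : (0 < k)%N ->
  #|{: {t : k.-tuple 'I_N.+1 | (\sum_(i <- t) i == N)%N}}| = 'C(k.-1 + N, k.-1).
Proof.
case: k => // k _; rewrite card_sig -card_ord_partitions /=.
by apply: eq_card => t; rewrite !inE.
Qed.

Section Basis.
Context {R : realType} (n p K : nat) (n1 : (1 < n)%N) (p0 : (0 < p)%N) (pK : (p <= K)%N).
Local Notation poly := (mpoly n.+1 R).
Local Notation point := 'rV[R]_n.+1.
Local Notation ix := (ix n).
Local Notation iy := (iy n).
Local Notation D := (lune R n p).
Local Notation aharm := (@aharm R n ix iy p).
Let xy : ix != iy := ix_iy n1.

Definition wmon (f : nat -> nat) : multinom n.+1 :=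
  Multinom (mktuple (fun i : 'I_n.+1 => if (i < n.-1)%N then f i else 0%N)).

Lemma wmonE f i : wmon f i = if (i < n.-1)%N then f i else 0%N.
Proof. by rewrite multinomE tnth_mktuple. Qed.

Lemma mdeg_wmon f : mdeg (wmon f) = (\sum_(i < n.-1) f i)%N.
Proof.
rewrite mdegE; under eq_bigr do rewrite wmonE.
rewrite -(big_mkord xpredT (fun i => if (i < n.-1)%N then f i else 0%N)).
rewrite (big_cat_nat (n := n.-1))//=; last by lia.
rewrite [X in (_ + X)%N]big_nat [X in (_ + X)%N]big1 ?addn0 => [|i /andP[ni _]]; last first.
  by rewrite ltnNge ni.
rewrite big_mkord; apply: eq_bigr => i _; by rewrite ltn_ord.
Qed.

Lemma wpoly_wmon f : wpoly ix iy (mpolyX R (wmon f)).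
Proof.
split; rewrite mderivX wmonE.
  by rewrite val_ix ltnn scale0r.
by rewrite val_iy ltnNge leq_pred scale0r.
Qed.

Let m := (K %/ p - 1)%N.
Let r := (K %% p)%N.

Let Km : K = (m.+1 * p + r)%N.
Proof.
rewrite {1}(divn_eq K p) /m subn1 prednK//.
by rewrite divn_gt0.
Qed.

Definition exponents (s : nat) :=
  {t : n.-1.-tuple 'I_(s * p + r).+1 | (\sum_(i <- t) i == s * p + r)%N}.
(** The summand s of the multiplicity formula counts the monomials in w of degree
    s p + r; their harmonic extensions of degree K have angular frequency
    K - (s p + r), which is freq s. *)
Definition basis_index := {s : 'I_m.+1 & exponents s}.

Let index_at (s : 'I_m.+1) (t : exponents s) : basis_index :=
  Tagged (fun s : 'I_m.+1 => exponents s) t.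

Definition freq (s : nat) := ((m.+1 - s) * p)%N.

Let fexp (N : nat) (t : n.-1.-tuple 'I_N.+1) (i : nat) : nat := nth ord0 t i.

Definition basis_poly (j : basis_index) : poly :=
  hext ix iy (tag j * p + r).+1 (freq (tag j)) (mpolyX R (wmon (fexp (val (tagged j))))).

Let sum_fexp N (t : n.-1.-tuple 'I_N.+1) : (\sum_(i < n.-1) fexp t i = \sum_(i <- t) i)%N.
Proof. by rewrite big_tuple; apply: eq_bigr => i _; rewrite (tnth_nth ord0). Qed.

Lemma hom_exponents s (t : exponents s) :
  hom (s * p + r) (mpolyX R (wmon (fexp (val t)))).
Proof.
rewrite /hom euler_homX mdeg_wmon sum_fexp.
by rewrite (eqP (valP t)).
Qed.

Let freqE (s : 'I_m.+1) : (s * p + r + freq s = K)%N.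
Proof.
have sm := ltn_ord s; rewrite addnAC -mulnDl subnKC ?Km//.
exact: ltnW.
Qed.

Let freq_gt0 (s : 'I_m.+1) : (0 < m.+1 - s)%N.
Proof. by rewrite subn_gt0. Qed.

Lemma aharm_basis j : aharm K (basis_poly j).
Proof.
apply: aharm1; [exact: freq_gt0|exact: freqE|exact: wpoly_wmon|].
exact: hom_exponents.
Qed.

Lemma aharm_sum (c : basis_index -> R) : aharm K (\sum_j c j *: basis_poly j).
Proof.
apply: big_ind => [|P Q|j _]; first exact: aharm0.
  exact: aharmD.
exact/aharmZ/aharm_basis.
Qed.

Let spanned (P : poly) := exists c : basis_index -> R, P = \sum_j c j *: basis_poly j.

Let spanned0 : spanned 0.
Proof. by exists (fun=> 0); rewrite big1// => j _; rewrite scale0r. Qed.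

Let spannedD P Q : spanned P -> spanned Q -> spanned (P + Q).
Proof.
move=> [c ->] [c' ->]; exists (fun j => c j + c' j).
by rewrite -big_split; apply: eq_bigr => j _; rewrite scalerDl.
Qed.

Let spannedZ a P : spanned P -> spanned (a *: P).
Proof.
move=> [c ->]; exists (fun j => a * c j).
by rewrite scaler_sumr; apply: eq_bigr => j _; rewrite scalerA.
Qed.

Let spanned_basis j : spanned (basis_poly j).
Proof.
exists (fun i => (i == j)%:R); rewrite (bigD1 j)//= eqxx scale1r big1 ?addr0// => i ij.
by rewrite (negbTE ij) scale0r.
Qed.

Lemma wmon_exponents (s : nat) (mm : multinom n.+1) : mm ix = 0%N -> mm iy = 0%N ->
  mdeg mm = (s * p + r)%N -> exists t : exponents s, mm = wmon (fexp (val t)).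
Proof.
move=> mx my md; set N := (s * p + r)%N in md *.
have le (i : 'I_n.+1) : (mm i <= N)%N by rewrite -md mdegE (bigD1 i)//= leq_addr.
pose t : n.-1.-tuple 'I_N.+1 := mktuple (fun i : 'I_n.-1 => inord (mm (inord i))).
have fE i : (i < n.-1)%N -> fexp t i = mm (inord i).
  move=> ni; rewrite /fexp -[i]/(val (Ordinal ni)) -tnth_nth tnth_mktuple inordK//.
  by rewrite ltnS le.
have mmE : mm = wmon (fexp t).
  apply/mnmP => i; rewrite wmonE; case: ltnP => [ni|ni].
    by rewrite fE// inord_val.
  have [->//|ix'] := eqVneq i ix; have [->//|iy'] := eqVneq i iy.
  have := ltn_ord i; move: ix' iy'; rewrite -!val_eqE /= val_ix val_iy; lia.
have tN : (\sum_(i <- t) i == N)%N by rewrite -sum_fexp -mdeg_wmon -mmE md.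
by exists (Sub t tN).
Qed.

Lemma aharm_spanned P : aharm K P ->
  exists c : basis_index -> R, P = \sum_j c j *: basis_poly j.
Proof.
elim=> [|s j q {}P j0 sK wq hq _ IH]; first exact: spanned0.
apply: spannedD => //.
have jm : (j <= m.+1)%N.
  rewrite leqNgt; apply/negP => mj.
  have rp : (r < p)%N by rewrite ltn_mod.
  have : ((m.+2) * p <= j * p)%N by rewrite leq_mul2r mj orbT.
  by move: Km; rewrite mulSn; lia.
have sj : (m.+1 - j < m.+1)%N by lia.
pose s' : 'I_m.+1 := Ordinal sj.
have fs : freq s' = (j * p)%N by rewrite /freq /= subKn.
have ss : s = (s' * p + r)%N by have := freqE s'; rewrite fs; lia.
have qE : q = \sum_(mm <- msupp q) mcoeff mm q *: mpolyX R mm by rewrite [LHS]mpolyE.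
have hextsum (l : seq (multinom n.+1)) : hext ix iy s.+1 (j * p)
    (\sum_(mm <- l) mcoeff mm q *: mpolyX R mm) =
    \sum_(mm <- l) mcoeff mm q *: hext ix iy s.+1 (j * p) (mpolyX R mm).
  elim: l => [|a l IHl]; last by rewrite !big_cons hextD IHl.
  by rewrite !big_nil -[0 in LHS](scale0r (0 : poly)) hextZ scale0r.
rewrite qE hextsum big_seq; apply: big_ind => // mm mq.
have mc : mcoeff mm q != 0 by rewrite mcoeff_eq0 negbK.
have [mx my] := wpoly_mcoeff wq mc.
have md : mdeg mm = (s' * p + r)%N.
  by rewrite -ss; apply/eqP; apply: contraNT mc => /(hom_mcoeff hq) ->.
have [t ->] := wmon_exponents mx my md.
apply: spannedZ; have := spanned_basis (@index_at s' t).
by rewrite /basis_poly /= -/s' fs ss.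
Qed.

Lemma zim_neq0 k : (0 < k)%N -> zim ix iy k != 0 :> poly.
Proof.
move=> k0; apply/eqP => z0.
pose t : R := pi / 2 / k%:R.
pose x : point := \row_l if l == ix then cos t else if l == iy then sin t else 0.
have px : polar_at x 1 t by split; rewrite mxE eqxx mul1r// eq_sym (negbTE xy).
have := (zre_zim_polar k px).2; rewrite z0 ev0 expr1n mul1r /t.
rewrite mulrC divfK ?pnatr_eq0 -?lt0n// sin_pihalf => /esym/eqP.
by rewrite oner_eq0.
Qed.

(** Where z = 0, the factor of Im z^k in the extension of q is equal to q. *)
Lemma hext_eq0 N k (q : poly) : (0 < k)%N -> wpoly ix iy q -> hext ix iy N.+1 k q = 0 -> q = 0.
Proof.
move=> k0 wq; rewrite hextE => /eqP; rewrite mulf_eq0 (negbTE (zim_neq0 k0)) orbF => /eqP F0.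
apply: ev_eq0 => x.
pose y : point := \row_l if (l == ix) || (l == iy) then 0 else x 0 l.
have -> : ev q x = ev q y.
  by apply: (ev_wpoly wq) => l lx ly; rewrite mxE (negbTE lx) (negbTE ly).
have yz : ev (zsq ix iy) y = 0.
  by rewrite /zsq !evE !mxE !eqxx orbT expr0n addr0.
have := congr1 (fun f => ev f y) F0; rewrite /= ev0 /hext_factor ev_sum big_ord_recl /=.
rewrite big1 => [|i _]; last by rewrite evZ evM evXn yz expr0n /= !mulr0.
by rewrite addr0 expr0 mulr1 /hcoef scale1r.
Qed.

(** Vanishing on the lune extends to the sphere by antiinvariance and to all
    points by homogeneity, which gives an identity between polynomials. The square
    of the infinitesimal rotation separates the angular frequencies, and for one
    frequency the extended polynomials in w are determined by the extension. *)
Lemma basis_independent (c : basis_index -> R) :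
  (forall x, D x -> \sum_j c j * ev (basis_poly j) x = 0) -> forall j, c j = 0.
Proof.
move=> c0.
pose G := \sum_j c j *: basis_poly j.
have aG : aharm K G by exact: aharm_sum.
have evG x : ev G x = \sum_j c j * ev (basis_poly j) x.
  by rewrite ev_sum; apply: eq_bigr => j _; rewrite evZ.
have G0 : G = 0.
  have Gs x : ev r2 x = 1 -> ev G x = 0.
    move=> x1; have [y [s [Dy _ h]]] := aharm_fold n1 p0 x1.
    by rewrite (h _ _ aG) evG c0// mulr0.
  apply: ev_eq0 => x; have hG := aharm_hom xy aG.
  have [xz|xz] := eqVneq (ev r2 x) 0.
    have -> : x = 0 *: x.
      apply/matrixP => i l; rewrite (ord1 i) mxE mul0r; apply/eqP.
      by rewrite -sqrf_eq0 eq_le sqr_ge0 andbT -xz coord_le_r2.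
    by rewrite (ev_hom _ _ hG) expr0n gtn_eqF ?mul0r// (leq_trans p0).
  have x0 : 0 < ev r2 x by rewrite lt_neqAle eq_sym xz ev_r2_ge0.
  have N0 : 0 < enorm x by rewrite enormE sqrtr_gt0.
  have -> : x = enorm x *: ((enorm x)^-1 *: x) by rewrite scalerA divff ?scale1r// gt_eqF.
  rewrite (ev_hom _ _ hG) Gs ?mulr0// ev_r2Z exprVn enormE sqr_sqrtr ?ev_r2_ge0//.
  by rewrite mulVf.
pose q (s : 'I_m.+1) : poly :=
  \sum_(t : exponents s) c (@index_at s t) *: mpolyX R (wmon (fexp (val t))).
have wq s : wpoly ix iy (q s).
  apply: big_ind => [|f g|t _]; first exact: wpoly0.
    exact: wpolyD.
  exact/wpolyZ/wpoly_wmon.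
pose v (s : 'I_m.+1) := hext ix iy (s * p + r).+1 (freq s) (q s).
have vE (s : 'I_m.+1) : v s = \sum_(t : exponents s)
    c (@index_at s t) *: basis_poly (@index_at s t).
  rewrite /v /q /hext; under eq_bigr => k _.
    have -> : iter k lap (\sum_(t : exponents s) c (@index_at s t) *:
        mpolyX R (wmon (fexp (val t)))) = \sum_(t : exponents s) c (@index_at s t) *:
        iter k lap (mpolyX R (wmon (fexp (val t)))).
      elim: (k : nat) => //= l ->; rewrite raddf_sum; apply: eq_bigr => t _.
      by rewrite /= lapZ.
    rewrite mulr_suml scaler_sumr.
    over.
  rewrite exchange_big; apply: eq_bigr => t _ /=.
  rewrite /basis_poly /hext scaler_sumr; apply: eq_bigr => k _ /=.
  by rewrite -scalerAl !scalerA mulrC.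
have sumv : \sum_(s <- enum 'I_m.+1) v s = 0.
  rewrite big_enum /= -[RHS]G0; under eq_bigr do rewrite vE.
  rewrite (@sig_big_dep _ _ _ _ (fun s : 'I_m.+1 => exponents s) xpredT (fun _ => xpredT)
    (fun (s : 'I_m.+1) (t : exponents s) => c (@index_at s t) *: basis_poly (@index_at s t))).
  by apply: eq_bigr => -[s t] _.
have inj : {in enum 'I_m.+1 &, injective (fun s : 'I_m.+1 => - ((freq s)%:R ^+ 2) : R)}.
  move=> s s' _ _ /oppr_inj /eqP; rewrite eqrXn2// eqr_nat => /eqP.
  rewrite /freq => /eqP; rewrite eqn_pmul2r// => /eqP e; apply/val_inj => /=.
  by have := ltn_ord s; have := ltn_ord s'; lia.
have v0 (s : 'I_m.+1) : v s = 0.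
  pose T : {linear poly -> poly} := (rot ix iy \o rot ix iy).
  apply: (@eigenvectors_independent R poly T _ (enum 'I_m.+1) v
     (fun s => - ((freq s)%:R ^+ 2))) => //.
  - exact: enum_uniq.
  - by move=> i; rewrite /= (rot2_hext xy).
  - by rewrite mem_enum.
move=> [s t].
have q0 : q s = 0.
  apply: (@hext_eq0 (s * p + r) (freq s)) => //; last exact: v0.
  by rewrite /freq muln_gt0 freq_gt0.
have := congr1 (mcoeff (wmon (fexp (val t)))) q0.
rewrite mcoeff0 /q raddf_sum (bigD1 t)//= mcoeffZ mcoeffX eqxx mulr1.
rewrite big1 ?addr0// => t' tt'; rewrite mcoeffZ mcoeffX; case: eqP => [e|]; last by rewrite mulr0.
case/eqP: tt'; apply/val_inj/eq_from_tnth => i; apply/val_inj.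
have := congr1 (fun mm : multinom n.+1 => mm (inord i)) e; rewrite /= !wmonE.
have ni := ltn_ord i; rewrite inordK ?ni; last by lia.
by rewrite /fexp -!tnth_nth.
Qed.

Lemma card_basis_index :
  #|{: basis_index}| = (\sum_(0 <= s < m.+1) 'C(n - 2 + (s * p + r), n - 2))%N.
Proof.
rewrite card_tagged sumnE big_map big_enum big_mkord /=; apply: eq_bigr => s _.
by rewrite card_compositions; [congr 'C(_ + _, _); lia|lia].
Qed.

End Basis.

(** * The spectrum of the lune *)

Section Spectrum.
Context {R : realType} (n p : nat) (n1 : (1 < n)%N) (p0 : (0 < p)%N).
Local Notation poly := (mpoly n.+1 R).
Local Notation point := 'rV[R]_n.+1.
Local Notation ix := (ix n).
Local Notation iy := (iy n).
Local Notation D := (lune R n p).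
Local Notation aharm := (@aharm R n ix iy p).
Local Notation level K := (K%:R * (K%:R + n%:R - 1) : R).
Implicit Types (K : nat) (P : poly) (u : point -> R) (x : point).
Let xy : ix != iy := ix_iy n1.

Lemma aharm_eigenfunction K P : aharm K P ->
  dirichlet_eigenspace D (level K) (restrict D (ev P)).
Proof.
move=> aP; apply: harmonic_eigenfunction; [exact: aharm_hom aP|exact: aharm_lap aP|].
by move=> x /(lune_boundary_zim n1 p0); exact: aharm_vanish aP.
Qed.

Lemma sphere_eigenfunction K P : hom K P -> lap P = 0 ->
  dirichlet_eigenspace (sphere R n) (level K) (restrict (sphere R n) (ev P)).
Proof.
move=> hP lP; apply: harmonic_eigenfunction => // x [Sx []]; split => //.
exact: nearW.
Qed.

Lemma basis_nonzero K : (p <= K)%N -> exists2 P, aharm K P & exists2 x, D x & ev P x != 0.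
Proof.
move=> pK; have : (0 < #|{: basis_index n p K}|)%N.
  by rewrite (card_basis_index n1 p0 pK) big_nat_recl// addn_gt0 bin_gt0 leq_addr.
case/card_gt0P => j _; exists (basis_poly j); first exact: aharm_basis.
apply: contrapT => no; have /eqP := oner_neq0 R; apply.
have := @basis_independent R n p K n1 p0 pK (fun i => (i == j)%:R).
move/(_ _ j); rewrite eqxx; apply => x Dx.
rewrite (bigD1 j)//= eqxx mul1r big1 ?addr0 => [|i /negbTE ->]; last by rewrite mul0r.
by apply: contrapT => /eqP nz; apply: no; exists x.
Qed.

(** If a is the positive solution of a (a + n - 1) = lambda, then u is a uniform limit
    of antiinvariant harmonics of degree a. These are 0 unless a is an
    integer at least p. *)
Lemma lune_eigenvalueP lambda : dirichlet_eigenvalues D lambda <->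
  exists2 K, (p <= K)%N & lambda = level K.
Proof.
split=> [[u eu u0]|[K pK ->]]; last first.
  have [P aP [x Dx Px]] := basis_nonzero pK.
  exists (restrict D (ev P)); first exact: aharm_eigenfunction.
  by move=> /(congr1 (fun f => f x)); rewrite restrict_in// => /eqP; rewrite (negbTE Px).
have l0 : 0 < lambda.
  rewrite ltNge; apply/negP => l0; apply: u0; apply/funext => x.
  exact: (nonpos_eigen n1 p0 eu).
pose b : R := n%:R - 1.
have b0 : 0 <= b by rewrite subr_ge0 ler1n ltnW.
have sq : b < Num.sqrt (b ^+ 2 + 4 * lambda).
  rewrite -{1}(ger0_norm b0) -sqrtr_sqr ltr_sqrt.
    by rewrite ltrDl mulr_gt0.
  by rewrite ltr_wpDl ?sqr_ge0// mulr_gt0.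
have sq2 : Num.sqrt (b ^+ 2 + 4 * lambda) ^+ 2 = b ^+ 2 + 4 * lambda.
  by rewrite sqr_sqrtr// addr_ge0 ?sqr_ge0// mulr_ge0// ltW.
pose a := (Num.sqrt (b ^+ 2 + 4 * lambda) - b) / 2.
have a0 : 0 < a by rewrite divr_gt0// subr_gt0.
have al : a * (a + n%:R - 1) = lambda.
  rewrite -addrA -/b /a; move: sq2; set s := Num.sqrt _ => sq2.
  have -> : (s - b) / 2 * ((s - b) / 2 + b) = (s ^+ 2 - b ^+ 2) / 4 by field.
  by rewrite sq2; field.
apply: contrapT => no; apply: u0; apply/funext => x.
have [Dx|Dx] := pselect (D x); last by have [-> //] := eu.
apply/eqP; rewrite -normr_le0; apply/ler_addgt0Pl => e e0; rewrite addr0.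
have [P [m [aP h]]] := eigen_limit n1 p0 eu a0 al e0.
have := h x Dx; rewrite big1 ?subr0// => k /eqP ak.
rewrite (aharm_small xy _ (aP k)) ?ev0// ltnNge; apply/negP => pk.
by apply: no; exists (k : nat) => //; rewrite -ak.
Qed.

(** The antiinvariant harmonics are eigenfunctions of the whole sphere as well, and
    the constants have the eigenvalue 0, which does not belong to the lune. *)
Lemma lune_sphere_proper : dirichlet_eigenvalues D `<` dirichlet_eigenvalues (sphere R n).
Proof.
split.
  move=> lambda /lune_eigenvalueP [K pK ->].
  have [P aP [x Dx Px]] := basis_nonzero pK.
  exists (restrict (sphere R n) (ev P)).
    by apply: sphere_eigenfunction; [exact: aharm_hom aP|exact: aharm_lap aP].
  move=> /(congr1 (fun f => f x)); rewrite restrict_in; last by case: Dx.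
  by move=> /eqP; rewrite (negbTE Px).
move=> /(_ 0); have S0 : dirichlet_eigenvalues (sphere R n) 0.
  exists (restrict (sphere R n) (ev (mpolyC n.+1 1))).
    have -> : 0 = level 0 by rewrite mul0r.
    apply: sphere_eigenfunction; first exact: homC.
    by rewrite /lap big1// => i _; rewrite mderivC raddf0.
  pose x : point := \row_i (i == 0)%:R.
  move=> /(congr1 (fun f => f x)); rewrite restrict_in; last first.
    rewrite /sphere /= /enorm (bigD1 0)//= mxE eqxx big1 ?addr0 ?expr1n ?sqrtr1//.
    by move=> i /negbTE i0; rewrite mxE i0 expr0n.
  by rewrite evC => /eqP; rewrite oner_eq0.
move=> /(_ S0) [u eu u0]; apply: u0; apply/funext => x.
exact: (nonpos_eigen n1 p0 eu).
Qed.

(** Eigenfunctions are uniform limits of elements of the span of the basis, which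
    is closed since it has finite dimension. *)
Lemma lune_multiplicity K : (p <= K)%N ->
  has_multiplicity D (level K) #|{: basis_index n p K}|.
Proof.
move=> pK; pose b (i : 'I_#|{: basis_index n p K}|) : point -> R := restrict D (ev (basis_poly (enum_val i))).
have sumb (c : 'I_#|{: basis_index n p K}| -> R) x :
    (\sum_i c i *: b i) x = \sum_i c i * b i x by rewrite fct_sumE.
have sumE (c : 'I_#|{: basis_index n p K}| -> R) x : D x ->
    \sum_i c i * b i x = ev (\sum_j c (enum_rank j) *: basis_poly j) x.
  move=> Dx; rewrite ev_sum (reindex (@enum_rank (basis_index n p K)))/=.
    by apply: eq_bigr => j _; rewrite evZ /b enum_rankK; congr (_ * _); exact: restrict_in.
  exact/onW_bij/enum_rank_bij.
have indep (c : 'I_#|{: basis_index n p K}| -> R) :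
    (forall x, D x -> \sum_i c i * b i x = 0) -> forall i, c i = 0.
  move=> c0 i; rewrite -(enum_valK i).
  apply: (@basis_independent R n p K n1 p0 pK (fun j => c (enum_rank j))) => x Dx.
  rewrite -[RHS](c0 x Dx) sumE// ev_sum.
  by apply: eq_bigr => j _; rewrite evZ.
exists b; split.
  move=> c c0; apply: indep => x Dx.
  by rewrite -sumb c0.
move=> u; split=> [eu|[c ->]]; last first.
  have -> : \sum_i c i *: b i = restrict D (ev (\sum_j c (enum_rank j) *: basis_poly j)).
    apply/funext => x; have [Dx|Dx] := pselect (D x).
      by rewrite restrict_in// sumb sumE.
    rewrite restrict_out// sumb big1// => i _.
    by rewrite /b restrict_out// mulr0.
  exact/aharm_eigenfunction/aharm_sum.
have K0 : 0 < K%:R :> R by rewrite ltr0n (leq_trans p0).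
have [eta eta0|c h] := span_closed (S := D) indep (u := u).
  have [P [m [aP h]]] := eigen_limit n1 p0 eu K0 erefl eta0.
  have [c PK] : exists c : basis_index n p K -> R, forall x,
      \sum_(k < m | K%:R == k%:R :> R) ev (P k) x = ev (\sum_j c j *: basis_poly j) x.
    have [Km|mK] := ltnP K m.
      have [c PK] := aharm_spanned n1 p0 pK (aP K); exists c => x.
      rewrite -PK (big_pred1 (Ordinal Km))// => k.
      by rewrite /= eqr_nat eq_sym.
    exists (fun=> 0) => x; rewrite [in RHS]big1 => [|j _]; last by rewrite scale0r.
    rewrite ev0 big1// => k; rewrite eqr_nat => /eqP kK.
    by have := ltn_ord k; rewrite -kK ltnNge mK.
  exists (fun i => c (enum_val i)) => x Dx; have := h x Dx; rewrite PK.
  have -> // : ev (\sum_j c j *: basis_poly j) x = \sum_i c (enum_val i) * b i x.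
  rewrite sumE//.
  by congr (ev _ x); apply: eq_bigr => j _; rewrite enum_rankK.
exists c; apply/funext => x; rewrite sumb; have [Dx|Dx] := pselect (D x).
  exact: h.
have [-> //] := eu; rewrite big1// => i _.
by rewrite /b restrict_out// mulr0.
Qed.

End Spectrum.

Theorem theorem5 (R : realType) (n p : nat) (hn : (2 <= n)%N) (hp : (1 <= p)%N) :
  [/\ dirichlet_eigenvalues (lune R n p) =
        [set lambda | exists2 K : nat,
           (p <= K)%N & lambda = K%:R * (K%:R + n%:R - 1)],
      dirichlet_eigenvalues (lune R n p) `<` dirichlet_eigenvalues (sphere R n)
    & forall K : nat, (p <= K)%N ->
        let m := (K %/ p - 1)%N in
        let r := (K %% p)%N in
        exists2 d : nat,
          has_multiplicity (lune R n p) (K%:R * (K%:R + n%:R - 1)) d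
        & d%:R = \sum_(0 <= s < m.+1)
            (rising_factorial (s * p + r + 1) (n - 2))%:R / ((n - 2)`!)%:R :> R].
Proof.
split.
- by apply/seteqP; split => lambda /(lune_eigenvalueP hn hp).
- exact: lune_sphere_proper.
- move=> K pK m r; exists #|{: basis_index n p K}|; first exact: lune_multiplicity.
  rewrite (card_basis_index hn hp pK) natr_sum; apply: eq_bigr => s _.
  by rewrite addn1 rising_factorial_bin natrM mulfK// pnatr_eq0 -lt0n fact_gt0.
Qed.
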